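(* Let $V^0=\mathbb C\,(h_1-2h_3)$ and $Y(0)=\mathrm{Fib}(0)/(V^0\oplus\mathrm{Fib})$. Then, as $\mathrm{Fib}$-modules, $$\mathrm{Fib}(0)\cong V^0\oplus\mathrm{Fib}\oplus Y(0)_-\oplus Y(0)_+,$$ where $Y(0)_-$ and $Y(0)_+$ are direct sums of lowest-weight and highest-weight $\mathrm{Fib}$-modules, respectively.
   Context: Let $A=(a_{ij})=\begin{pmatrix}2&-2&0\\-2&2&-1\\0&-1&2\end{pmatrix}$ and let $\mathcal F$ be the Kac–Moody Lie algebra over $\mathbb C$ with generalized Cartan matrix $A$: generators $h_i,e_i,f_i$ ($i=1,2,3$), relations $[h_i,h_j]=0$, $[h_i,e_j]=a_{ij}e_j$, $[h_i,f_j]=-a_{ij}f_j$, $[e_i,f_j]=\delta_{ij}h_i$, $(\mathrm{ad}\,e_i)^{1-a_{ij}}e_j=0=(\mathrm{ad}\,f_i)^{1-a_{ij}}f_j$ for $i\ne j$. Cartan subalgebra $\mathfrak h=\bigoplus_i\mathbb Ch_i$; simple roots $\alpha_j\in\mathfrak h^*$ with $\alpha_j(h_i)=a_{ij}$; $\Phi$ is the set of roots, $\mathcal F_\alpha$ the root spaces. Let $e_{1123}=[e_1,[e_1,[e_2,e_3]]]$, $f_{1123}=[f_1,[f_1,[f_2,f_3]]]$. Put $\beta_1=2\alpha_1+\alpha_2+\alpha_3$, $\beta_2=\alpha_2$, $E_1=\frac12e_{1123}$, $F_1=-\frac12f_{1123}$, $H_1=2h_1+h_2+h_3$, $E_2=e_2$,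 $F_2=f_2$, $H_2=h_2$. $\mathrm{Fib}$ is the subalgebra of $\mathcal F$ generated by $E_i,F_i,H_i$ ($i=1,2$); it is isomorphic to the Kac–Moody algebra with Cartan matrix $\begin{pmatrix}2&-3\\-3&2\end{pmatrix}$, with Cartan subalgebra $\mathfrak h_{\mathrm{Fib}}=\mathbb CH_1\oplus\mathbb CH_2$, and $\mathfrak h_{\mathrm{Fib}}^*$ is identified with $\mathbb C\beta_1\oplus\mathbb C\beta_2$. Fundamental weights $\lambda_1=-\frac15(2\beta_1+3\beta_2)$, $\lambda_2=-\frac15(3\beta_1+2\beta_2)$; $wt(n_1\lambda_1+n_2\lambda_2)=n_1+n_2$. $\Delta_0=\{x\alpha_1+y\alpha_2+z\alpha_3\in\Phi:2z-x=0\}$ and $\mathrm{Fib}(0)=\mathfrak h\oplus\bigoplus_{\beta\in\Delta_0}\mathcal F_\beta$, a $\mathrm{Fib}$-module under the restricted adjoint action; $V^0$ is a one-dimensional trivial submodule and $\mathrm{Fib}\subset\mathrm{Fib}(0)$ is the adjoint submodule. For a diagonalizable $\mathrm{Fib}$-module $V=\bigoplus_\mu V_\mu$, with $V_\mu=\{v:H\cdot v=\mu(H)v\ \forall H\in\mathfrak h_{\mathrm{Fib}}\}$, put $V_+=\bigoplus_{wt(\mu)\ge0}V_\mu$ and $V_-=\bigoplus_{wt(\mu)<0}V_\mu$. A highest-weight (resp. lowest-weight) module is one generated by a nonzero weight vector annihilated by $E_1,E_2$ (resp. $F_1,F_2$). *)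

(* Defs.v *)
From HB Require Import structures.
From mathcomp Require Import all_boot all_order all_algebra.
From mathcomp Require Import ring boolp classical_sets.

Set Implicit Arguments.
Unset Strict Implicit.
Unset Printing Implicit Defensive.

Import Order.TTheory GRing.Theory Num.Theory.
Local Open Scope classical_set_scope.
Local Open Scope ring_scope.
Local Open Scope quotient_scope.

HB.mixin Record Lmodule_isLieAlgebra (K : fieldType) L of GRing.Lmodule K L := {
  lie : L -> L -> L;
  lie_linearl : forall y, linear (lie^~ y);
  lie_linearr : forall x, linear (lie x);
  liexx : forall x, lie x x = 0;
  lie_jacobi : forall x y z,
    lie x (lie y z) + lie y (lie z x) + lie z (lie x y) = 0 }.

#[short(type="lieAlgType")]
HB.structure Definition LieAlgebra (K : fieldType) :=
  {L of Lmodule_isLieAlgebra K L & GRing.Lmodule K L}.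

HB.mixin Record Lmodule_isLieModule (K : fieldType) (g : lieAlgType K) V
    of GRing.Lmodule K V := {
  act : g -> V -> V;
  act_linearl : forall v, linear (act^~ v);
  act_linearr : forall x, linear (act x);
  act_lie : forall x y v, act (lie x y) v = act x (act y v) - act y (act x v) }.

#[short(type="lieModType")]
HB.structure Definition LieModule (K : fieldType) (g : lieAlgType K) :=
  {V of Lmodule_isLieModule K g V & GRing.Lmodule K V}.

Section LieTheory.
Variables (K : fieldType) (L : lieAlgType K).
Implicit Types x y z : L.

Lemma lieDl x y z : lie (x + y) z = lie x z + lie y z.
Proof. by have := lie_linearl z 1 x y; rewrite !scale1r. Qed.
Lemma lieDr x y z : lie x (y + z) = lie x y + lie x z.
Proof. by have := lie_linearr x 1 y z; rewrite !scale1r. Qed.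
Lemma lie0x x : lie 0 x = 0.
Proof. by apply: (@addrI _ (lie 0 x)); rewrite -lieDl !addr0. Qed.
Lemma liex0 x : lie x 0 = 0.
Proof. by apply: (@addrI _ (lie x 0)); rewrite -lieDr !addr0. Qed.
Lemma lieZl a x y : lie (a *: x) y = a *: lie x y.
Proof. by have := lie_linearl y a x 0; rewrite lie0x !addr0. Qed.
Lemma lieZr a x y : lie x (a *: y) = a *: lie x y.
Proof. by have := lie_linearr x a y 0; rewrite liex0 !addr0. Qed.
Lemma lieNl x y : lie (- x) y = - lie x y.
Proof. by rewrite -scaleN1r lieZl scaleN1r. Qed.
Lemma lieNr x y : lie x (- y) = - lie x y.
Proof. by rewrite -scaleN1r lieZr scaleN1r. Qed.
Lemma lieC x y : lie x y = - lie y x.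
Proof.
apply/eqP; rewrite -addr_eq0; apply/eqP.
by have := liexx (x + y); rewrite lieDl !lieDr !liexx add0r addr0.
Qed.
Lemma lie_leibniz x y z : lie x (lie y z) = lie (lie x y) z + lie y (lie x z).
Proof.
have := lie_jacobi x y z; rewrite (lieC z x) (lieC z (lie _ _)) lieNr.
by move/eqP; rewrite subr_eq0 subr_eq => /eqP ->.
Qed.
Lemma lie_suml (I : Type) (r : seq I) (F : I -> L) y :
  lie (\sum_(i <- r) F i) y = \sum_(i <- r) lie (F i) y.
Proof.
by elim: r => [|i r IH]; rewrite ?big_nil ?lie0x // !big_cons lieDl IH.
Qed.
End LieTheory.

Section LieModuleTheory.
Variables (K : fieldType) (g : lieAlgType K) (V : lieModType g).
Implicit Types (x y : g) (v w : V).

Lemma actDl x y v : act (x + y) v = act x v + act y v.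
Proof. by have := act_linearl v 1 x y; rewrite !scale1r. Qed.
Lemma actDr x v w : act x (v + w) = act x v + act x w.
Proof. by have := act_linearr x 1 v w; rewrite !scale1r. Qed.
Lemma actx0 x : act x (0 : V) = 0.
Proof. by apply: (@addrI _ (act x 0)); rewrite -actDr !addr0. Qed.
Lemma act0v v : act (0 : g) v = 0.
Proof. by apply: (@addrI _ (act 0 v)); rewrite -actDl !addr0. Qed.
Lemma actZr x a v : act x (a *: v) = a *: act x v.
Proof. by have := act_linearr x a v 0; rewrite actx0 !addr0. Qed.
Lemma actBr x v w : act x (v - w) = act x v - act x w.
Proof. by rewrite actDr -scaleN1r actZr scaleN1r. Qed.
End LieModuleTheory.

Inductive lspan (K : fieldType) (V : lmodType K) (S : set V) : V -> Prop :=
| lspan0 : lspan S 0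
| lspanD a x y : S x -> lspan S y -> lspan S (a *: x + y).

Section Span.
Variables (K : fieldType) (V : lmodType K).
Implicit Types S T : set V.

Lemma lspan_in S x : S x -> lspan S x.
Proof.
by move=> Sx; rewrite -[x]addr0 -[x in x + _]scale1r; apply/lspanD/lspan0.
Qed.

Lemma lspan_lin S a x y : lspan S x -> lspan S y -> lspan S (a *: x + y).
Proof.
move=> Sx Sy; elim: {x}Sx => [|b x z Sx _ IH]; first by rewrite scaler0 add0r.
by rewrite scalerDr scalerA -addrA; apply: lspanD.
Qed.

Lemma lspan_add S x y : lspan S x -> lspan S y -> lspan S (x + y).
Proof. by move=> Sx Sy; rewrite -[x]scale1r; apply: lspan_lin. Qed.

Lemma lspan_scale S a x : lspan S x -> lspan S (a *: x).
Proof.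
by move=> Sx; rewrite -[_ *: _]addr0; apply: lspan_lin => //; apply: lspan0.
Qed.

Lemma lspan_opp S x : lspan S x -> lspan S (- x).
Proof. by move=> Sx; rewrite -scaleN1r; apply: lspan_scale. Qed.

End Span.

Lemma lspan_map (K : fieldType) (V W : lmodType K) (f : V -> W) (S : set V)
    (T : set W) :
  linear f -> (forall x, S x -> lspan T (f x)) ->
  forall x, lspan S x -> lspan T (f x).
Proof.
move=> fL fS x; have f0 : f 0 = 0.
  by have := fL (-1) 0 0; rewrite scaler0 addr0 scaleN1r addNr.
elim=> [|a {}x y Sx _ IH]; first by rewrite f0; apply: lspan0.
by rewrite fL; apply: lspan_lin => //; apply: fS.
Qed.


Record subalg (K : fieldType) (L : lieAlgType K) := Subalg {
  subalg_set :> L -> Prop;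
  subalg0 : subalg_set 0;
  subalg_lin : forall a x y,
    subalg_set x -> subalg_set y -> subalg_set (a *: x + y);
  subalg_lie : forall x y, subalg_set x -> subalg_set y -> subalg_set (lie x y) }.

Section SubalgType.
Variables (K : fieldType) (L : lieAlgType K) (S : subalg L).

Definition subalg_pred : {pred L} := fun x => `[< S x >].

Fact subalg_pred_closed : submod_closed subalg_pred.
Proof.
split=> [|a x y /asboolP Sx /asboolP Sy]; apply/asboolP; first exact: subalg0.
exact: subalg_lin.
Qed.
HB.instance Definition _ :=
  GRing.isSubmodClosed.Build K L subalg_pred subalg_pred_closed.

Definition subalg_type : Type := {x : L | x \in subalg_pred}.
HB.instance Definition _ := SubChoice.on subalg_type.
HB.instance Definition _ := [SubChoice_isSubLmodule of subalg_type by <:].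

Definition subalg_lie_op (x y : subalg_type) : subalg_type :=
  exist _ (lie (val x) (val y))
    (asboolT (subalg_lie (asboolW (valP x)) (asboolW (valP y)))).

Fact subalg_lie_linearl y : linear (subalg_lie_op^~ y).
Proof. by move=> a x z; apply: val_inj; rewrite /= lie_linearl. Qed.
Fact subalg_lie_linearr x : linear (subalg_lie_op x).
Proof. by move=> a y z; apply: val_inj; rewrite /= lie_linearr. Qed.
Fact subalg_liexx x : subalg_lie_op x x = 0.
Proof. by apply: val_inj; rewrite /= liexx. Qed.
Fact subalg_jacobi x y z :
  subalg_lie_op x (subalg_lie_op y z) + subalg_lie_op y (subalg_lie_op z x)
    + subalg_lie_op z (subalg_lie_op x y) = 0.
Proof. by apply: val_inj; rewrite /= lie_jacobi. Qed.

HB.instance Definition _ := Lmodule_isLieAlgebra.Build K subalg_type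
  subalg_lie_linearl subalg_lie_linearr subalg_liexx subalg_jacobi.

End SubalgType.
Coercion subalg_type : subalg >-> Sortclass.

Definition restr_adj (K : fieldType) (L : lieAlgType K) (S : subalg L) : Type := L.
HB.instance Definition _ (K : fieldType) (L : lieAlgType K) (S : subalg L) :=
  GRing.Lmodule.copy (restr_adj S) L.

Section RestrictedAdjoint.
Variables (K : fieldType) (L : lieAlgType K) (S : subalg L).

Definition restr_adj_act (x : S) (v : restr_adj S) : restr_adj S :=
  lie (val x) (v : L).

Fact restr_adj_linearl v : linear (restr_adj_act^~ v).
Proof. by move=> a x y; rewrite /restr_adj_act /= lie_linearl. Qed.
Fact restr_adj_linearr x : linear (restr_adj_act x).
Proof. by move=> a v w; rewrite /restr_adj_act lie_linearr. Qed.
Fact restr_adj_lie x y v : restr_adj_act (lie x y) v =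
  restr_adj_act x (restr_adj_act y v) - restr_adj_act y (restr_adj_act x v).
Proof.
apply/eqP; rewrite eq_sym subr_eq; apply/eqP.
exact: (lie_leibniz (val x) (val y) (v : L)).
Qed.
HB.instance Definition _ := Lmodule_isLieModule.Build K S (restr_adj S)
  restr_adj_linearl restr_adj_linearr restr_adj_lie.

End RestrictedAdjoint.

Inductive gen_lie (K : fieldType) (L : lieAlgType K) (X : set L) : L -> Prop :=
| gen_lie_in x : X x -> gen_lie X x
| gen_lie0 : gen_lie X 0
| gen_lie_lin a x y : gen_lie X x -> gen_lie X y -> gen_lie X (a *: x + y)
| gen_lie_lie x y : gen_lie X x -> gen_lie X y -> gen_lie X (lie x y).

Definition gen_subalg (K : fieldType) (L : lieAlgType K) (X : set L) :
  subalg L := Subalg (gen_lie0 X) (@gen_lie_lin _ _ X) (@gen_lie_lie _ _ X).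

Record submod (K : fieldType) (g : lieAlgType K) (V : lieModType g) := Submod {
  submod_set :> V -> Prop;
  submod0 : submod_set 0;
  submod_lin : forall a v w,
    submod_set v -> submod_set w -> submod_set (a *: v + w);
  submod_act : forall x v, submod_set v -> submod_set (act x v) }.

Section SubmodType.
Variables (K : fieldType) (g : lieAlgType K) (V : lieModType g).
Variable N : submod V.

Definition submod_pred : {pred V} := fun v => `[< N v >].

Fact submod_pred_closed : submod_closed submod_pred.
Proof.
split=> [|a x y /asboolP Nx /asboolP Ny]; apply/asboolP; first exact: submod0.
exact: submod_lin.
Qed.
HB.instance Definition _ :=
  GRing.isSubmodClosed.Build K V submod_pred submod_pred_closed.

Definition submod_type : Type := {v : V | v \in submod_pred}.
HB.instance Definition _ := SubChoice.on submod_type.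
HB.instance Definition _ := [SubChoice_isSubLmodule of submod_type by <:].

Definition submod_act_op (x : g) (v : submod_type) : submod_type :=
  exist _ (act x (val v)) (asboolT (submod_act x (asboolW (valP v)))).

Fact submod_linearl v : linear (submod_act_op^~ v).
Proof. by move=> a x y; apply: val_inj; rewrite /= act_linearl. Qed.
Fact submod_linearr x : linear (submod_act_op x).
Proof. by move=> a v w; apply: val_inj; rewrite /= act_linearr. Qed.
Fact submod_act_lie x y v : submod_act_op (lie x y) v =
  submod_act_op x (submod_act_op y v) - submod_act_op y (submod_act_op x v).
Proof. by apply: val_inj; rewrite /= act_lie. Qed.
HB.instance Definition _ := Lmodule_isLieModule.Build K g submod_type
  submod_linearl submod_linearr submod_act_lie.

End SubmodType.
Coercion submod_type : submod >-> Sortclass.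

Inductive gen_mod (K : fieldType) (g : lieAlgType K) (V : lieModType g)
    (X : set V) : V -> Prop :=
| gen_mod_in v : X v -> gen_mod X v
| gen_mod0 : gen_mod X 0
| gen_mod_lin a v w : gen_mod X v -> gen_mod X w -> gen_mod X (a *: v + w)
| gen_mod_act x v : gen_mod X v -> gen_mod X (act x v).

Definition gen_submod (K : fieldType) (g : lieAlgType K) (V : lieModType g)
    (X : set V) : submod V :=
  Submod (gen_mod0 X) (@gen_mod_lin _ _ _ X) (@gen_mod_act _ _ _ X).

Section SumSubmod.
Variables (K : fieldType) (g : lieAlgType K) (V : lieModType g).
Variables N1 N2 : submod V.

Definition sum_submod_set : set V :=
  [set v | exists v1 v2, [/\ N1 v1, N2 v2 & v = v1 + v2]].

Fact sum_submod0 : sum_submod_set 0.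
Proof. by exists 0, 0; split; rewrite ?addr0 //; apply: submod0. Qed.
Fact sum_submod_lin a v w :
  sum_submod_set v -> sum_submod_set w -> sum_submod_set (a *: v + w).
Proof.
move=> [v1 [v2 [n1 n2 ->]]] [w1 [w2 [m1 m2 ->]]].
exists (a *: v1 + w1), (a *: v2 + w2).
by split; [exact: submod_lin | exact: submod_lin | rewrite scalerDr addrACA].
Qed.
Fact sum_submod_act x v : sum_submod_set v -> sum_submod_set (act x v).
Proof.
move=> [v1 [v2 [n1 n2 ->]]]; exists (act x v1), (act x v2).
by split; [exact: submod_act | exact: submod_act | rewrite actDr].
Qed.
Definition sum_submod : submod V :=
  Submod sum_submod0 sum_submod_lin sum_submod_act.
End SumSubmod.

Section QuotientModule.
Variables (K : fieldType) (g : lieAlgType K) (V : lieModType g).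
Variable N : submod V.

Definition quot_rel (v w : V) : bool := `[< N (v - w) >].

Fact quot_rel_refl : reflexive quot_rel.
Proof. by move=> v; apply/asboolP; rewrite subrr; apply: submod0. Qed.
Fact quot_rel_sym : symmetric quot_rel.
Proof.
have H v w : quot_rel v w -> quot_rel w v.
  move=> /asboolP nvw; apply/asboolP; rewrite -opprB -scaleN1r -[_ *: _]addr0.
  by apply: submod_lin => //; apply: submod0.
by move=> v w; apply/idP/idP; apply: H.
Qed.
Fact quot_rel_trans : transitive quot_rel.
Proof.
move=> v u w /asboolP nuv /asboolP nvw; apply/asboolP.
by rewrite -(subrKA v) -[u - v]scale1r; apply: submod_lin.
Qed.
Canonical quot_equiv := EquivRel quot_rel quot_rel_refl quot_rel_sym quot_rel_trans.

Definition quot_mod : Type := {eq_quot quot_equiv}.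
HB.instance Definition _ : EqQuotient _ quot_equiv quot_mod :=
  EqQuotient.on quot_mod.
HB.instance Definition _ := Choice.on quot_mod.

Definition quot_pi (v : V) : quot_mod := \pi_quot_mod v.

Lemma quot_piP v w : quot_pi v = quot_pi w <-> N (v - w).
Proof. by split=> [/eqmodP/asboolP|nvw]; last by apply/eqmodP/asboolP. Qed.

Lemma quot_repr v : N (repr (quot_pi v) - v).
Proof. by apply/quot_piP; rewrite /quot_pi reprK. Qed.

Definition quot_lin (a : K) (p q : quot_mod) : quot_mod :=
  quot_pi (a *: repr p + repr q).
Definition quot_add (p q : quot_mod) : quot_mod := quot_pi (repr p + repr q).
Definition quot_opp (p : quot_mod) : quot_mod := quot_pi (- repr p).
Definition quot_scale (a : K) (p : quot_mod) : quot_mod := quot_pi (a *: repr p).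
Definition quot_act (x : g) (p : quot_mod) : quot_mod := quot_pi (act x (repr p)).

Lemma quot_ind (P : quot_mod -> Prop) :
  (forall v, P (quot_pi v)) -> forall p, P p.
Proof. by move=> H p; rewrite -[p]reprK; apply: H. Qed.

Lemma quot_subN v w : N v -> N w -> N (v + w).
Proof. by move=> nv nw; rewrite -[v]scale1r; apply: submod_lin. Qed.
Lemma quot_scaleN a v : N v -> N (a *: v).
Proof.
by move=> nv; rewrite -[_ *: _]addr0; apply: submod_lin => //; apply: submod0.
Qed.

Lemma quot_addE v w : quot_add (quot_pi v) (quot_pi w) = quot_pi (v + w).
Proof.
by apply/quot_piP; rewrite opprD addrACA; apply: quot_subN; apply: quot_repr.
Qed.
Lemma quot_scaleE a v : quot_scale a (quot_pi v) = quot_pi (a *: v).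
Proof. by apply/quot_piP; rewrite -scalerBr; apply/quot_scaleN/quot_repr. Qed.
Lemma quot_oppE v : quot_opp (quot_pi v) = quot_pi (- v).
Proof.
by apply/quot_piP; rewrite -opprD -scaleN1r; apply/quot_scaleN/quot_repr.
Qed.
Lemma quot_actE x v : quot_act x (quot_pi v) = quot_pi (act x v).
Proof. by apply/quot_piP; rewrite -actBr; apply/submod_act/quot_repr. Qed.

Fact quot_addA : associative quot_add.
Proof.
by elim/quot_ind=> u; elim/quot_ind=> v; elim/quot_ind=> w; rewrite !quot_addE addrA.
Qed.
Fact quot_addC : commutative quot_add.
Proof. by elim/quot_ind=> u; elim/quot_ind=> v; rewrite !quot_addE addrC. Qed.
Fact quot_add0 : left_id (quot_pi 0) quot_add.
Proof. by elim/quot_ind=> u; rewrite !quot_addE add0r. Qed.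
Fact quot_addN : left_inverse (quot_pi 0) quot_opp quot_add.
Proof. by elim/quot_ind=> u; rewrite quot_oppE !quot_addE addNr. Qed.
HB.instance Definition _ :=
  GRing.isZmodule.Build quot_mod quot_addA quot_addC quot_add0 quot_addN.

Lemma quot_piD u v : quot_pi (u + v) = quot_pi u + quot_pi v.
Proof. by rewrite -quot_addE. Qed.
Fact quot_scaleA a b p : quot_scale a (quot_scale b p) = quot_scale (a * b) p.
Proof. by elim/quot_ind: p => u; rewrite !quot_scaleE scalerA. Qed.
Fact quot_scale1 : left_id 1 quot_scale.
Proof. by elim/quot_ind=> u; rewrite !quot_scaleE scale1r. Qed.
Fact quot_scaleDr : right_distributive quot_scale +%R.
Proof.
by move=> a; elim/quot_ind=> u; elim/quot_ind=> v;
  rewrite -quot_piD !quot_scaleE -quot_piD scalerDr.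
Qed.
Fact quot_scaleDl p : {morph quot_scale^~ p : a b / a + b}.
Proof.
by move=> a b; elim/quot_ind: p => u; rewrite !quot_scaleE -quot_piD scalerDl.
Qed.
HB.instance Definition _ := GRing.Zmodule_isLmodule.Build K quot_mod
  quot_scaleA quot_scale1 quot_scaleDr quot_scaleDl.

Lemma quot_pi_linear : linear quot_pi.
Proof. by move=> a u v; rewrite quot_piD -quot_scaleE. Qed.

Fact quot_act_linearl p : linear (quot_act^~ p).
Proof.
by move=> a x y; elim/quot_ind: p => u;
  rewrite !quot_actE act_linearl quot_pi_linear.
Qed.
Fact quot_act_linearr x : linear (quot_act x).
Proof.
move=> a; elim/quot_ind=> u; elim/quot_ind=> v.
by rewrite -quot_pi_linear !quot_actE act_linearr quot_pi_linear.
Qed.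
Fact quot_act_lie x y p :
  quot_act (lie x y) p = quot_act x (quot_act y p) - quot_act y (quot_act x p).
Proof.
elim/quot_ind: p => u; rewrite !quot_actE act_lie.
by rewrite -scaleN1r addrC quot_pi_linear scaleN1r addrC.
Qed.
HB.instance Definition _ := Lmodule_isLieModule.Build K g quot_mod
  quot_act_linearl quot_act_linearr quot_act_lie.

End QuotientModule.

Section ProductModule.
Variables (K : fieldType) (g : lieAlgType K) (V W : lieModType g).

Definition prod_act (x : g) (p : V * W) : V * W := (act x p.1, act x p.2).
Fact prod_act_linearl p : linear (prod_act^~ p).
Proof. by move=> a x y; rewrite /prod_act !act_linearl. Qed.
Fact prod_act_linearr x : linear (prod_act x).
Proof. by move=> a p q; rewrite /prod_act !act_linearr. Qed.
Fact prod_act_lie x y p :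
  prod_act (lie x y) p = prod_act x (prod_act y p) - prod_act y (prod_act x p).
Proof. by rewrite /prod_act !act_lie. Qed.
HB.instance Definition _ := Lmodule_isLieModule.Build K g (V * W)%type
  prod_act_linearl prod_act_linearr prod_act_lie.
End ProductModule.

Definition mod_iso (K : fieldType) (g : lieAlgType K) (V W : lieModType g) :=
  exists phi : {linear V -> W},
    bijective phi /\ forall (x : g) (v : V), phi (act x v) = act x (phi v).

(* Internal direct sum of an arbitrary, possibly infinite or empty, family of
   submodules satisfying P. *)
Definition direct_sum_of (K : fieldType) (g : lieAlgType K)
    (P : lieModType g -> Prop) (V : lieModType g) : Prop :=
  exists (I : choiceType) (W : I -> submod V),
  [/\ forall i, P (W i),
      forall v : V, lspan [set w | exists i, W i w] v
    & forall (r : seq I) (w : I -> V), uniq r ->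
        (forall i, i \in r -> W i (w i)) -> \sum_(i <- r) w i = 0 ->
        forall i, i \in r -> w i = 0].

(* The Lie algebra presented by a set X of generators and a set R of
   relations s = t between formal Lie expressions: formal expressions modulo
   the smallest congruence containing R and the axioms of Lie algebras. *)

Inductive lie_term (K : fieldType) (X : Type) : Type :=
| LVar of X
| LZero
| LAdd of lie_term K X & lie_term K X
| LScale of K & lie_term K X
| LBr of lie_term K X & lie_term K X.
Arguments LVar {K X}.
Arguments LZero {K X}.

Section Presentation.
Variables (K : fieldType) (X : Type).
Notation term := (lie_term K X).
Variable R : term -> term -> Prop.

Inductive pres_eq : term -> term -> Prop :=
| pe_rel s t : R s t -> pres_eq s t
| pe_refl s : pres_eq s s
| pe_sym s t : pres_eq s t -> pres_eq t s
| pe_trans s t u : pres_eq s t -> pres_eq t u -> pres_eq s u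
| pe_add s s' t t' :
    pres_eq s s' -> pres_eq t t' -> pres_eq (LAdd s t) (LAdd s' t')
| pe_scale a s s' : pres_eq s s' -> pres_eq (LScale a s) (LScale a s')
| pe_br s s' t t' :
    pres_eq s s' -> pres_eq t t' -> pres_eq (LBr s t) (LBr s' t')
| pe_addA s t u : pres_eq (LAdd s (LAdd t u)) (LAdd (LAdd s t) u)
| pe_addC s t : pres_eq (LAdd s t) (LAdd t s)
| pe_add0 s : pres_eq (LAdd LZero s) s
| pe_addN s : pres_eq (LAdd (LScale (-1) s) s) LZero
| pe_scaleA a b s : pres_eq (LScale a (LScale b s)) (LScale (a * b) s)
| pe_scale1 s : pres_eq (LScale 1 s) s
| pe_scaleDr a s t :
    pres_eq (LScale a (LAdd s t)) (LAdd (LScale a s) (LScale a t))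
| pe_scaleDl a b s :
    pres_eq (LScale (a + b) s) (LAdd (LScale a s) (LScale b s))
| pe_brl a s t u :
    pres_eq (LBr (LAdd (LScale a s) t) u) (LAdd (LScale a (LBr s u)) (LBr t u))
| pe_brr a s t u :
    pres_eq (LBr u (LAdd (LScale a s) t)) (LAdd (LScale a (LBr u s)) (LBr u t))
| pe_brxx s : pres_eq (LBr s s) LZero
| pe_jacobi s t u :
    pres_eq (LAdd (LAdd (LBr s (LBr t u)) (LBr t (LBr u s))) (LBr u (LBr s t)))
            LZero.

HB.instance Definition _ := gen_eqMixin term.
HB.instance Definition _ := gen_choiceMixin term.

Definition pres_eqb (s t : term) : bool := `[< pres_eq s t >].
Fact pres_eqb_refl : reflexive pres_eqb.
Proof. by move=> s; apply/asboolP/pe_refl. Qed.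
Fact pres_eqb_sym : symmetric pres_eqb.
Proof. by move=> s t; apply/asboolP/asboolP; apply: pe_sym. Qed.
Fact pres_eqb_trans : transitive pres_eqb.
Proof. by move=> t s u /asboolP st /asboolP tu; apply/asboolP/(pe_trans st). Qed.
Canonical pres_equiv :=
  EquivRel pres_eqb pres_eqb_refl pres_eqb_sym pres_eqb_trans.

Definition pres_alg : Type := {eq_quot pres_equiv}.
HB.instance Definition _ : EqQuotient _ pres_equiv pres_alg :=
  EqQuotient.on pres_alg.
HB.instance Definition _ := Choice.on pres_alg.

Definition pres_pi (s : term) : pres_alg := \pi_pres_alg s.

Lemma pres_piP s t : pres_pi s = pres_pi t <-> pres_eq s t.
Proof. by split=> [/eqmodP/asboolP|st]; last by apply/eqmodP/asboolP. Qed.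

Lemma pres_ind (P : pres_alg -> Prop) :
  (forall s, P (pres_pi s)) -> forall p, P p.
Proof. by move=> H p; rewrite -[p]reprK; apply: H. Qed.

Lemma pres_repr s : pres_eq (repr (pres_pi s)) s.
Proof. by apply/pres_piP; rewrite /pres_pi reprK. Qed.

Definition pres_add (p q : pres_alg) := pres_pi (LAdd (repr p) (repr q)).
Definition pres_scale a (p : pres_alg) := pres_pi (LScale a (repr p)).
Definition pres_opp (p : pres_alg) := pres_scale (-1) p.
Definition pres_lie (p q : pres_alg) := pres_pi (LBr (repr p) (repr q)).

Lemma pres_addE s t : pres_add (pres_pi s) (pres_pi t) = pres_pi (LAdd s t).
Proof. by apply/pres_piP/pe_add; apply: pres_repr. Qed.
Lemma pres_scaleE a s : pres_scale a (pres_pi s) = pres_pi (LScale a s).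
Proof. by apply/pres_piP/pe_scale/pres_repr. Qed.
Lemma pres_lieE s t : pres_lie (pres_pi s) (pres_pi t) = pres_pi (LBr s t).
Proof. by apply/pres_piP/pe_br; apply: pres_repr. Qed.

Fact pres_addA : associative pres_add.
Proof.
elim/pres_ind=> s; elim/pres_ind=> t; elim/pres_ind=> u.
by rewrite !pres_addE; apply/pres_piP/pe_addA.
Qed.
Fact pres_addC : commutative pres_add.
Proof.
by elim/pres_ind=> s; elim/pres_ind=> t; rewrite !pres_addE; apply/pres_piP/pe_addC.
Qed.
Fact pres_add0 : left_id (pres_pi LZero) pres_add.
Proof. by elim/pres_ind=> s; rewrite pres_addE; apply/pres_piP/pe_add0. Qed.
Fact pres_addN : left_inverse (pres_pi LZero) pres_opp pres_add.
Proof.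
by elim/pres_ind=> s; rewrite /pres_opp pres_scaleE pres_addE; apply/pres_piP/pe_addN.
Qed.
HB.instance Definition _ :=
  GRing.isZmodule.Build pres_alg pres_addA pres_addC pres_add0 pres_addN.

Lemma pres_piD s t : pres_pi (LAdd s t) = pres_pi s + pres_pi t.
Proof. by rewrite -pres_addE. Qed.
Fact pres_scaleA a b p : pres_scale a (pres_scale b p) = pres_scale (a * b) p.
Proof. by elim/pres_ind: p => s; rewrite !pres_scaleE; apply/pres_piP/pe_scaleA. Qed.
Fact pres_scale1 : left_id 1 pres_scale.
Proof. by elim/pres_ind=> s; rewrite pres_scaleE; apply/pres_piP/pe_scale1. Qed.
Fact pres_scaleDr : right_distributive pres_scale +%R.
Proof.
move=> a; elim/pres_ind=> s; elim/pres_ind=> t.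
by rewrite -pres_piD !pres_scaleE -pres_piD; apply/pres_piP/pe_scaleDr.
Qed.
Fact pres_scaleDl p : {morph pres_scale^~ p : a b / a + b}.
Proof.
move=> a b; elim/pres_ind: p => s.
by rewrite !pres_scaleE -pres_piD; apply/pres_piP/pe_scaleDl.
Qed.
HB.instance Definition _ := GRing.Zmodule_isLmodule.Build K pres_alg
  pres_scaleA pres_scale1 pres_scaleDr pres_scaleDl.

Lemma pres_pi0 : pres_pi LZero = 0. Proof. by []. Qed.
Lemma pres_piZ a s : pres_pi (LScale a s) = a *: pres_pi s.
Proof. by rewrite -pres_scaleE. Qed.

Fact pres_lie_linearl p : linear (pres_lie^~ p).
Proof.
move=> a; elim/pres_ind=> s; elim/pres_ind=> t; elim/pres_ind: p => u.
rewrite -pres_piZ -pres_piD !pres_lieE -pres_piZ -pres_piD.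
by apply/pres_piP/pe_brl.
Qed.
Fact pres_lie_linearr p : linear (pres_lie p).
Proof.
move=> a; elim/pres_ind=> s; elim/pres_ind=> t; elim/pres_ind: p => u.
rewrite -pres_piZ -pres_piD !pres_lieE -pres_piZ -pres_piD.
by apply/pres_piP/pe_brr.
Qed.
Fact pres_liexx p : pres_lie p p = 0.
Proof. by elim/pres_ind: p => s; rewrite pres_lieE; apply/pres_piP/pe_brxx. Qed.
Fact pres_jacobi p q r : pres_lie p (pres_lie q r) + pres_lie q (pres_lie r p)
  + pres_lie r (pres_lie p q) = 0.
Proof.
elim/pres_ind: p => s; elim/pres_ind: q => t; elim/pres_ind: r => u.
by rewrite !pres_lieE -!pres_piD; apply/pres_piP/pe_jacobi.
Qed.
HB.instance Definition _ := Lmodule_isLieAlgebra.Build K pres_alg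
  pres_lie_linearl pres_lie_linearr pres_liexx pres_jacobi.

Lemma pres_piL s t : pres_pi (LBr s t) = lie (pres_pi s) (pres_pi t).
Proof. by rewrite -pres_lieE. Qed.

Lemma pres_alg_ind (P : pres_alg -> Prop) :
  P 0 -> (forall a x y, P x -> P y -> P (a *: x + y)) ->
  (forall x y, P x -> P y -> P (lie x y)) ->
  (forall i, P (pres_pi (LVar i))) -> forall x, P x.
Proof.
move=> P0 Plin Plie Pgen; elim/pres_ind.
elim=> [i||s IHs t IHt|a s IHs|s IHs t IHt] //.
- by rewrite pres_piD -[pres_pi s]scale1r; apply: Plin.
- by rewrite pres_piZ -[_ *: _]addr0; apply: Plin.
- by rewrite pres_piL; apply: Plie.
Qed.

End Presentation.

Inductive km_gen (n : nat) : Type :=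
| GenH of 'I_n
| GenE of 'I_n
| GenF of 'I_n.

Section KacMoody.
Variables (K : fieldType) (n : nat) (A : 'M[int]_n).

Local Notation H i := (LVar (GenH i)).
Local Notation E i := (LVar (GenE i)).
Local Notation F i := (LVar (GenF i)).

Inductive km_rel : lie_term K (km_gen n) -> lie_term K (km_gen n) -> Prop :=
| km_rel_hh i j : km_rel (LBr (H i) (H j)) LZero
| km_rel_he i j : km_rel (LBr (H i) (E j)) (LScale (A i j)%:~R (E j))
| km_rel_hf i j : km_rel (LBr (H i) (F j)) (LScale (- (A i j)%:~R) (F j))
| km_rel_ef i j : km_rel (LBr (E i) (F j)) (if i == j then H i else LZero)
| km_rel_ee i j : i != j ->
    km_rel (iter `|1 - A i j|%N (LBr (E i)) (E j)) LZero
| km_rel_ff i j : i != j ->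
    km_rel (iter `|1 - A i j|%N (LBr (F i)) (F j)) LZero.

(* The Serre presentation with Cartan subalgebra spanned by the h_i alone: no
   derivations are adjoined, which is harmless when det A != 0. *)
Definition kac_moody : lieAlgType K := pres_alg km_rel.

Definition km_h (i : 'I_n) : kac_moody := pres_pi km_rel (H i).
Definition km_e (i : 'I_n) : kac_moody := pres_pi km_rel (E i).
Definition km_f (i : 'I_n) : kac_moody := pres_pi km_rel (F i).

(* A functional on the Cartan subalgebra spanned by the h_i is given by the row
   of its values at the h_i. *)

Definition simple_root (j : 'I_n) : 'rV[K]_n := \row_i (A i j)%:~R.

Definition root_space (al : 'rV[K]_n) : set kac_moody :=
  [set x | forall c : 'I_n -> K,
    lie (\sum_i c i *: km_h i) x = (\sum_i c i * al 0 i) *: x].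

Definition is_root (al : 'rV[K]_n) : Prop :=
  al != 0 /\ exists2 x, x != 0 & root_space al x.

End KacMoody.

Section KacMoodyTheory.
Variables (K : numFieldType) (n : nat) (A : 'M[int]_n).
Notation L := (kac_moody K A).
Notation h := (km_h K A).
Notation e := (km_e K A).
Notation f := (km_f K A).
Notation hval c := (\sum_i c i *: h i).

Lemma km_relE s t :
  @km_rel K n A s t -> pres_pi (@km_rel K n A) s = pres_pi (@km_rel K n A) t.
Proof. by move=> st; apply/pres_piP/pe_rel. Qed.

Lemma km_hh i j : lie (h i) (h j) = 0.
Proof. by rewrite /km_h -pres_piL (km_relE (km_rel_hh _ _ _ _)). Qed.
Lemma km_he i j : lie (h i) (e j) = (A i j)%:~R *: e j.
Proof.
by rewrite /km_h /km_e -pres_piL (km_relE (km_rel_he _ _ _ _)) pres_piZ.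
Qed.
Lemma km_hf i j : lie (h i) (f j) = - (A i j)%:~R *: f j.
Proof.
by rewrite /km_h /km_f -pres_piL (km_relE (km_rel_hf _ _ _ _)) pres_piZ.
Qed.
Lemma km_ef i j : lie (e i) (f j) = if i == j then h i else 0.
Proof.
by rewrite /km_e /km_f -pres_piL (km_relE (km_rel_ef _ _ _ _)); case: ifP.
Qed.

Lemma km_hval_h c j : lie (hval c) (h j) = 0.
Proof. by rewrite lie_suml big1 // => i _; rewrite lieZl km_hh scaler0. Qed.

Lemma root_space_e j : root_space (simple_root K A j) (e j).
Proof.
move=> c; rewrite lie_suml scaler_suml; apply: eq_bigr => i _.
by rewrite lieZl km_he scalerA mxE.
Qed.
Lemma root_space_f j : root_space (- simple_root K A j) (f j).
Proof.
move=> c; rewrite lie_suml scaler_suml; apply: eq_bigr => i _.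
by rewrite lieZl km_hf scalerA !mxE.
Qed.
Lemma root_space_h j : root_space 0 (h j).
Proof.
move=> c; rewrite km_hval_h big1 ?scale0r // => i _; by rewrite mxE mulr0.
Qed.
Lemma root_space_lie al be (x y : L) :
  root_space al x -> root_space be y -> root_space (al + be) (lie x y).
Proof.
move=> Rx Ry c; rewrite lie_leibniz Rx Ry lieZl lieZr -scalerDl -big_split /=.
by congr (_ *: _); apply: eq_bigr => i _; rewrite mxE mulrDr.
Qed.
Lemma root_spaceZ al a (x : L) : root_space al x -> root_space al (a *: x).
Proof. by move=> Rx c; rewrite lieZr Rx !scalerA mulrC. Qed.

Inductive bracket (x : 'I_n -> L) : nat -> L -> Prop :=
| bracket1 j : bracket x 1 (x j)
| bracketS j k y : bracket x k y -> bracket x k.+1 (lie (x j) y).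

Lemma eigen_bracket (d : L) x (c : 'I_n -> K) k y :
  (forall j, lie d (x j) = c j *: x j) -> bracket x k y ->
  exists b, lie d y = b *: y.
Proof.
move=> dx; elim=> [j|j {}k {}y _ [b IH]]; first by exists (c j).
by exists (c j + b); rewrite lie_leibniz dx IH lieZl lieZr scalerDl.
Qed.

Lemma eigen_bracket_height (d : L) x (a : K) k y :
  (forall j, lie d (x j) = a *: x j) -> bracket x k y ->
  lie d y = (a * k%:R) *: y.
Proof.
move=> dx; elim=> [j|j {}k {}y _ IH]; first by rewrite dx mulr1.
by rewrite lie_leibniz dx IH lieZl lieZr -scalerDl
  [k.+1%:R]mulrS mulrDr mulr1.
Qed.

Definition brackets x : set L := [set y | exists k, bracket x k y].

Lemma lower_bracket (x y : 'I_n -> L) (s : K) (c : 'I_n -> 'I_n -> K) i k z :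
  (forall i j, lie (x i) (y j) = if i == j then s *: h i else 0) ->
  (forall i j, lie (h i) (y j) = c i j *: y j) -> bracket y k z ->
  lspan (range h `|` brackets y) (lie (x i) z).
Proof.
move=> xy hy; elim=> [j|j {}k {}z bz IH].
  rewrite xy; case: ifP => _; last exact: lspan0.
  by apply/lspan_scale/lspan_in; left; exists i.
rewrite lie_leibniz xy; apply: lspan_add.
  case: ifP => _; last by rewrite lie0x; apply: lspan0.
  have [b ->] : exists b, lie (s *: h i) z = b *: z.
    apply: (@eigen_bracket (s *: h i) y (fun j => s * c i j)) bz => l.
    by rewrite lieZl hy scalerA.
  by apply/lspan_scale/lspan_in; right; exists k.
apply: (lspan_map (lie_linearr (y j)) _ IH) => w [[l _ <-]|[l bw]].
  rewrite lieC hy; apply/lspan_opp/lspan_scale/lspan_in.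
  by right; exists 1%N; apply: bracket1.
by apply: lspan_in; right; exists l.+1; apply: bracketS.
Qed.

Definition triangular : set L := range h `|` (brackets e `|` brackets f).

Lemma sub_e w : lspan (range h `|` brackets e) w -> lspan triangular w.
Proof.
by apply: (lspan_map (f := id)) => // x [hx|ex]; apply: lspan_in;
  [left | right; left].
Qed.
Lemma sub_f w : lspan (range h `|` brackets f) w -> lspan triangular w.
Proof.
by apply: (lspan_map (f := id)) => // x [hx|ex]; apply: lspan_in;
  [left | right; right].
Qed.

Lemma km_triangular (x : L) : lspan triangular x.
Proof.
have fe i j : lie (f i) (e j) = if i == j then (-1) *: h i else 0.
  by rewrite lieC km_ef eq_sym; case: eqP => [->|_]; rewrite ?oppr0 // scaleN1r.
have ef i j : lie (e i) (f j) = if i == j then 1 *: h i else 0.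
  by rewrite km_ef scale1r.
have Ve i : triangular (e i) by right; left; exists 1%N; apply: bracket1.
have Vf i : triangular (f i) by right; right; exists 1%N; apply: bracket1.
have stable : forall x y : L, lspan triangular y -> lspan triangular (lie x y).
  apply: pres_alg_ind => [y _|a u v IHu IHv y Uy|u v IHu IHv y Uy|g y Uy].
  - by rewrite lie0x; apply: lspan0.
  - by rewrite lieDl lieZl; apply: lspan_lin; [apply: IHu | apply: IHv].
  - have -> : lie (lie u v) y = lie u (lie v y) - lie v (lie u y).
      by rewrite (lie_leibniz u v y) addrK.
    by apply: lspan_add; [apply/IHu/IHv | apply/lspan_opp/IHv/IHu].
  apply: (lspan_map (lie_linearr _) _ Uy) => {Uy}z.
  case: g => i; rewrite -/(h i) -/(e i) -/(f i) => -[[j _ <-]|[[k bz]|[k bz]]].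
  - by rewrite km_hh; apply: lspan0.
  - have [b ->] := eigen_bracket (km_he i) bz.
    by apply/lspan_scale/lspan_in; right; left; exists k.
  - have [b ->] := eigen_bracket (km_hf i) bz.
    by apply/lspan_scale/lspan_in; right; right; exists k.
  - by rewrite lieC km_he; apply/lspan_opp/lspan_scale/lspan_in.
  - by apply: lspan_in; right; left; exists k.+1; apply: bracketS.
  - exact/sub_f/(lower_bracket i ef km_hf bz).
  - by rewrite lieC km_hf; apply/lspan_opp/lspan_scale/lspan_in.
  - exact/sub_e/(lower_bracket i fe km_he bz).
  - by apply: lspan_in; right; right; exists k.+1; apply: bracketS.
move: x; apply: pres_alg_ind => [|a u v|u v _|g]; first exact: lspan0.
- exact: lspan_lin.
- exact: stable.
- by apply: lspan_in; case: g => i; [left; exists i | exact: Ve | exact: Vf].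
Qed.

Lemma eigen_sum0 (d : L) (r : seq (K * L)) (z : L) :
  (forall p, p \in r -> p.1 != 0 /\ lie d p.2 = p.1 *: p.2) ->
  lie d z = 0 -> \sum_(p <- r) p.2 = z -> z = 0.
Proof.
elim: {r}(size r) {-2}r (erefl (size r)) z => [|k IH] [|[c u] r] //= rk z rP dz.
  by rewrite big_nil.
rewrite big_cons /= => uz; have [c0 du] := rP _ (mem_head _ _).
have /eqP : - c *: z = 0.
  apply: (IH [seq (p.1, (p.1 - c) *: p.2) | p <- r]).
  - by rewrite size_map; case: rk.
  - move=> _ /mapP[p pr ->]; have [p0 dp] := rP p (mem_behead (s := _ :: _) pr).
    by split=> //=; rewrite lieZr dp !scalerA mulrC.
  - by rewrite lieZr dz scaler0.
  have dS : lie d (\sum_(p <- r) p.2) = \sum_(p <- r) p.1 *: p.2.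
    rewrite lieC lie_suml -sumrN big_seq [RHS]big_seq; apply: eq_bigr => p pr.
    have [_ dp] := rP p (mem_behead (s := _ :: _) pr).
    by rewrite -lieC dp.
  rewrite big_map /=; under eq_bigr do rewrite scalerBl.
  rewrite sumrB -scaler_sumr -dS; move: dz; rewrite -uz lieDr du => /eqP.
  by rewrite addrC addr_eq0 => /eqP ->; rewrite scaleNr scalerDr opprD.
by rewrite scaler_eq0 oppr_eq0 (negPf c0) => /eqP.
Qed.

Lemma root_space0 (rho : 'I_n -> K) (x : L) :
  (forall j, \sum_i rho i * (A i j)%:~R = 1) ->
  root_space 0 x -> lspan (range h) x.
Proof.
move=> rho1 x0; set d := hval rho.
have de j : lie d (e j) = 1 *: e j.
  rewrite root_space_e -[in RHS](rho1 j); congr (_ *: _).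
  by apply: eq_bigr => i _; rewrite mxE.
have df j : lie d (f j) = -1 *: f j.
  rewrite root_space_f -[in RHS](rho1 j) -sumrN; congr (_ *: _).
  by apply: eq_bigr => i _; rewrite !mxE mulrN.
have dx : lie d x = 0.
  by rewrite x0 big1 ?scale0r // => i _; rewrite mxE mulr0.
have nz k z y a : bracket y k z -> a != 0 -> a * k%:R != 0 :> K.
  case=> [_|_ {}k _ _] a0; rewrite mulf_neq0 ?oner_eq0 //.
  by rewrite pnatr_eq0.
suff [y [r [hy rP xE]]] : exists y (r : seq (K * L)), [/\ lspan (range h) y,
    forall p, p \in r -> p.1 != 0 /\ lie d p.2 = p.1 *: p.2
    & x = y + \sum_(p <- r) p.2].
  suff /eqP : x - y = 0 by rewrite subr_eq0 => /eqP ->.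
  apply: (eigen_sum0 rP); last by rewrite xE addrAC subrr add0r.
  rewrite lieDr dx lieNr add0r.
  elim: hy => [|a _ z [j _ <-] _ IH]; first by rewrite liex0 oppr0.
  by rewrite lieDr lieZr km_hval_h scaler0 add0r.
elim: (km_triangular x) => [|a u v Vu _ [y [r [hy rP vE]]]].
  by exists 0, [::]; split; rewrite ?big_nil ?addr0 //; apply: lspan0.
case: Vu => [[j _ <-]|bu].
  exists (a *: h j + y), r; split=> //; last by rewrite vE addrA.
  by apply: lspanD => //; exists j.
have [b b0 du] : exists2 b, b != 0 & lie d u = b *: u.
  case: bu => -[k bu].
    by exists (1 * k%:R); [apply: nz bu _; rewrite oner_eq0
                          | apply: eigen_bracket_height bu].
  by exists (-1 * k%:R); [apply: nz bu _; rewrite oppr_eq0 oner_eq0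
                         | apply: eigen_bracket_height bu].
exists y, ((b, a *: u) :: r); split=> // [p|]; last by rewrite big_cons vE addrCA.
by rewrite inE => /predU1P[->|/rP//]; split=> //=; rewrite lieZr du !scalerA mulrC.
Qed.

End KacMoodyTheory.

(* Ordinals start at 0; these are the indices 1, 2, 3 of the generators. *)
Definition i1 : 'I_3 := @Ordinal 3 0 isT.
Definition i2 : 'I_3 := @Ordinal 3 1 isT.
Definition i3 : 'I_3 := @Ordinal 3 2 isT.

Definition A3 : 'M[int]_3 := \matrix_(i, j)
  nth 0 (nth [::] [:: [:: 2; -2; 0]; [:: -2; 2; -1]; [:: 0; -1; 2]] i) j.

Lemma ord3_ind (P : 'I_3 -> Prop) : P i1 -> P i2 -> P i3 -> forall i, P i.
Proof.
by move=> ? ? ? [[|[|[|]]] // lt3];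
  [have -> : Ordinal lt3 = i1 | have -> : Ordinal lt3 = i2
  | have -> : Ordinal lt3 = i3] => //; apply: val_inj.
Qed.

Lemma sum3 (V : nmodType) (G : 'I_3 -> V) : \sum_i G i = G i1 + G i2 + G i3.
Proof.
rewrite !big_ord_recl big_ord0 addr0 addrA.
by congr (G _ + G _ + G _); apply: val_inj.
Qed.

Section Fibonacci.
Variable K : numFieldType.

Definition Falg : lieAlgType K := kac_moody K A3.
Notation h := (km_h K A3).
Notation e := (km_e K A3).
Notation f := (km_f K A3).
Notation alpha := (simple_root K A3).
Notation hval c := (\sum_i c i *: h i).

Definition E1 : Falg := 2^-1 *: lie (e i1) (lie (e i1) (lie (e i2) (e i3))).
Definition F1 : Falg := - (2^-1) *: lie (f i1) (lie (f i1) (lie (f i2) (f i3))).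
Definition H1 : Falg := 2 *: h i1 + h i2 + h i3.
Definition E2 : Falg := e i2.
Definition F2 : Falg := f i2.
Definition H2 : Falg := h i2.

Definition Fib : subalg Falg := gen_subalg [set E1; F1; H1; E2; F2; H2].

Lemma fib_gen (x : Falg) : [set E1; F1; H1; E2; F2; H2] x -> x \in subalg_pred Fib.
Proof. by move=> gx; apply/asboolP/gen_lie_in. Qed.

Definition FibE1 : Fib := exist _ E1 (fib_gen ltac:(do 5 left; by [])).
Definition FibF1 : Fib := exist _ F1 (fib_gen ltac:(do 4 left; by right)).
Definition FibH1 : Fib := exist _ H1 (fib_gen ltac:(do 3 left; by right)).
Definition FibE2 : Fib := exist _ E2 (fib_gen ltac:(do 2 left; by right)).
Definition FibF2 : Fib := exist _ F2 (fib_gen ltac:(left; by right)).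
Definition FibH2 : Fib := exist _ H2 (fib_gen ltac:(by right)).

(* A functional on h_Fib is given by the row of its values at H_1 and H_2;
   fib_restr restricts a functional on the Cartan subalgebra of F. *)

Definition fib_restr (al : 'rV[K]_3) : 'rV[K]_2 :=
  \row_i (if i == 0 then 2 * al 0 i1 + al 0 i2 + al 0 i3 else al 0 i2).

Definition beta1 : 'rV[K]_2 :=
  fib_restr (2 *: alpha i1 + alpha i2 + alpha i3).
Definition beta2 : 'rV[K]_2 := fib_restr (alpha i2).

Definition lambda1 : 'rV[K]_2 := - 5^-1 *: (2 *: beta1 + 3 *: beta2).
Definition lambda2 : 'rV[K]_2 := - 5^-1 *: (3 *: beta1 + 2 *: beta2).

Section FibModule.
Variable V : lieModType Fib.

Definition wt_space (mu : 'rV[K]_2) : set V :=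
  [set v | forall a b : K,
    act (a *: FibH1 + b *: FibH2) v = (a * mu 0 0 + b * mu 0 1) *: v].

Definition diagonalizable : Prop :=
  forall v : V, lspan [set w | exists mu, wt_space mu w] v.

(* The order of K is the partial order of a numFieldType: for K = C,
   0 <= z means that z is a nonnegative real. *)

Definition pos_part : set V := lspan [set v | exists n1 n2 : K,
  0 <= n1 + n2 /\ wt_space (n1 *: lambda1 + n2 *: lambda2) v].
Definition neg_part : set V := lspan [set v | exists n1 n2 : K,
  n1 + n2 < 0 /\ wt_space (n1 *: lambda1 + n2 *: lambda2) v].

Definition highest_weight_module : Prop := exists (v : V) (mu : 'rV[K]_2),
  [/\ v != 0, wt_space mu v, act FibE1 v = 0, act FibE2 v = 0
    & forall w : V, gen_mod [set v] w].
Definition lowest_weight_module : Prop := exists (v : V) (mu : 'rV[K]_2),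
  [/\ v != 0, wt_space mu v, act FibF1 v = 0, act FibF2 v = 0
    & forall w : V, gen_mod [set v] w].
End FibModule.

Definition root3 (x y z : int) : 'rV[K]_3 :=
  x%:~R *: alpha i1 + y%:~R *: alpha i2 + z%:~R *: alpha i3.

Definition Delta0 (be : 'rV[K]_3) : Prop := is_root A3 be /\
  exists x y z : int, be = root3 x y z /\ 2 * z - x = 0.

Definition fib0_span : set Falg := range h `|`
  [set v | exists be, Delta0 be /\ root_space be v].
Definition fib0 : set Falg := lspan fib0_span.

Lemma root3D x y z x' y' z' :
  root3 x y z + root3 x' y' z' = root3 (x + x') (y + y') (z + z').
Proof. by rewrite /root3 !intrD !scalerDl addrACA (addrACA (_ *: _)). Qed.

Lemma A3_root_space0 (v : Falg) : root_space 0 v -> lspan (range h) v.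
Proof.
apply: (@root_space0 K 3 A3 (fun i => nth 0 [:: - (9 / 2); -5; -2] i)).
by apply: ord3_ind; rewrite sum3 !mxE /=; field.
Qed.

Lemma fib0_root (v : Falg) x y z :
  2 * z - x = 0 -> root_space (root3 x y z) v -> fib0 v.
Proof.
move=> xz; case: (eqVneq v 0) => [-> _|v0 rv]; first exact: lspan0.
case: (eqVneq (root3 x y z) 0) => [a0|a0].
  move: rv; rewrite a0 => /A3_root_space0.
  by apply: (lspan_map (f := id)) => // w hw; apply: lspan_in; left.
apply: lspan_in; right; exists (root3 x y z); split=> //.
by split; [split=> //; exists v | exists x, y, z].
Qed.

Lemma fib0_h i : fib0 (h i).
Proof. by apply: lspan_in; left; exists i. Qed.

Lemma fib0_span_graded (v : Falg) : fib0_span v ->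
  exists x y z : int, 2 * z - x = 0 /\ root_space (root3 x y z) v.
Proof.
case=> [[i _ <-]|[be [[_ [x [y [z [-> xz]]]]] rv]]]; last by exists x, y, z.
exists 0, 0, 0; split=> //; rewrite /root3 !scale0r !addr0.
exact: root_space_h.
Qed.

Lemma fib0_lie (u v : Falg) : fib0 u -> fib0 v -> fib0 (lie u v).
Proof.
move=> fu fv; apply: (lspan_map (lie_linearl v) _ fu) => {fu}u gu.
apply: (lspan_map (lie_linearr u) _ fv) => {fv}v gv.
have [x [y [z [xz ru]]]] := fib0_span_graded gu.
have [x' [y' [z' [xz' rv]]]] := fib0_span_graded gv.
apply: (@fib0_root _ (x + x') (y + y') (z + z')).
  by rewrite mulrDr opprD addrACA xz xz' addr0.
by rewrite -root3D; apply: root_space_lie.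
Qed.

Lemma fib_sub_fib0 (x : Falg) : Fib x -> fib0 x.
Proof.
have re i : root_space (root3 (i == i1)%:Z (i == i2)%:Z (i == i3)%:Z) (e i).
  have -> : root3 (i == i1)%:Z (i == i2)%:Z (i == i3)%:Z = alpha i.
    by move: i; apply: ord3_ind; rewrite /root3 /= !scale0r ?scale1r ?add0r ?addr0.
  exact: root_space_e.
have rf i : root_space (root3 (- (i == i1)%:Z) (- (i == i2)%:Z) (- (i == i3)%:Z))
    (f i).
  have -> : root3 (- (i == i1)%:Z) (- (i == i2)%:Z) (- (i == i3)%:Z) = - alpha i.
    by move: i; apply: ord3_ind;
      rewrite /root3 /= !intrN !scaleNr !scale0r ?scale1r ?oppr0 ?add0r ?addr0.
  exact: root_space_f.
elim=> [{}x gx||a y z _ fy _ fz|y z _ fy _ fz]; last 3 first.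
- exact: lspan0.
- exact: lspan_lin.
- exact: fib0_lie.
case: gx => [[[[[->|->]|->]|->]|->]|->].
- have := root_space_lie (re i1)
    (root_space_lie (re i1) (root_space_lie (re i2) (re i3))).
  by rewrite !root3D => /fib0_root fe; apply: lspan_scale; apply: fe.
- have := root_space_lie (rf i1)
    (root_space_lie (rf i1) (root_space_lie (rf i2) (rf i3))).
  by rewrite !root3D => /fib0_root ff; apply: lspan_scale; apply: ff.
- by apply: lspan_add; [apply: lspan_add; first apply: lspan_scale|]; apply: fib0_h.
- exact: (fib0_root _ (re i2)).
- exact: (fib0_root _ (rf i2)).
- exact: fib0_h.
Qed.

Definition adj : lieModType Fib := restr_adj Fib.

Definition Fib0 : submod adj := @Submod K Fib adj fib0 (lspan0 _)
  (fun a u v => @lspan_lin K Falg fib0_span a u v)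
  (fun x v fv => fib0_lie (fib_sub_fib0 (asboolW (valP x))) fv).

Definition hV0 : Falg := h i1 - 2 *: h i3.

Lemma hV0_fib0 : fib0 hV0.
Proof. by apply: lspan_add; [|apply/lspan_opp/lspan_scale]; apply: fib0_h. Qed.

Lemma hV0_central (v : Falg) : fib0 v -> lie v hV0 = 0.
Proof.
elim=> [|a {}v w gv _ IH]; first by rewrite lie0x.
rewrite lieDl IH addr0 lieZl.
have [x [y [z [xz rv]]]] := fib0_span_graded gv.
have -> : hV0 = hval (fun i : 'I_3 => nth 0 [:: 1; 0; - 2] i).
  by rewrite sum3 /= scale1r scale0r addr0 scaleNr.
rewrite lieC rv sum3 /= !mxE /=.
have -> : x = 2 * z by apply/esym/eqP; rewrite -subr_eq0 xz.
rewrite (_ : _ + _ = 0) ?scale0r ?oppr0 ?scaler0 //.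
by rewrite intrM; ring.
Qed.

Definition V0_set : set Fib0 := [set v | exists c, val v = c *: hV0].

Fact V0_0 : V0_set 0.
Proof. by exists 0; rewrite scale0r. Qed.
Fact V0_lin a u v : V0_set u -> V0_set v -> V0_set (a *: u + v).
Proof.
by move=> [b ub] [c vc]; exists (a * b + c); rewrite /= ub vc scalerA scalerDl.
Qed.
Lemma V0_trivial (x : Fib) v : V0_set v -> act x v = 0.
Proof.
move=> [c vc]; apply: val_inj; rewrite /= vc.
rewrite [LHS](lieZr c (val x) hV0) hV0_central ?scaler0 //.
exact: fib_sub_fib0 (asboolW (valP x)).
Qed.
Fact V0_act (x : Fib) v : V0_set v -> V0_set (act x v).
Proof. by move=> /V0_trivial ->; apply: V0_0. Qed.
Definition V0 : submod Fib0 := Submod V0_0 V0_lin V0_act.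

(* The image of Fib in Fib(0); nothing is lost, by fib_sub_fib0. *)
Definition FibAd_set : set Fib0 := [set v | Fib (val v)].
Fact FibAd_0 : FibAd_set 0.
Proof. exact: subalg0. Qed.
Fact FibAd_lin a u v : FibAd_set u -> FibAd_set v -> FibAd_set (a *: u + v).
Proof. exact: subalg_lin. Qed.
Fact FibAd_act (x : Fib) v : FibAd_set v -> FibAd_set (act x v).
Proof. exact/subalg_lie/(asboolW (valP x)). Qed.
Definition FibAd : submod Fib0 := Submod FibAd_0 FibAd_lin FibAd_act.

Definition Y0 : lieModType Fib := quot_mod (sum_submod V0 FibAd).

Lemma fib_wt_space al (v : Falg) (fv : v \in submod_pred Fib0) :
  root_space al v -> wt_space (fib_restr al) (exist _ v fv : Fib0).
Proof.
move=> rv a b; apply: val_inj => /=.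
have := rv (fun i : 'I_3 => nth 0 [:: 2 * a; a + b; a] i).
rewrite !sum3 !mxE /= => rv'.
have -> : (a * (2 * al 0 i1 + al 0 i2 + al 0 i3) + b * al 0 i2) =
    (2 * a * al 0 i1 + (a + b) * al 0 i2 + a * al 0 i3) by ring.
rewrite -rv'; congr lie; rewrite -[LHS]/(a *: H1 + b *: H2) /H1 /H2.
rewrite !scalerDr scalerA (mulrC 2) scalerDl.
by rewrite -!addrA; congr (_ + (_ + _)); rewrite addrC.
Qed.

Lemma wt_space_quot (V : lieModType Fib) (N : submod V) mu (v : V) :
  wt_space mu v -> wt_space mu (quot_pi N v : quot_mod N).
Proof.
move=> wv a b; by rewrite [LHS]quot_actE wv -quot_scaleE.
Qed.

Lemma Y0_diagonalizable : diagonalizable Y0.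
Proof.
rewrite /diagonalizable; apply: quot_ind => x.
have : fib0 (val x) by exact: asboolW (valP x).
move vE: (val x) => v fv; elim: fv x vE => [|a {}v w gv fw IH] x xE.
  rewrite (_ : x = 0); last exact: val_inj.
  exact: lspan0.
have fv : v \in submod_pred Fib0 by apply/asboolP/lspan_in.
have fw' : w \in submod_pred Fib0 by apply/asboolP.
pose v' : Fib0 := exist _ v fv; pose w' : Fib0 := exist _ w fw'.
rewrite (_ : x = a *: v' + w'); last exact: val_inj.
rewrite quot_pi_linear; apply: lspanD; last exact: IH.
have [y [z [t [_ rv]]]] := fib0_span_graded gv.
exists (fib_restr (root3 y z t)).
by apply: wt_space_quot; apply: fib_wt_space.
Qed.

End Fibonacci.

Arguments diagonalizable {K} V.
Arguments pos_part {K} V _.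
Arguments neg_part {K} V _.
Arguments highest_weight_module {K} V.
Arguments lowest_weight_module {K} V.

(* Main.v *)
Require Import Defs.
From HB Require Import structures.
From mathcomp Require Import all_boot all_order all_algebra complex.
From mathcomp Require Import ring zify boolp classical_sets reals.

(** Why the theorem holds.

    Let tr be the antilinear anti-involution of F that exchanges e_i and f_i,
    let (x | y) be the invariant bilinear form of F, and H(x, y) = (x | tr y).
    Then ad u and ad (tr u) are adjoint for H, and H is positive definite on
    every root space (herm_pos). Since tr preserves Fib and V0 commutes with Fib,
    the orthogonal of V0 + Fib in Fib(0) is a Fib-submodule. Root spaces are
    finite dimensional and Fib is graded, so that it is a complement of V0 + Fib
    (fib0_decomposition), and hence a copy of Y(0) inside Fib(0). It meets the
    Cartan subalgebra only in 0, because V0 and the Cartan subalgebra of Fib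
    span the latter, on which the form is nondegenerate.

    A root 2z alpha1 + y alpha2 + z alpha3 of Fib(0) restricts to a weight of
    Fib with wt = - y. A root with y = 0 would have norm 10 z^2, whereas no
    root has norm above 2 (root_norm_le2). So the complement lives in the
    weights with y > 0 and y < 0. These two halves are submodules: E_1, E_2
    raise y by one and F_1, F_2 lower it by one, so that y can change sign
    only through y = 0. On the half y > 0, the level y is bounded below and H
    is positive definite with F_i adjoint to E_i. Such a module is the
    orthogonal sum of the modules generated by an orthogonal basis of the
    vectors killed by F_1 and F_2 (unitarizable_decomposition). The other half
    is the same with E and F exchanged.

    The form. Let phi be the functional on the Cartan subalgebra that maps the
    coroot of al to the height of al. An invariant form must satisfy
    phi [x, y] = p (x | y) for x in degree p, which defines it for p != 0; its
    invariance is proved by induction on the degrees (form_inv_le).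

    Positivity. Let T be the sum of the operators ad u ad (tr u), where u runs
    over orthonormal bases of the degrees between 1 and N - 1. On a root space
    of height N, invariance of the form makes T the scalar
    2N - (al | al) (casimir_root), so that (2N - (al | al)) H(x, x) is the sum
    of the norms H([tr u, x], [tr u, x]) in lower degrees. The scalar is
    positive for N > 1 because (al | al) <= 2: a positive root of larger norm
    has a positive product with a simple root of its support, and the
    corresponding reflection, which preserves roots by the theory of sl2,
    lowers its height but not its norm (root_norm_le2_pos).

    All this presupposes that the e_j are nonzero, which makes the h_i
    independent. If some e_j is zero, then so is F (e0_trivial), and the
    theorem reduces to a statement on zero modules. *)

Set Implicit Arguments.
Unset Strict Implicit.
Unset Printing Implicit Defensive.

Import Order.TTheory GRing.Theory Num.Theory.
Local Open Scope ring_scope.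

(** * Spans and linear maps *)

Section LinearMaps.
Variables (K : fieldType) (V W : lmodType K) (f : V -> W).
Hypothesis fL : linear f.

Lemma linearD_prop u v : f (u + v) = f u + f v.
Proof. by have := fL 1 u v; rewrite !scale1r. Qed.
Lemma linear0_prop : f 0 = 0.
Proof. by apply: (@addrI _ (f 0)); rewrite -linearD_prop !addr0. Qed.
Lemma linearZ_prop a u : f (a *: u) = a *: f u.
Proof. by have := fL a u 0; rewrite linear0_prop !addr0. Qed.
Lemma linearN_prop u : f (- u) = - f u.
Proof. by rewrite -scaleN1r linearZ_prop scaleN1r. Qed.
Lemma linear_sum_prop (I : Type) (r : seq I) (P : pred I) (F : I -> V) :
  f (\sum_(i <- r | P i) F i) = \sum_(i <- r | P i) f (F i).
Proof.
elim: r => [|i r IH]; rewrite ?big_nil ?linear0_prop // !big_cons -IH.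
by case: (P i); rewrite ?linearD_prop.
Qed.
End LinearMaps.

Lemma lspan_sub (K : fieldType) (V : lmodType K) (S P : set V) :
  P 0 -> (forall a x y, P x -> P y -> P (a *: x + y)) ->
  (forall x, S x -> P x) -> forall x, lspan S x -> P x.
Proof. by move=> P0 Pl PS x; elim=> // a {}x y /PS Px _ Py; apply: Pl. Qed.

Lemma lspan_mono (K : fieldType) (V : lmodType K) (S T : set V) :
  (forall x, S x -> T x) -> forall x, lspan S x -> lspan T x.
Proof.
move=> ST; apply: lspan_sub => [|a x y|x /ST Tx]; first exact: lspan0.
- exact: lspan_lin.
- exact: lspan_in.
Qed.

Lemma lspan_sum (K : fieldType) (V : lmodType K) (S : set V) (I : eqType)
    (r : seq I) (F : I -> V) :
  (forall i, i \in r -> lspan S (F i)) -> lspan S (\sum_(i <- r) F i).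
Proof.
move=> FS; rewrite big_seq; elim/big_ind: _ => [|x y|i /FS //].
- exact: lspan0.
- exact: lspan_add.
Qed.

(** * Simultaneous eigenspaces *)

Section Weights.
Variables (K : fieldType) (V : lmodType K) (T : Type) (S : eqType).
Variables (ev : S -> T -> K) (D : T -> V -> V).
Hypothesis DL : forall t, linear (D t).
Hypothesis ev_inj : forall s s', (forall t, ev s t = ev s' t) -> s = s'.

(** S only names the joint eigenvalues, so that the same results serve for the
    root spaces, with three operators, and for the principal grading, with a
    single one. *)
Definition weight s : set V := [set v | forall t, D t v = ev s t *: v].

Lemma weight0 s : weight s 0.
Proof. by move=> t; rewrite linear0_prop // scaler0. Qed.

Lemma weight_lin s a u v : weight s u -> weight s v -> weight s (a *: u + v).
Proof. by move=> su sv t; rewrite DL su sv scalerDr !scalerA mulrC. Qed.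

Lemma weight_indep (r : seq S) (w : S -> V) : uniq r ->
  (forall s, s \in r -> weight s (w s)) -> \sum_(s <- r) w s = 0 ->
  forall s, s \in r -> w s = 0.
Proof.
elim: r w => [|s0 r IH] w //= /andP[s0r ur] ww s0w.
have ws : forall s, s \in r -> w s = 0.
  move=> s sr; have [t st] : exists t, ev s t != ev s0 t.
    apply: contrapT => nt; have ss0 : s = s0.
      by apply: ev_inj => t; apply/eqP/negPn/negP => st; apply: nt; exists t.
    by rewrite -ss0 sr in s0r.
  (* D t - ev s0 t kills the term of s0 and rescales the others. *)
  have : (ev s t - ev s0 t) *: w s = 0.
    apply: (IH (fun s' => (ev s' t - ev s0 t) *: w s')) => // [s' s'r t'|].
      rewrite (linearZ_prop (DL t')) ww ?inE ?s'r ?orbT //.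
      by rewrite !scalerA mulrC.
    have : D t (\sum_(s' <- s0 :: r) w s') = 0 by rewrite s0w (linear0_prop (DL t)).
    rewrite (linear_sum_prop (DL t)) big_cons ww ?mem_head //.
    move: s0w; rewrite big_cons => /eqP; rewrite addr_eq0 => /eqP ->.
    rewrite scalerN addrC => /eqP; rewrite subr_eq0 => /eqP Dr.
    under eq_bigr do rewrite scalerBl.
    rewrite sumrB -scaler_sumr -Dr; apply/eqP; rewrite subr_eq0; apply/eqP.
    by apply: eq_big_seq => s' s'r; rewrite ww // inE s'r orbT.
  by move/eqP; rewrite scaler_eq0 subr_eq0 (negPf st) => /eqP.
move=> s; rewrite inE => /predU1P[->|/ws//].
by move: s0w; rewrite big_cons big_seq big1 ?addr0.
Qed.

Lemma weight_uniq s s' v : weight s v -> weight s' v -> v != 0 -> s = s'.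
Proof.
move=> sv s'v v0; apply: ev_inj => t; have := sv t; rewrite s'v => /eqP.
by rewrite -subr_eq0 -scalerBl scaler_eq0 (negPf v0) orbF subr_eq0 => /eqP.
Qed.

Hypothesis wt_full : forall v, lspan [set w | exists s, weight s w] v.

Definition weight_dec (v : V) (r : seq (S * V)) :=
  (forall p, p \in r -> weight p.1 p.2) /\ v = \sum_(p <- r) p.2.

Lemma weight_dec_ex v : exists r, weight_dec v r.
Proof.
elim: (wt_full v) => [|a {}v w [s sv] _ [r [rP ->]]].
  by exists [::]; split; rewrite ?big_nil.
exists ((s, a *: v) :: r); split; last by rewrite big_cons.
move=> p; rewrite inE => /predU1P[->|/rP//] /=.
by rewrite -[_ *: _]addr0; apply: weight_lin => //; apply: weight0.
Qed.

(** This is what makes weight_op below independent of the decomposition. *)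
Lemma weight_dec0 (c : S -> K) r :
  weight_dec 0 r -> \sum_(p <- r) c p.1 *: p.2 = 0.
Proof.
move=> [rP r0]; set ks := undup [seq p.1 | p <- r].
have part (G : S * V -> V) :
    \sum_(p <- r) G p = \sum_(s <- ks) \sum_(p <- r | p.1 == s) G p.
  rewrite (exchange_big_dep predT) //=.
  apply: eq_big_seq => p pr.
  rewrite big_mkcond (bigD1_seq p.1) ?undup_uniq //=; last first.
    by rewrite mem_undup; apply/mapP; exists p.
  by rewrite eqxx big1 ?addr0 // => s /negPf; rewrite eq_sym => ->.
rewrite part; apply: big1_seq => s /= sks.
have sG : \sum_(p <- r | p.1 == s) p.2 = 0.
  apply: (@weight_indep ks (fun s => \sum_(p <- r | p.1 == s) p.2));
    rewrite ?undup_uniq // -?part // => s' _.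
  rewrite big_seq_cond; elim/big_ind: _ => [|u v su sv|p /andP[/rP pw /eqP<-]] //.
    exact: weight0.
  by rewrite -[u]scale1r; apply: weight_lin.
transitivity (c s *: \sum_(p <- r | p.1 == s) p.2); last by rewrite sG scaler0.
by rewrite scaler_sumr; apply: eq_bigr => p /eqP->.
Qed.

(** Both the projections and the inverse of the degree operator are of this
    form. *)
Definition weight_op (c : S -> K) (v : V) : V :=
  \sum_(p <- sval (cid (weight_dec_ex v))) c p.1 *: p.2.

Lemma weight_opE c v r : weight_dec v r ->
  weight_op c v = \sum_(p <- r) c p.1 *: p.2.
Proof.
move=> [rP rE]; rewrite /weight_op.
case: (cid _) => r' [r'P r'E] /=; apply/eqP; rewrite -subr_eq0; apply/eqP.
have := @weight_dec0 c (r' ++ [seq (p.1, - p.2) | p <- r]).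
rewrite !big_cat !big_map /=; under [X in _ + X = 0]eq_bigr do rewrite scalerN.
rewrite sumrN => -> //; split; last first.
  by rewrite big_cat big_map /= sumrN -r'E -rE subrr.
move=> p; rewrite mem_cat => /orP[/r'P//|/mapP[q /rP qP ->]] /= t.
by rewrite (linearN_prop (DL t)) qP scalerN.
Qed.

Lemma weight_op_linear c : linear (weight_op c).
Proof.
move=> a u v; have [[r [rP uE]] [r' [r'P vE]]] := (weight_dec_ex u, weight_dec_ex v).
rewrite (@weight_opE c u r) // (@weight_opE c v r') //.
rewrite (@weight_opE c _ ([seq (p.1, a *: p.2) | p <- r] ++ r')).
  rewrite big_cat big_map /= scaler_sumr; congr (_ + _); apply: eq_bigr => p _.
  by rewrite !scalerA mulrC.
split; last by rewrite big_cat big_map /= -scaler_sumr -uE -vE.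
move=> p; rewrite mem_cat => /orP[/mapP[q /rP qP ->]|/r'P//] /= t.
by rewrite (linearZ_prop (DL t)) qP !scalerA mulrC.
Qed.

Lemma weight_op_weight c s v : weight s v -> weight_op c v = c s *: v.
Proof.
move=> sv; rewrite (@weight_opE c v [:: (s, v)]) ?big_seq1 //.
by split; rewrite ?big_seq1 // => p; rewrite inE => /eqP->.
Qed.

Definition weight_proj s : V -> V := weight_op (fun s' => (s' == s)%:R).

Lemma weight_proj_linear s : linear (weight_proj s).
Proof. exact: weight_op_linear. Qed.

Lemma weight_projE s s' v :
  weight s' v -> weight_proj s v = if s' == s then v else 0.
Proof.
move=> s'v; rewrite /weight_proj (weight_op_weight _ s'v).
by case: eqP => _; rewrite ?scale1r ?scale0r.
Qed.

Lemma weight_proj_id s v : weight s v -> weight_proj s v = v.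
Proof. by move/weight_projE->; rewrite eqxx. Qed.

Lemma weight_proj_weight s v : weight s (weight_proj s v).
Proof.
elim: (wt_full v) => [|a {}v w [s' s'v] _ IH].
  by rewrite (linear0_prop (weight_proj_linear s)); apply: weight0.
rewrite weight_proj_linear; apply: weight_lin => //.
by rewrite (weight_projE _ s'v); case: eqP => [<-|_] //; apply: weight0.
Qed.

Lemma weight_proj_sum v : exists r : seq S, uniq r /\
  v = \sum_(s <- r) weight_proj s v.
Proof.
have [r [rP vE]] := weight_dec_ex v.
exists (undup [seq p.1 | p <- r]); split; first exact: undup_uniq.
under eq_bigr do rewrite [in weight_proj _ _]vE (linear_sum_prop (weight_proj_linear _)).
rewrite exchange_big /= [LHS]vE; apply: eq_big_seq => p pr.
rewrite (bigD1_seq p.1) ?undup_uniq //=; last first.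
  by rewrite mem_undup; apply/mapP; exists p.
rewrite (weight_proj_id (rP p pr)) big1 ?addr0 // => s sp.
by rewrite (weight_projE _ (rP p pr)) eq_sym (negPf sp).
Qed.

(** The projection to the weight s fixes v and kills the elements of X of the
    other weights. *)
Lemma weight_span (X : set V) s v :
  (forall x, X x -> exists s', weight s' x) -> weight s v -> lspan X v ->
  lspan [set x | X x /\ weight s x] v.
Proof.
move=> XW sv Xv; rewrite -(weight_proj_id sv).
apply: (lspan_map (weight_proj_linear s) _ Xv) => x Xx; have [s' s'x] := XW x Xx.
rewrite (weight_projE _ s'x).
by case: eqP => [ss'|_]; [apply: lspan_in; rewrite -ss' | apply: lspan0].
Qed.

End Weights.

(** * Hermitian forms and orthogonal bases *)

Section Hermitian.
Variables (K : numClosedFieldType) (V : lmodType K) (H : V -> V -> K).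
Hypothesis HL : forall a u v w, H (a *: u + v) w = a * H u w + H v w.
Hypothesis HC : forall u v, H v u = (H u v)^*.

Lemma herm0l w : H 0 w = 0.
Proof.
by have := HL 1 0 0 w; rewrite scale1r addr0 mul1r => /eqP;
  rewrite -subr_eq0 opprD addNKr oppr_eq0 => /eqP.
Qed.
Lemma hermDl u v w : H (u + v) w = H u w + H v w.
Proof. by have := HL 1 u v w; rewrite scale1r mul1r. Qed.
Lemma hermZl a u w : H (a *: u) w = a * H u w.
Proof. by have := HL a u 0 w; rewrite !addr0 herm0l addr0. Qed.
Lemma hermNl u w : H (- u) w = - H u w.
Proof. by rewrite -[- u]scaleN1r hermZl mulN1r. Qed.
Lemma herm_suml (I : Type) (r : seq I) (F : I -> V) w :
  H (\sum_(i <- r) F i) w = \sum_(i <- r) H (F i) w.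
Proof.
by elim: r => [|i r IH]; rewrite ?big_nil ?herm0l // !big_cons hermDl IH.
Qed.
Lemma herm_sym0 u v : H u v = 0 -> H v u = 0.
Proof. by move=> uv; rewrite HC uv conjC0. Qed.
Lemma herm0r w : H w 0 = 0. Proof. exact/herm_sym0/herm0l. Qed.
Lemma hermDr u v w : H w (u + v) = H w u + H w v.
Proof. by rewrite HC hermDl rmorphD /= -!HC. Qed.
Lemma hermZr a u w : H w (a *: u) = a^* * H w u.
Proof. by rewrite HC hermZl rmorphM /= -HC. Qed.
Lemma hermNr u w : H w (- u) = - H w u.
Proof. by rewrite HC hermNl rmorphN /= -HC. Qed.

Lemma herm_span0 (S : set V) u : (forall v, S v -> H v u = 0) ->
  forall v, lspan S v -> H v u = 0.
Proof.
move=> Su; apply: lspan_sub => // [|a x y xu yu]; first exact: herm0l.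
by rewrite HL xu yu mulr0 addr0.
Qed.

Definition orth_seq (b : seq V) : Prop :=
  (forall u, u \in b -> H u u != 0) /\ pairwise (fun u v => H u v == 0) b.

Definition oproj (b : seq V) (v : V) : V := \sum_(u <- b) (H v u / H u u) *: u.

Lemma oproj_span b v : lspan [set u | u \in b] (oproj b v).
Proof. by apply: lspan_sum => u ub; apply/lspan_scale/lspan_in. Qed.

Lemma oproj_herm b v u : orth_seq b -> u \in b -> H (oproj b v) u = H v u.
Proof.
elim: b => // w b IH [nz]; rewrite /= => /andP[/allP wb pb].
have ob : orth_seq b by split=> // t tb; rewrite nz // inE tb orbT.
rewrite inE => /predU1P[->|ub]; rewrite /oproj big_cons hermDl hermZl.
  rewrite divfK ?nz ?mem_head // herm_suml big_seq big1 ?addr0 // => t tb.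
  by rewrite hermZl (herm_sym0 (eqP (wb t tb))) mulr0.
by rewrite (eqP (wb u ub)) mulr0 add0r; apply: IH.
Qed.

Lemma oproj_orth b v u : orth_seq b -> u \in b -> H (v - oproj b v) u = 0.
Proof. by move=> ob ub; rewrite hermDl hermNl oproj_herm // subrr. Qed.

Lemma orth_seq_ext b v : orth_seq b -> H (v - oproj b v) (v - oproj b v) != 0 ->
  orth_seq (v - oproj b v :: b).
Proof.
move=> ob nz; split=> [u|]; first by rewrite inE => /predU1P[->//|]; apply: (proj1 ob).
rewrite /= (proj2 ob) andbT; apply/allP => u ub.
by rewrite /= (oproj_orth _ ob ub).
Qed.

(** Gram-Schmidt: as H is anisotropic on the span, each orthogonalized vector is
    zero or has a nonzero norm. *)
Lemma gram_schmidt (r : seq V) :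
  (forall v, lspan [set u | u \in r] v -> v != 0 -> H v v != 0) ->
  exists b, [/\ orth_seq b, forall u, u \in b -> lspan [set u | u \in r] u
    & forall v, lspan [set u | u \in r] v -> v = oproj b v].
Proof.
elim: r => [|x r IH] nz.
  exists [::]; split=> // v; rewrite /oproj big_nil.
  by apply: (lspan_sub (P := fun v => v = 0)) => // a u w -> ->; rewrite scaler0 addr0.
have sub u : lspan [set u | u \in r] u -> lspan [set u | u \in x :: r] u.
  by apply: lspan_mono => v /= vr; rewrite inE vr orbT.
have [v /sub/nz//|b [ob br rb]] := IH.
have opl a u v : oproj b (a *: u + v) = a *: oproj b u + oproj b v.
  rewrite /oproj scaler_sumr -big_split; apply: eq_bigr => w _ /=.
  by rewrite HL mulrDl scalerDl scalerA mulrA.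
set x' := x - oproj b x.
have x'r : lspan [set u | u \in x :: r] x'.
  apply: lspan_add; first by apply: lspan_in; rewrite /= mem_head.
  apply: lspan_opp; elim: (oproj_span b x) => [|a u v ub _ IHv]; first exact: lspan0.
  by apply: lspan_lin => //; apply/sub/br.
have fix_r c : (forall u, u \in x :: r -> u = oproj c u) ->
    forall v, lspan [set u | u \in x :: r] v -> v = oproj c v.
  move=> cE; apply: lspan_sub => [|a u v uE vE|//].
    by rewrite /oproj big1 // => u _; rewrite herm0l mul0r scale0r.
  rewrite {1}uE {1}vE /oproj scaler_sumr -big_split; apply: eq_bigr => w _ /=.
  by rewrite HL mulrDl scalerDl scalerA mulrA.
have [x0|x'0] := eqVneq x' 0.
  exists b; split=> // [u /br/sub//|]; apply: fix_r => u.
  rewrite inE => /predU1P[->|ur]; last by apply/rb/lspan_in.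
  by apply/eqP; rewrite -subr_eq0 -/x' x0.
have nz' := nz _ x'r x'0.
exists (x' :: b); split=> [|u|]; first exact: orth_seq_ext.
  by rewrite inE => /predU1P[->//|/br/sub].
have x'orth u : u \in b -> H u x' = 0.
  by move=> ub; apply/herm_sym0/oproj_orth.
have x'b v : H (oproj b v) x' = 0.
  by apply: (herm_span0 _ (oproj_span b v)) => u /= /x'orth.
apply: fix_r => u; rewrite inE => /predU1P[->|ur].
  rewrite /oproj big_cons -/(oproj b x).
  have -> : H x x' = H x' x' by rewrite {2}/x' hermDl hermNl x'b subr0.
  by rewrite divff // scale1r subrK.
have uE : u = oproj b u by apply/rb/lspan_in.
by rewrite /oproj big_cons -/(oproj b u) {2}uE x'b mul0r scale0r add0r.
Qed.

(** Finite dimension is expressed by separating functionals, which can be pulled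
    back along an embedding. By induction on their number, an orthogonal basis
    of the kernel of the last one is completed by one vector. *)
Lemma orthogonal_basis (n : nat) (l : nat -> V -> K) (W : set V) :
  (forall i a u v, l i (a *: u + v) = a * l i u + l i v) ->
  W 0 -> (forall a u v, W u -> W v -> W (a *: u + v)) ->
  (forall v, W v -> v != 0 -> H v v != 0) ->
  (forall v, W v -> (forall i, (i < n)%N -> l i v = 0) -> v = 0) ->
  exists b, [/\ orth_seq b, forall u, u \in b -> W u
    & forall v, W v -> lspan [set u | u \in b] v].
Proof.
move=> ll; elim: n W => [|n IH] W W0 Wl nz sep.
  by exists [::]; split=> // v Wv; rewrite (sep v Wv) //; apply: lspan0.
have l0 : l n 0 = 0.
  by have := ll n 1 0 0; rewrite scale1r addr0 mul1r => /eqP;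
    rewrite -subr_eq0 opprD addNKr oppr_eq0 => /eqP.
have [||v [Wv _]|v [Wv lv] sv|b [ob bW Wb]] := IH (fun v : V => W v /\ l n v = 0).
- by split.
- move=> a u v [Wu lu] [Wv lv].
  by split; [apply: Wl | rewrite ll lu lv mulr0 addr0].
- exact: nz.
- apply: sep => // i; rewrite ltnS leq_eqVlt => /predU1P[->//|]; exact: sv.
have [Wl0|] := pselect (forall v, W v -> l n v = 0).
  by exists b; split=> // [u /bW[]//|v Wv]; apply: (Wb v (conj Wv (Wl0 v Wv))).
move=> /existsNP[x /not_implyP[Wx /eqP lx]].
have Wb' v : lspan [set u | u \in b] v -> W v /\ l n v = 0.
  apply: (lspan_sub (P := fun v => W v /\ l n v = 0)); last exact: bW.
    by split.
  move=> a u w [Wu lu] [Ww lw].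
  by split; [apply: Wl | rewrite ll lu lw mulr0 addr0].
set x' := x - oproj b x.
have [Wo lo] := Wb' _ (oproj_span b x).
have x'E : x' = -1 *: oproj b x + x by rewrite scaleN1r addrC.
have Wx' : W x' by rewrite x'E; apply: Wl.
have lx' : l n x' != 0 by rewrite x'E ll lo mulr0 add0r.
have x'0 : x' != 0 by apply: contraNneq lx' => ->; rewrite l0.
exists (x' :: b); split=> [|u|v Wv]; first exact/orth_seq_ext/nz.
  by rewrite inE => /predU1P[->//|/bW[]].
have vE : v = (l n v / l n x') *: x' + (- (l n v / l n x') *: x' + v).
  by rewrite addrA -scalerDl subrr scale0r add0r.
rewrite vE; apply: lspanD; first by rewrite /= mem_head.
apply: (@lspan_mono _ _ [set u | u \in b]) => [u /= ub|]; first by rewrite inE ub orbT.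
by apply: Wb; split; [apply: Wl | rewrite ll mulNr divfK // addNr].
Qed.

End Hermitian.

Section Nilpotency.
Variables (K : fieldType) (L : lieAlgType K).

Definition ad_nilp (x y : L) := exists m, iter m (lie x) y = 0.

Lemma iter_lie0 (x : L) m : iter m (lie x) 0 = 0.
Proof. by elim: m => //= m ->; rewrite liex0. Qed.

Lemma iter_lie_linear (x : L) m : linear (iter m (lie x)).
Proof. by elim: m => // m IH a u v; rewrite !iterS IH lie_linearr. Qed.

Lemma ad_nilp_leq (x y : L) m k : (m <= k)%N ->
  iter m (lie x) y = 0 -> iter k (lie x) y = 0.
Proof. by move=> mk y0; rewrite -(subnK mk) iterD y0 iter_lie0. Qed.

(** By the Leibniz rule, each term of (ad x)^(m + k) [y, z] contains (ad x)^m y or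
    (ad x)^k z. *)
Lemma ad_nilp_lie (x y z : L) : ad_nilp x y -> ad_nilp x z -> ad_nilp x (lie y z).
Proof.
move=> [m ym] [k zk]; exists (m + k)%N; move sE: (m + k)%N => s.
elim: s m k sE y z ym zk => [|s IH] m k mk y z ym zk.
  by move: mk ym => /eqP; rewrite addn_eq0 => /andP[/eqP-> _] /= ->; rewrite lie0x.
rewrite iterSr lie_leibniz (linearD_prop (iter_lie_linear _ _)).
case: m mk ym => [|m] mk ym.
  by rewrite [y]ym liex0 !lie0x (linear0_prop (iter_lie_linear _ _)) addr0.
case: k mk zk => [|k] mk zk.
  by rewrite [z]zk liex0 !liex0 (linear0_prop (iter_lie_linear _ _)) addr0.
rewrite (IH m k.+1) ?add0r //; last by rewrite -iterSr.
  by rewrite (IH m.+1 k) //; [lia | rewrite -iterSr].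
by lia.
Qed.

End Nilpotency.

(** * The Chevalley anti-involution *)

Section Transpose.
Variables (K : numClosedFieldType) (n : nat) (A : 'M[int]_n).
Notation L := (kac_moody K A).
Notation h := (km_h K A).
Notation e := (km_e K A).
Notation f := (km_f K A).

Lemma km_serre_e i j : i != j -> iter `|1 - A i j|%N (lie (e i)) (e j) = 0.
Proof.
move=> ij; rewrite -[RHS](km_relE (km_rel_ee K A ij)).
by elim: `|_|%N => //= m ->; rewrite pres_piL.
Qed.
Lemma km_serre_f i j : i != j -> iter `|1 - A i j|%N (lie (f i)) (f j) = 0.
Proof.
move=> ij; rewrite -[RHS](km_relE (km_rel_ff K A ij)).
by elim: `|_|%N => //= m ->; rewrite pres_piL.
Qed.

Fixpoint transpose_term (s : lie_term K (km_gen n)) : L :=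
  match s with
  | LVar (GenH i) => h i
  | LVar (GenE i) => f i
  | LVar (GenF i) => e i
  | LZero => 0
  | LAdd s t => transpose_term s + transpose_term t
  | LScale a s => a^* *: transpose_term s
  | LBr s t => lie (transpose_term t) (transpose_term s)
  end.

Lemma iter_lieC (x y : L) m :
  iter m (fun z => lie z x) y = (-1) ^+ m *: iter m (lie x) y.
Proof.
elim: m => [|m /= ->]; first by rewrite scale1r.
by rewrite lieC lieZr exprS mulN1r scaleNr.
Qed.

(** The defining relations are exchanged by e <-> f, up to signs, and their
    coefficients are integers, hence invariant under conjugation. *)
Lemma transpose_term_eq s t :
  pres_eq (@km_rel K n A) s t -> transpose_term s = transpose_term t.
Proof.
have conjA i j : ((A i j)%:~R : K)^* = (A i j)%:~R by rewrite rmorph_int.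
elim=> {s t}.
- move=> s t; case=> [i j|i j|i j|i j|i j ij|i j ij] /=.
  + exact: km_hh.
  + by rewrite conjA lieC km_hf scaleNr opprK.
  + by rewrite rmorphN /= conjA lieC km_he scaleNr.
  + by rewrite km_ef eq_sym; case: ifP => [/eqP->|].
  + rewrite -[RHS](scaler0 _ ((-1) ^+ `|1 - A i j|)) -(km_serre_f ij) -iter_lieC.
    by elim: `|_|%N => //= m ->.
  + rewrite -[RHS](scaler0 _ ((-1) ^+ `|1 - A i j|)) -(km_serre_e ij) -iter_lieC.
    by elim: `|_|%N => //= m ->.
- by [].
- by [].
- by move=> s t u _ -> _ ->.
- by move=> s s' t t' _ /= -> _ ->.
- by move=> a s s' _ /= ->.
- by move=> s s' t t' _ /= -> _ ->.
- by move=> s t u /=; rewrite addrA.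
- by move=> s t /=; rewrite addrC.
- by move=> s /=; rewrite add0r.
- by move=> s /=; rewrite rmorphN1 scaleN1r addNr.
- by move=> a b s /=; rewrite scalerA rmorphM.
- by move=> s /=; rewrite rmorph1 scale1r.
- by move=> a s t /=; rewrite scalerDr.
- by move=> a b s /=; rewrite rmorphD scalerDl.
- by move=> a s t u /=; rewrite lieDr lieZr.
- by move=> a s t u /=; rewrite lieDl lieZl.
- by move=> s /=; rewrite liexx.
- move=> s t u /=; set x := transpose_term s; set y := transpose_term t.
  set z := transpose_term u.
  rewrite (lieC (lie z y)) (lieC z y) (lieC (lie x z)) (lieC x z) (lieC (lie y x)).
  by rewrite (lieC y x) !lieNr !opprK lie_jacobi.
Qed.

(** Antilinearity makes the form (x | transpose y) Hermitian. *)
Definition transpose (x : L) : L := transpose_term (repr x).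

Lemma transpose_pi s : transpose (pres_pi (@km_rel K n A) s) = transpose_term s.
Proof. exact/transpose_term_eq/pres_repr. Qed.

Lemma transpose_h i : transpose (h i) = h i. Proof. exact: transpose_pi. Qed.
Lemma transpose_e i : transpose (e i) = f i. Proof. exact: transpose_pi. Qed.
Lemma transpose_f i : transpose (f i) = e i. Proof. exact: transpose_pi. Qed.

Lemma transpose_antilinear a x y :
  transpose (a *: x + y) = a^* *: transpose x + transpose y.
Proof.
elim/pres_ind: x => s; elim/pres_ind: y => t.
by rewrite -pres_piZ -pres_piD !transpose_pi.
Qed.

Lemma transpose_lie x y : transpose (lie x y) = lie (transpose y) (transpose x).
Proof.
by elim/pres_ind: x => s; elim/pres_ind: y => t; rewrite -pres_piL !transpose_pi.
Qed.

Lemma transpose0 : transpose 0 = 0. Proof. exact: transpose_pi. Qed.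

Lemma transposeZ a x : transpose (a *: x) = a^* *: transpose x.
Proof. by have := transpose_antilinear a x 0; rewrite transpose0 !addr0. Qed.

Lemma transposeD x y : transpose (x + y) = transpose x + transpose y.
Proof. by have := transpose_antilinear 1 x y; rewrite rmorph1 !scale1r. Qed.

Lemma transposeN x : transpose (- x) = - transpose x.
Proof. by rewrite -scaleN1r transposeZ rmorphN1 scaleN1r. Qed.

Lemma transpose_sum (I : Type) (r : seq I) (F : I -> L) :
  transpose (\sum_(i <- r) F i) = \sum_(i <- r) transpose (F i).
Proof.
by elim: r => [|i r IH]; rewrite ?big_nil ?transpose0 // !big_cons transposeD IH.
Qed.

Lemma transposeK : involutive transpose.
Proof.
apply: pres_alg_ind => [|a x y xK yK|x y xK yK|[] i].
- by rewrite !transpose0.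
- by rewrite !transpose_antilinear conjCK xK yK.
- by rewrite !transpose_lie xK yK.
- by rewrite transpose_h transpose_h.
- by rewrite transpose_e transpose_f.
- by rewrite transpose_f transpose_e.
Qed.

Lemma transpose_span (S T : set L) : (forall x, S x -> lspan T (transpose x)) ->
  forall x, lspan S x -> lspan T (transpose x).
Proof.
move=> ST x; elim=> [|a {}x y Sx _ IH]; first by rewrite transpose0; apply: lspan0.
by rewrite transpose_antilinear; apply: lspan_lin => //; apply: ST.
Qed.

Lemma transpose_bracket_e k x : bracket e k x ->
  exists2 y, bracket f k y & transpose x = y \/ transpose x = - y.
Proof.
elim=> [j|j {}k {}x _ [y fy xy]].
  by exists (f j); [apply: bracket1 | left; rewrite transpose_e].
exists (lie (f j) y); first exact: bracketS.
rewrite transpose_lie transpose_e lieC.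
by case: xy => ->; [right | left; rewrite lieNr opprK].
Qed.

(** By ad_nilp_lie it suffices to check the generators; on the e j this is the
    Serre relation. *)
Lemma km_e_nilp i x : ad_nilp (e i) x.
Proof.
move: x; apply: pres_alg_ind => [|a x y [m xm] [k yk]|x y|[] j].
- by exists 0%N.
- exists (m + k)%N; rewrite iter_lie_linear.
  rewrite (ad_nilp_leq (leq_addr k m) xm) (ad_nilp_leq (leq_addl m k) yk).
  by rewrite scaler0 addr0.
- exact: ad_nilp_lie.
- exists 2%N; rewrite /= -/(h j) [lie (e i) (h j)]lieC km_he.
  by rewrite lieNr lieZr liexx scaler0 oppr0.
- have [<-|ij] := eqVneq i j; first by exists 1%N; rewrite /= liexx.
  by exists `|1 - A i j|%N; apply: km_serre_e.
- exists 3%N; rewrite /= -/(f j) km_ef; case: ifP => _; last by rewrite !liex0.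
  by rewrite [lie (e i) (h i)]lieC km_he !lieNr !lieZr liexx ?(scaler0, oppr0, liex0).
Qed.

End Transpose.

(** * Strings for sl2 *)

Section Sl2.
Variables (K : numFieldType) (L : lieAlgType K) (e f h : L).
Hypotheses (ef : lie e f = h) (he : lie h e = 2 *: e) (hf : lie h f = - 2 *: f).

Lemma sl2_weight_f m (c : K) v : lie h v = c *: v ->
  lie h (iter m (lie f) v) = (c - (2 * m)%:R) *: iter m (lie f) v.
Proof.
move=> hv; elim: m => [|m IH] /=; first by rewrite subr0.
rewrite lie_leibniz hf lieZl IH lieZr -scalerDl; congr (_ *: _).
by rewrite mulnS natrD; ring.
Qed.

Lemma sl2_ef m (c : K) v : lie h v = c *: v ->
  lie e (iter m.+1 (lie f) v) = iter m.+1 (lie f) (lie e v)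
    + (m.+1%:R * (c - m%:R)) *: iter m (lie f) v.
Proof.
move=> hv; elim: m => [|m IH].
  by rewrite /= lie_leibniz ef hv addrC mul1r subr0.
rewrite [in LHS]iterS lie_leibniz ef IH lieDr lieZr.
rewrite (sl2_weight_f m.+1 hv) addrCA -!iterS -scalerDl; congr (_ + _ *: _).
by rewrite mulnS mul2n -addnn !natrD !mulrS; ring.
Qed.

(** A vector of weight k on which e is nilpotent survives k applications of f:
    if f^k kills v, then f^(k+2) kills e v, since e commutes with f^(k+1) on v;
    so e v = 0 by induction on the order of nilpotency, and v would be a
    highest weight vector with too short a string. *)
Lemma sl2_string m (k : nat) v : iter m (lie e) v = 0 -> lie h v = k%:R *: v ->
  iter k (lie f) v = 0 -> v = 0.
Proof.
elim: m k v => [//|m IH] k v em hv fv.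
have ev : lie e v = 0.
  apply: (IH k.+2); first by rewrite -iterSr.
    by rewrite lie_leibniz he lieZl hv lieZr -scalerDl -natrD.
  have := sl2_ef k hv; rewrite subrr mulr0 scale0r addr0 !iterS => H.
  by rewrite -H -iterS [iter k.+1 _ _]iterS fv !liex0.
suff string j : (j <= k)%N -> iter j (lie f) v = 0 -> v = 0 by apply: string fv.
elim: j => [//|j IHj] jk fjv; apply: (IHj (ltnW jk)).
have := sl2_ef j hv; rewrite fjv liex0 ev iter_lie0 add0r => /esym/eqP.
by rewrite scaler_eq0 mulf_eq0 pnatr_eq0 subr_eq0 eqr_nat (gtn_eqF jk) => /eqP.
Qed.

End Sl2.

(** * The roots of F *)

Section Roots.
Variable K : numClosedFieldType.
Notation L := (Falg K).
Notation h := (km_h K A3).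
Notation e := (km_e K A3).
Notation f := (km_f K A3).
Notation root_sp := (@root_space K 3 A3).
Notation root3 := (root3 K).
Notation tri := (@triangular K 3 A3).
Notation tr := (@transpose K 3 A3).

Definition cartan_ev (al : 'rV[K]_3) (i : 'I_3) : K := al 0 i.
Definition cartan_op (i : 'I_3) (x : L) : L := lie (h i) x.

Lemma cartan_op_linear i : linear (cartan_op i).
Proof. exact: lie_linearr. Qed.

Lemma cartan_ev_inj al be : (forall i, cartan_ev al i = cartan_ev be i) -> al = be.
Proof. by move=> ab; apply/rowP. Qed.

Lemma root_weight al (x : L) : root_sp al x <-> weight cartan_ev cartan_op al x.
Proof.
split=> [rx i|wx c].
  have := rx (fun j => (j == i)%:R); rewrite (bigD1 i) //= (bigD1 (P := predT) i) //=.
  rewrite !eqxx scale1r mul1r !big1 ?addr0 // => j /negPf->.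
    by rewrite mul0r.
  by rewrite scale0r.
rewrite lie_suml scaler_suml; apply: eq_bigr => i _.
by rewrite lieZl [lie _ x]wx scalerA.
Qed.

Lemma root_space_lin al a (x y : L) :
  root_sp al x -> root_sp al y -> root_sp al (a *: x + y).
Proof.
move=> /root_weight rx /root_weight ry; apply/root_weight.
exact: (weight_lin cartan_op_linear).
Qed.

Lemma root_space_0 al : root_sp al (0 : L).
Proof. exact/root_weight/(weight0 _ cartan_op_linear). Qed.

Lemma root3E x y z :
  [/\ root3 x y z 0 i1 = (2 * x - 2 * y)%:~R,
      root3 x y z 0 i2 = (- 2 * x + 2 * y - z)%:~R
    & root3 x y z 0 i3 = (- y + 2 * z)%:~R].
Proof. by rewrite /root3 !mxE /=; split; rewrite ?(intrD, intrB, intrM, intrN); ring. Qed.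

Lemma root3_inj x y z x' y' z' :
  root3 x y z = root3 x' y' z' -> [/\ x = x', y = y' & z = z'].
Proof.
move=> r; have [a1 a2 a3] := root3E x y z; have [b1 b2 b3] := root3E x' y' z'.
move: b1 b2 b3; rewrite -r a1 a2 a3.
by move=> /eqP + /eqP + /eqP; rewrite !eqr_int => /eqP ? /eqP ? /eqP ?; split; lia.
Qed.

Lemma root3_0 : root3 0 0 0 = 0.
Proof. by rewrite /root3 !scale0r !addr0. Qed.

Lemma root3N x y z : - root3 x y z = root3 (- x) (- y) (- z).
Proof. by rewrite /root3 !intrN !scaleNr !opprD. Qed.

Lemma simple_root3 i :
  simple_root K A3 i = root3 (i == i1)%:Z (i == i2)%:Z (i == i3)%:Z.
Proof.
by move: i; apply: ord3_ind; rewrite /root3 /= !scale0r ?scale1r ?add0r ?addr0.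
Qed.

Lemma transpose_root x y z (v : L) :
  root_sp (root3 x y z) v -> root_sp (root3 (- x) (- y) (- z)) (tr v).
Proof.
rewrite -root3N => /root_weight rv; apply/root_weight => i.
have : lie (tr v) (h i) = (cartan_ev (root3 x y z) i)^* *: tr v.
  by rewrite -transposeZ -(rv i) transpose_lie transpose_h.
rewrite /cartan_op lieC => /eqP; rewrite eqr_oppLR -scaleNr => /eqP ->.
congr (_ *: _); rewrite /cartan_ev [RHS]mxE; congr (- _).
have [a1 a2 a3] := root3E x y z; move: i {rv}; apply: ord3_ind.
- by rewrite a1 rmorph_int.
- by rewrite a2 rmorph_int.
- by rewrite a3 rmorph_int.
Qed.

(** The last clause, that no proper multiple of a simple root is a root, starts
    the reflection argument below: only a positive root supported on a single
    simple root can be made negative by a reflection. *)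
Lemma bracket_e_root k (x : L) : bracket e k x -> exists a b c : nat,
  [/\ k = (a + b + c)%N, root_sp (root3 a b c) x
    & [\/ a + b = 0, a + c = 0 | b + c = 0]%N -> k = 1%N \/ x = 0].
Proof.
suff H : bracket e k x -> exists u : 'I_3 -> nat,
    [/\ k = (u i1 + u i2 + u i3)%N,
        root_sp (root3 (u i1) (u i2) (u i3)) x
      & forall i, (forall j, j != i -> u j = 0%N) -> k = 1%N /\ x = e i \/ x = 0].
  move=> /H[u [ku ru uu]]; exists (u i1), (u i2), (u i3); split=> // su.
  have [i ui] : exists i, forall j, j != i -> u j = 0%N.
    by case: su => su; [exists i3 | exists i2 | exists i1];
      apply: ord3_ind => // _; lia.
  by case: (uu i ui) => [[-> _]|->]; [left | right].
elim=> [j|j {}k {}x _ [u [ku ru uu]]].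
  exists (fun i => (i == j) : nat); split.
  - by move: j; apply: ord3_ind.
  - rewrite (_ : root3 _ _ _ = simple_root K A3 j); first exact: root_space_e.
    by rewrite simple_root3 ![j == _]eq_sym.
  - move=> i ij; left; split=> //; congr e; apply/eqP.
    by have := ij j; case: eqP => // _ /(_ isT); rewrite eqxx.
exists (fun i => (i == j) + u i)%N; split.
- by rewrite ku; move: j; apply: ord3_ind => /=; lia.
- rewrite !PoszD -root3D; apply: root_space_lie => //.
  by rewrite ![_ == j]eq_sym -simple_root3; apply: root_space_e.
- move=> i ui; have ij : i = j.
    apply/eqP; apply: contraT; rewrite eq_sym => /ui /eqP.
    by rewrite addn_eq0 eqxx.
  right; subst j; case: (uu i) => [j ji|[_ ->]|->]; rewrite ?liexx ?liex0 //.
  by have := ui j ji; rewrite (negPf ji).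
Qed.

Lemma transpose_bracket_f k (x : L) : bracket f k x ->
  exists2 y, bracket e k y & x = tr y \/ x = - tr y.
Proof.
elim=> [j|j {}k {}x _ [y ey xy]].
  by exists (e j); [apply: bracket1 | left; rewrite transpose_e].
exists (lie (e j) y); first exact: bracketS.
rewrite transpose_lie transpose_e [lie (f j) x]lieC.
by case: xy => ->; rewrite ?lieNl ?opprK; [right | left].
Qed.

Lemma bracket_f_root k (x : L) : bracket f k x -> exists a b c : nat,
  [/\ k = (a + b + c)%N & root_sp (root3 (- a%:Z) (- b%:Z) (- c%:Z)) x].
Proof.
move=> /transpose_bracket_f[y /bracket_e_root[a [b [c [kE ry _]]]] xy].
exists a, b, c; split=> //; have := transpose_root ry.
by case: xy => -> //; rewrite -[- tr y]scaleN1r; apply: root_spaceZ.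
Qed.

Lemma triangular_root (x : L) : tri x -> exists a b c, root_sp (root3 a b c) x.
Proof.
case=> [[j _ <-]|[[k bx]|[k bx]]].
- by exists 0, 0, 0; rewrite root3_0; apply: root_space_h.
- by have [a [b [c [_ r _]]]] := bracket_e_root bx; exists a, b, c.
- by have [a [b [c [_ r]]]] := bracket_f_root bx; exists (- a%:Z), (- b%:Z), (- c%:Z).
Qed.

Lemma root_full (x : L) :
  lspan [set y | exists al, weight cartan_ev cartan_op al y] x.
Proof.
apply: lspan_mono (km_triangular x) => y /triangular_root[a [b [c r]]].
by exists (root3 a b c); apply/root_weight.
Qed.

Definition root_proj (al : 'rV[K]_3) : L -> L :=
  weight_proj cartan_op_linear root_full al.

Lemma root_proj_linear al : linear (root_proj al).
Proof. exact: weight_proj_linear cartan_ev_inj _ _. Qed.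

Lemma root_projE al be x :
  root_sp be x -> root_proj al x = if be == al then x else 0.
Proof. by move=> /root_weight; apply: weight_projE; apply: cartan_ev_inj. Qed.

Lemma root_proj_root al x : root_sp al (root_proj al x).
Proof. exact/root_weight/weight_proj_weight/cartan_ev_inj. Qed.

Lemma root_proj_sum x : exists r : seq 'rV[K]_3, uniq r /\
  x = \sum_(al <- r) root_proj al x.
Proof. exact: weight_proj_sum cartan_ev_inj _ _. Qed.

Lemma root_uniq al be (x : L) : root_sp al x -> root_sp be x -> x != 0 -> al = be.
Proof.
move=> /root_weight ax /root_weight bx x0.
exact: (weight_uniq cartan_ev_inj ax bx x0).
Qed.

Lemma root_span (X : set L) al x :
  (forall y, X y -> exists be, root_sp be y) -> root_sp al x -> lspan X x ->
  lspan [set y | X y /\ root_sp al y] x.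
Proof.
move=> XR /root_weight rx Xx.
have := weight_span cartan_op_linear cartan_ev_inj root_full _ rx Xx.
move=> /(_ _)/(lspan_mono _); apply=> [y [Xy wy]|y /XR[be ry]].
  by split=> //; apply/root_weight.
by exists be; apply/root_weight.
Qed.

(** By the triangular decomposition x is a sum of h_i and of brackets of its own
    weight; one of them is not zero. *)
Lemma root_coords al (x : L) : root_sp al x -> x != 0 -> al != 0 ->
  exists a b c : nat, [/\ (0 < a + b + c)%N,
    al = root3 a b c \/ al = root3 (- a%:Z) (- b%:Z) (- c%:Z) &
    [\/ a + b = 0, a + c = 0 | b + c = 0]%N -> (a + b + c = 1)%N].
Proof.
move=> rx x0 al0; have tx := @root_span tri al x _ rx (km_triangular x).
have {}tx : lspan [set y | tri y /\ root_sp al y] x.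
  by apply: tx => y /triangular_root[a [b [c r]]]; exists (root3 a b c).
apply: contrapT => nc; move/eqP: x0; apply; move: x tx {rx}.
apply: (lspan_sub (P := fun y => y = 0)) => // [a x y -> ->|y [ty ry]].
  by rewrite scaler0 addr0.
apply: contrapT => /eqP y0; apply: nc.
case: ty => [[j _ yE]|[[k bx]|[k bx]]].
- have ry0 : root_sp 0 y by rewrite -yE; apply: root_space_h.
  by rewrite (root_uniq ry ry0 y0) eqxx in al0.
- have [a [b [c [kE r sE]]]] := bracket_e_root bx.
  exists a, b, c; split; first by rewrite -kE; case: bx.
    by left; apply: root_uniq ry r y0.
  by rewrite -kE => /sE[//|yE]; rewrite yE eqxx in y0.
- have [z bz yz] := transpose_bracket_f bx.
  have [a [b [c [kE r sE]]]] := bracket_e_root bz.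
  exists a, b, c; split; first by rewrite -kE; case: bx.
    right; apply: root_uniq ry _ y0; have := transpose_root r.
    by case: yz => -> //; rewrite -[- tr z]scaleN1r; apply: root_spaceZ.
  rewrite -kE => /sE[//|zE].
  by move: y0; case: yz => ->; rewrite zE transpose0 ?oppr0 eqxx.
Qed.

(** The norm (al | al) of al = a alpha1 + b alpha2 + c alpha3. *)
Definition root_norm (a b c : int) : int :=
  2 * a * a + 2 * b * b + 2 * c * c - 4 * a * b - 2 * b * c.

Lemma iter_f_root i m a b c (x : L) : root_sp (root3 a b c) x ->
  root_sp (root3 (a - m%:Z * (i == i1)%:Z) (b - m%:Z * (i == i2)%:Z)
                 (c - m%:Z * (i == i3)%:Z))
    (iter m (lie (f i)) x).
Proof.
move=> rx; elim: m => [|m IH]; first by rewrite !mul0r !subr0.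
have := root_space_lie (@root_space_f K 3 A3 i) IH.
rewrite simple_root3 root3N root3D iterS.
by congr (root_sp (root3 _ _ _) _); rewrite -[m.+1]add1n PoszD; ring.
Qed.

(** The vector (ad f_i)^m x has the reflected root. It is not zero by the theory
    of sl2-strings, ad e_i being locally nilpotent. *)
Lemma root_reflect i (m : nat) a b c (x : L) :
  root_sp (root3 a b c) x -> x != 0 -> root3 a b c 0 i = m%:R ->
  iter m (lie (f i)) x != 0.
Proof.
move=> rx x0 mE; apply: contraNneq x0 => fx0.
have [k ex0] := km_e_nilp i x.
have ii : (A3 i i)%:~R = 2 :> K by move: i {mE fx0 ex0}; apply: ord3_ind; rewrite mxE.
have efh : lie (e i) (f i) = h i by rewrite km_ef eqxx.
have he : lie (h i) (e i) = 2 *: e i by rewrite km_he ii.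
have hf : lie (h i) (f i) = - 2 *: f i by rewrite km_hf ii.
apply/eqP; apply: (sl2_string efh he hf ex0 _ fx0).
by have /root_weight := rx; move/(_ i); rewrite /cartan_op /cartan_ev mE.
Qed.

(** A root with norm above 2 would have a positive product with some simple
    root in its support, and the reflection in that simple root would give a
    root with the same norm and a smaller height. *)
Lemma root_norm_le2_pos (a b c : nat) (x : L) :
  root_sp (root3 a b c) x -> x != 0 -> root_norm a b c <= 2.
Proof.
move: {2}(a + b + c)%N (leqnn (a + b + c)) => n.
elim: n a b c x => [|n IH] a b c x; first by rewrite leqn0 !addn_eq0 /root_norm; lia.
move=> abcn rx x0; rewrite leNgt; apply/negP => q2.
have step i (m : nat) (a' b' c' : nat) :
    root3 a b c 0 i = m%:R -> (0 < m)%N ->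
    [/\ a%:Z - m%:Z * (i == i1)%:Z = a', b%:Z - m%:Z * (i == i2)%:Z = b'
      & c%:Z - m%:Z * (i == i3)%:Z = c'] ->
    root_norm a' b' c' = root_norm a b c -> False.
  move=> mE m0 [aE bE cE] qE; have := iter_f_root i m rx.
  rewrite aE bE cE => r; have := root_reflect rx x0 mE => y0.
  suff abc' : (a' + b' + c' <= n)%N.
    by have := IH a' b' c' _ abc' r y0; rewrite qE leNgt q2.
  by move: i aE bE cE {mE r y0}; apply: ord3_ind => /=; lia.
(* The reflected root is still positive, as x has a second simple root in its
   support. *)
have nz i (m : nat) : root3 a b c 0 i = m%:R -> (0 < m)%N -> exists a' b' c' : nat,
    [/\ a%:Z - m%:Z * (i == i1)%:Z = a', b%:Z - m%:Z * (i == i2)%:Z = b'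
      & c%:Z - m%:Z * (i == i3)%:Z = c'].
  move=> mE m0; have rfx := iter_f_root i m rx; have fx0 := root_reflect rx x0 mE.
  have abc0 : root3 a b c != 0.
    by apply: contra_eq_neq mE => ->; rewrite mxE eq_sym pnatr_eq0 -lt0n.
  have [a0 [b0 [c0 [_ aE sE]]]] := root_coords rx x0 abc0.
  have {aE} [aE bE cE] : [/\ a = a0, b = b0 & c = c0].
    by case: aE => /root3_inj[? ? ?]; split; lia.
  subst a0 b0 c0.
  have s1 : ~ [\/ a + b = 0, a + c = 0 | b + c = 0]%N.
    move=> s; have := sE s; move: q2; rewrite /root_norm.
    by case: s => ss s1;
      [have [-> ->] : a = 0%N /\ b = 0%N by lia
      |have [-> ->] : a = 0%N /\ c = 0%N by lia
      |have [-> ->] : b = 0%N /\ c = 0%N by lia]; lia.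
  have r0 : root3 (a%:Z - m%:Z * (i == i1)%:Z) (b%:Z - m%:Z * (i == i2)%:Z)
      (c%:Z - m%:Z * (i == i3)%:Z) != 0.
    rewrite -root3_0; apply/eqP => /root3_inj[]; move: i {mE rfx fx0}.
    apply: ord3_ind => /= *; apply: s1;
      [apply: Or33 | apply: Or32 | apply: Or31]; lia.
  have [a1 [b1 [c1 [s0 aE _]]]] := root_coords rfx fx0 r0.
  exists a1, b1, c1; case: aE => /root3_inj[aE bE cE]; first by split.
  exfalso; apply: s1; move: i {mE rfx fx0 r0} aE bE cE; apply: ord3_ind => /= *;
    [apply: Or33 | apply: Or32 | apply: Or31]; lia.
have red i (m : int) : root3 a b c 0 i = m%:~R -> 0 < m ->
    root_norm (a%:Z - m * (i == i1)%:Z) (b%:Z - m * (i == i2)%:Z)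
      (c%:Z - m * (i == i3)%:Z) = root_norm a b c -> False.
  case: m => // m mE m0 qE; have [a' [b' [c' [aE bE cE]]]] := nz i m mE m0.
  by apply: (step i m a' b' c') => //; rewrite -aE -bE -cE.
have [E1 E2 E3] := root3E a b c.
have : [\/ (0 < a)%N /\ 0 < 2 * a%:Z - 2 * b%:Z,
   (0 < b)%N /\ 0 < - 2 * a%:Z + 2 * b%:Z - c%:Z | (0 < c)%N /\ 0 < - b%:Z + 2 * c%:Z].
  apply: contrapT => nn; move: q2; rewrite ltNge => /negP; apply.
  (* The norm is the sum of the coefficients of the root times its products
     with the simple roots. *)
  have neg (u : nat) (v : int) : ~ ((0 < u)%N /\ 0 < v) -> u%:Z * v <= 0.
    move=> uv; case: (posnP u) => [->|u0]; first by rewrite mul0r.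
    by rewrite pmulr_rle0 // leNgt; apply/negP => v0; apply: uv.
  have -> : root_norm a b c = a%:Z * (2 * a%:Z - 2 * b%:Z)
      + b%:Z * (- 2 * a%:Z + 2 * b%:Z - c%:Z) + c%:Z * (- b%:Z + 2 * c%:Z).
    by rewrite /root_norm; ring.
  have := neg a _ (fun uv => nn (Or31 _ _ uv)).
  have := neg b _ (fun uv => nn (Or32 _ _ uv)).
  by have := neg c _ (fun uv => nn (Or33 _ _ uv)); lia.
by case=> [] [_ m0]; [apply: (red i1 _ E1 m0)|apply: (red i2 _ E2 m0)
  |apply: (red i3 _ E3 m0)]; rewrite /root_norm /=; ring.
Qed.

Lemma root_sign a b c (x : L) : root_sp (root3 a b c) x -> x != 0 ->
  [/\ 0 <= a, 0 <= b & 0 <= c] \/ [/\ a <= 0, b <= 0 & c <= 0].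
Proof.
move=> rx x0; have [|r0] := eqVneq (root3 a b c) 0.
  by rewrite -root3_0 => /root3_inj[-> -> ->]; left.
have [a' [b' [c' [_ aE _]]]] := root_coords rx x0 r0.
by case: aE => /root3_inj[-> -> ->]; [left | right]; split; lia.
Qed.

Lemma root_norm_le2 a b c (x : L) :
  root_sp (root3 a b c) x -> x != 0 -> root_norm a b c <= 2.
Proof.
move=> rx x0; case: (root_sign rx x0) => -[].
  by move: a b c rx => [a|//] [b|//] [c|//] rx _ _ _; apply: root_norm_le2_pos rx x0.
move=> a0 b0 c0; have tx0 : tr x != 0.
  by apply: contraNneq x0 => tx; rewrite -(transposeK x) tx transpose0.
have -> : root_norm a b c = root_norm (- a) (- b) (- c) by rewrite /root_norm; ring.
move: (transpose_root rx).
have [a' ->] : exists a' : nat, - a = a' by exists `|a|%N; lia.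
have [b' ->] : exists b' : nat, - b = b' by exists `|b|%N; lia.
have [c' ->] : exists c' : nat, - c = c' by exists `|c|%N; lia.
by move=> tr'; apply: root_norm_le2_pos tr' tx0.
Qed.

End Roots.

(** * The principal grading *)

Section Form.
Variable K : numClosedFieldType.
Notation L := (Falg K).
Notation h := (km_h K A3).
Notation e := (km_e K A3).
Notation f := (km_f K A3).
Notation hval c := (\sum_i c i *: h i).
Notation tri := (@triangular K 3 A3).
Notation root_sp := (@root_space K 3 A3).
Notation root3 := (root3 K).
Notation tr := (@transpose K 3 A3).

(** The coordinates of the element of the Cartan subalgebra on which all simple
    roots are 1. *)
Definition rho (i : 'I_3) : K := nth 0 [:: - (9 / 2); -5; -2] i.

Lemma rho_simple j : \sum_i rho i * (A3 i j)%:~R = 1.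
Proof. by move: j; apply: ord3_ind; rewrite sum3 !mxE /rho /=; field. Qed.

Definition degree_op (_ : unit) (x : L) : L := lie (hval rho) x.
Definition degree_ev (p : int) (_ : unit) : K := p%:~R.

Lemma degree_op_linear t : linear (degree_op t).
Proof. exact: lie_linearr. Qed.

Lemma degree_ev_inj p q : (forall t, degree_ev p t = degree_ev q t) -> p = q.
Proof. by move=> /(_ tt)/intr_inj. Qed.

Definition gr (p : int) : set L := weight degree_ev degree_op p.

Lemma grP p x : gr p x <-> lie (hval rho) x = p%:~R *: x.
Proof. by split=> [/(_ tt)|gx []]. Qed.

Lemma gr0 p : gr p 0. Proof. exact: (weight0 _ degree_op_linear). Qed.
Lemma gr_lin p a x y : gr p x -> gr p y -> gr p (a *: x + y).
Proof. exact: (weight_lin degree_op_linear). Qed.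

Lemma gr_lie p q x y : gr p x -> gr q y -> gr (p + q) (lie x y).
Proof.
move=> /grP gx /grP gy; apply/grP.
by rewrite lie_leibniz gx gy lieZl lieZr intrD scalerDl.
Qed.

Lemma gr_uniq p q x : gr p x -> gr q x -> p != q -> x = 0.
Proof.
move=> gp gq; apply: contra_neq_eq => x0; exact: (weight_uniq degree_ev_inj gp gq).
Qed.

Lemma gr_h i : gr 0 (h i).
Proof. by apply/grP; rewrite km_hval_h scale0r. Qed.

Lemma gr_bracket_e k x : bracket e k x -> gr k x.
Proof.
move=> bx; apply/grP; rewrite (eigen_bracket_height (a := 1) _ bx) ?mul1r //.
move=> j; rewrite root_space_e -[in RHS](rho_simple j); congr (_ *: _).
by apply: eq_bigr => i _; rewrite mxE.
Qed.

Lemma gr_bracket_f k x : bracket f k x -> gr (- k%:Z) x.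
Proof.
move=> bx; apply/grP; rewrite (eigen_bracket_height (a := -1) _ bx).
  by rewrite mulN1r intrN.
move=> j; rewrite root_space_f -[in RHS](rho_simple j) -sumrN; congr (_ *: _).
by apply: eq_bigr => i _; rewrite !mxE mulrN.
Qed.

Lemma triangular_gr x : tri x -> exists p, gr p x.
Proof.
case=> [[j _ <-]|[[k bx]|[k bx]]].
- by exists 0; apply: gr_h.
- by exists k; apply: gr_bracket_e.
- by exists (- k%:Z); apply: gr_bracket_f.
Qed.

Lemma gr_full (x : L) : lspan [set y | exists p, weight degree_ev degree_op p y] x.
Proof. by apply: lspan_mono (km_triangular x) => y /triangular_gr. Qed.

Lemma gr_span p x : gr p x -> lspan [set y | tri y /\ gr p y] x.
Proof.
move=> gx.
apply: (weight_span degree_op_linear degree_ev_inj gr_full triangular_gr gx).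
exact: km_triangular.
Qed.

Lemma gr_span_sub (T : set L) p x : (forall y, tri y -> gr p y -> y != 0 -> lspan T y) ->
  gr p x -> lspan T x.
Proof.
move=> H /gr_span; apply: lspan_sub; first exact: lspan0.
  by move=> *; apply: lspan_lin.
move=> y [ty gy]; have [->|] := eqVneq y 0; [exact: lspan0 | exact: H].
Qed.

Lemma gr0_span x : gr 0 x -> lspan (range h) x.
Proof.
apply: gr_span_sub => y ty gy y0; case: ty => [|[[k bx]|[k bx]]].
- exact: lspan_in.
- have k0 : k%:Z != 0 by case: bx.
  by rewrite (gr_uniq (gr_bracket_e bx) gy k0) eqxx in y0.
- have k0 : - k%:Z != 0 by case: bx.
  by rewrite (gr_uniq (gr_bracket_f bx) gy k0) eqxx in y0.
Qed.

Lemma gr_span_e (k : nat) x : gr k.+1 x -> lspan (bracket e k.+1) x.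
Proof.
apply: gr_span_sub => y ty gy y0; case: ty => [[j _ yE]|[[l bx]|[l bx]]].
- move: y0; rewrite -yE in gy *; rewrite (gr_uniq (gr_h j) gy) ?eqxx //.
- have [<-|lk] := eqVneq l k.+1; first exact: lspan_in.
  by rewrite (gr_uniq (gr_bracket_e bx) gy) ?eqxx // in y0.
- rewrite (gr_uniq (gr_bracket_f bx) gy) ?eqxx // in y0; lia.
Qed.

Lemma gr_span_f (k : nat) x : gr (- k.+1%:Z) x -> lspan (bracket f k.+1) x.
Proof.
apply: gr_span_sub => y ty gy y0; case: ty => [[j _ yE]|[[l bx]|[l bx]]].
- move: y0; rewrite -yE in gy *; rewrite (gr_uniq (gr_h j) gy) ?eqxx //.
- rewrite (gr_uniq (gr_bracket_e bx) gy) ?eqxx // in y0; lia.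
- have [<-|lk] := eqVneq l k.+1; first exact: lspan_in.
  by rewrite (gr_uniq (gr_bracket_f bx) gy) ?eqxx // in y0; lia.
Qed.

Lemma transpose_gr p x : gr p x -> gr (- p) (tr x).
Proof.
move=> gx; suff : lspan [set y | gr (- p) y] (tr x).
  apply: (lspan_sub (P := gr (- p))) => //; first exact: gr0.
  by move=> *; apply: gr_lin.
apply: (transpose_span _ (gr_span gx)) => y [ty gy].
have [->|y0] := eqVneq y 0; first by rewrite transpose0; apply: lspan0.
apply: lspan_in => /=; case: ty => [[j _ yE]|[[k bx]|[k bx]]].
- have := gr_uniq (gr_h j); rewrite yE => /(_ _ gy); case: eqVneq => [<- _|_ /(_ isT)].
    by rewrite -yE transpose_h oppr0; apply: gr_h.
  by move=> yz; rewrite yz eqxx in y0.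
- have := gr_uniq (gr_bracket_e bx) gy; case: eqVneq => [<- _|_ /(_ isT) yz]; last first.
    by rewrite yz eqxx in y0.
  have [z bz yz] := transpose_bracket_e bx; have gz := gr_bracket_f bz.
  by case: yz => ->//; rewrite -scaleN1r -[_ *: _]addr0; apply: gr_lin gz (gr0 _).
- have := gr_uniq (gr_bracket_f bx) gy; case: eqVneq => [<- _|_ /(_ isT) yz]; last first.
    by rewrite yz eqxx in y0.
  have [z bz yz] := transpose_bracket_f bx; have gz := gr_bracket_e bz.
  rewrite opprK; case: yz => ->; rewrite ?transposeN transposeK //.
  by rewrite -scaleN1r -[_ *: _]addr0; apply: gr_lin gz (gr0 _).
Qed.

Definition gr_proj (p : int) : L -> L := weight_proj degree_op_linear gr_full p.

Lemma gr_proj_linear p : linear (gr_proj p).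
Proof. exact: weight_proj_linear degree_ev_inj _ _. Qed.

Lemma gr_projE p q x : gr q x -> gr_proj p x = if q == p then x else 0.
Proof. exact: weight_projE degree_ev_inj _ _ _ _. Qed.

Lemma gr_proj_gr p x : gr p (gr_proj p x).
Proof. exact: weight_proj_weight degree_ev_inj _ _ _. Qed.

Lemma gr_ind (P : L -> Prop) : P 0 -> (forall a x y, P x -> P y -> P (a *: x + y)) ->
  (forall p x, gr p x -> P x) -> forall x, P x.
Proof.
move=> P0 Pl Pg x; apply: (lspan_sub P0 Pl _ (gr_full x)) => y [p gy].
exact: Pg gy.
Qed.

(** * The invariant form *)

(** The alternative makes F trivial (e0_trivial). *)
Hypothesis e_neq0 : forall j, e j != 0.

Lemma cartan_matrix_inj (c : 'I_3 -> K) :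
  (forall j, \sum_i c i * (A3 i j)%:~R = 0) -> forall i, c i = 0.
Proof.
move=> ce; move: (ce i1) (ce i2) (ce i3); rewrite !sum3 !mxE /= => c1 c2 c3.
apply: ord3_ind.
- transitivity (- (3 / 2 * 0 + 2 * 0 + 0) : K); last by ring.
  by rewrite -{1}c1 -{1}c2 -c3; field.
- transitivity (- (2 * 0 + 2 * 0 + 0) : K); last by ring.
  by rewrite -{1}c1 -{1}c2 -c3; ring.
- transitivity (- (0 + 0) : K); last by ring.
  by rewrite -{1}c1 -c2; ring.
Qed.

(** A linear relation between the h_i acts by zero on the e_j. *)
Lemma h_indep (c : 'I_3 -> K) : hval c = 0 -> forall i, c i = 0.
Proof.
move=> c0; apply: cartan_matrix_inj => j.
apply/eqP; have := @root_space_e K 3 A3 j c; rewrite c0 lie0x => /esym/eqP.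
rewrite scaler_eq0 (negPf (e_neq0 j)) orbF; congr (_ == 0).
by apply: eq_bigr => i _; rewrite mxE.
Qed.

Lemma cartan_coord x : exists c, gr_proj 0 x = hval c.
Proof.
elim: (gr0_span (gr_proj_gr 0 x)) => [|a _ y [i _ <-] _ [c ->]].
  by exists (fun=> 0); rewrite big1 // => i _; rewrite scale0r.
exists (fun j => a * (j == i)%:R + c j).
under [RHS]eq_bigr do rewrite scalerDl; rewrite big_split /=; congr (_ + _).
rewrite (bigD1 i) //= eqxx mulr1 big1 ?addr0 // => j /negPf->.
by rewrite mulr0 scale0r.
Qed.

(** Through gr_proj, coord i is extended by zero to the nonzero degrees. *)
Definition coord (i : 'I_3) (x : L) : K := sval (cid (cartan_coord x)) i.

Lemma coordP x : gr_proj 0 x = \sum_i coord i x *: h i.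
Proof. by rewrite /coord; case: (cid _). Qed.

Lemma coord_uniq x c : gr_proj 0 x = hval c -> forall i, coord i x = c i.
Proof.
rewrite coordP => xc i; apply/eqP; rewrite -subr_eq0; apply/eqP.
apply: (h_indep (c := fun i => coord i x - c i)).
by under eq_bigr do rewrite scalerBl; rewrite sumrB xc subrr.
Qed.

Lemma coord_lin i a x y : coord i (a *: x + y) = a * coord i x + coord i y.
Proof.
apply: (@coord_uniq _ (fun i => a * coord i x + coord i y)).
rewrite gr_proj_linear !coordP scaler_sumr -big_split /=.
by apply: eq_bigr => j _; rewrite scalerA scalerDl.
Qed.

Lemma coord_gr i p x : gr p x -> p != 0 -> coord i x = 0.
Proof.
move=> gx p0; apply: (@coord_uniq _ (fun=> 0)); rewrite (gr_projE _ gx) (negPf p0).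
by rewrite big1 // => j _; rewrite scale0r.
Qed.

Lemma coord_hval c i : coord i (hval c) = c i.
Proof.
apply: (@coord_uniq _ c); have gc : gr 0 (hval c).
  rewrite sum3 -addrA; apply: gr_lin (gr_h _) _.
  by apply: gr_lin (gr_h _) _; rewrite -[_ *: _]addr0; apply: gr_lin (gr_h _) (gr0 _).
by rewrite (gr_projE _ gc) eqxx.
Qed.

Lemma coord_h i j : coord i (h j) = (i == j)%:R.
Proof.
have -> : h j = hval (fun k => (k == j)%:R).
  rewrite (bigD1 j) //= eqxx scale1r big1 ?addr0 // => k /negPf->.
  by rewrite scale0r.
exact: coord_hval.
Qed.

Lemma gr0_coord x : gr 0 x -> x = \sum_i coord i x *: h i.
Proof. by move=> gx; rewrite -coordP (gr_projE _ gx) eqxx. Qed.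

(** phi maps the coroot of al to the height of al. *)
Definition phi (x : L) : K := coord i1 x + coord i2 x + coord i3 x.
(** (h_i | h_j) = a_ij, the matrix A being symmetric. *)
Definition hform (x y : L) : K := \sum_i \sum_j coord i x * (A3 i j)%:~R * coord j y.
(** In degree 0 this is 0, by the convention 0^-1 = 0. *)
Definition deg_inv : L -> L :=
  weight_op degree_op_linear gr_full (fun p => (p%:~R)^-1).

(** For x of degree p != 0 this is phi [x, y] / p: an invariant form satisfies
    [x, y] = (x | y) coroot al on the root spaces of al and - al, and phi takes
    the value p on the coroot. *)
Definition form (x y : L) : K := phi (lie (deg_inv x) y) + hform x y.

Lemma phi_lin a x y : phi (a *: x + y) = a * phi x + phi y.
Proof. by rewrite /phi !coord_lin; ring. Qed.

Lemma phi_gr p x : gr p x -> p != 0 -> phi x = 0.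
Proof. by move=> gx p0; rewrite /phi !(coord_gr _ gx p0) !addr0. Qed.

Lemma phi0 : phi 0 = 0.
Proof. exact: (phi_gr (p := 1) (gr0 _)). Qed.

Lemma phiN x : phi (- x) = - phi x.
Proof. by rewrite -scaleN1r -[_ *: _]addr0 phi_lin phi0 addr0 mulN1r. Qed.

Lemma phiZ a x : phi (a *: x) = a * phi x.
Proof. by rewrite -[_ *: _]addr0 phi_lin phi0 addr0. Qed.

Lemma deg_inv_linear : linear deg_inv.
Proof. exact: weight_op_linear degree_ev_inj _ _. Qed.

Lemma deg_invE p x : gr p x -> deg_inv x = p%:~R^-1 *: x.
Proof. exact: weight_op_weight degree_ev_inj _ _ _ _. Qed.

Lemma hformC x y : hform x y = hform y x.
Proof.
rewrite /hform exchange_big; apply: eq_bigr => i _; apply: eq_bigr => j _.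
have -> : A3 j i = A3 i j by move: i j; do 2!apply: ord3_ind; rewrite !mxE.
by ring.
Qed.

Lemma hform_linl a x y z : hform (a *: x + y) z = a * hform x z + hform y z.
Proof.
rewrite /hform mulr_sumr -big_split; apply: eq_bigr => i _ /=.
by rewrite mulr_sumr -big_split; apply: eq_bigr => j _ /=; rewrite coord_lin; ring.
Qed.

Lemma form_linl a x y z : form (a *: x + y) z = a * form x z + form y z.
Proof.
by rewrite /form deg_inv_linear lie_linearl phi_lin hform_linl; ring.
Qed.

Lemma form_linr a x y z : form z (a *: x + y) = a * form z x + form z y.
Proof.
by rewrite /form lie_linearr phi_lin !(hformC z) hform_linl; ring.
Qed.

Lemma form_gr p x y : gr p x -> p != 0 -> p%:~R * form x y = phi (lie x y).
Proof.
move=> gx p0; rewrite /form (deg_invE gx) lieZl phiZ mulrDr mulrA divff ?intr_eq0 //.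
rewrite mul1r /hform big1 ?mulr0 ?addr0 // => i _; apply: big1 => j _.
by rewrite (coord_gr _ gx p0) !mul0r.
Qed.

Lemma form_gr0 x y : gr 0 x -> form x y = hform x y.
Proof. by move=> gx; rewrite /form (deg_invE gx) invr0 scale0r lie0x phi0 add0r. Qed.

Lemma form0 p q x y : gr p x -> gr q y -> p + q != 0 -> form x y = 0.
Proof.
move=> gx gy pq; have [p0|p0] := eqVneq p 0.
  rewrite p0 add0r in pq; rewrite p0 in gx.
  rewrite form_gr0 // /hform big1 // => i _; apply: big1 => j _.
  by rewrite (coord_gr _ gy pq) mulr0.
have := form_gr y gx p0; rewrite (phi_gr (gr_lie gx gy) pq) => /eqP.
by rewrite mulf_eq0 intr_eq0 (negPf p0) => /eqP.
Qed.

Lemma form0l y : form 0 y = 0.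
Proof.
have := form_linl 1 0 0 y; rewrite scale1r addr0 mul1r => /eqP.
by rewrite -subr_eq0 opprD addNKr oppr_eq0 => /eqP.
Qed.

Lemma form0r y : form y 0 = 0.
Proof.
have := form_linr 1 0 0 y; rewrite scale1r addr0 mul1r => /eqP.
by rewrite -subr_eq0 opprD addNKr oppr_eq0 => /eqP.
Qed.

Lemma formC x y : form x y = form y x.
Proof.
move: x y; apply: gr_ind => [y|a x x' IH IH' y|p x gx].
- by rewrite form0l form0r.
- by rewrite form_linl form_linr IH IH'.
apply: gr_ind => [|a y y' IH IH'|q y gy].
- by rewrite form0l form0r.
- by rewrite form_linl form_linr IH IH'.
have [pq|pq] := eqVneq (p + q) 0; last first.
  by rewrite (form0 gx gy) // (form0 gy gx) // addrC.
have qE : q = - p by apply/eqP; rewrite -addr_eq0 addrC pq.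
have [p0|p0] := eqVneq p 0.
  by rewrite qE p0 oppr0 in gx gy; rewrite !form_gr0 // hformC.
have p0K : (p%:~R : K) != 0 by rewrite intr_eq0.
apply: (mulfI p0K); rewrite (form_gr y gx p0) lieC phiN -(form_gr x gy) ?qE ?oppr_eq0 //.
by rewrite intrN mulNr opprK.
Qed.

Lemma formNl x y : form (- x) y = - form x y.
Proof. by have := form_linl (-1) x 0 y; rewrite scaleN1r addr0 form0l addr0 mulN1r. Qed.
Lemma formNr x y : form x (- y) = - form x y.
Proof. by rewrite formC formNl formC. Qed.
Lemma formDl x y z : form (x + y) z = form x z + form y z.
Proof. by have := form_linl 1 x y z; rewrite scale1r mul1r. Qed.
Lemma formDr x y z : form z (x + y) = form z x + form z y.
Proof. by rewrite formC formDl !(formC z). Qed.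
Lemma formZl a x y : form (a *: x) y = a * form x y.
Proof. by rewrite -[_ *: _]addr0 form_linl form0l addr0. Qed.
Lemma formZr a x y : form x (a *: y) = a * form x y.
Proof. by rewrite formC formZl formC. Qed.

Lemma gr0_root x y al : gr 0 x -> root_sp al y ->
  lie x y = (\sum_i coord i x * al 0 i) *: y.
Proof.
move=> /gr0_coord-> ry; rewrite ry; congr (_ *: _).
by apply: eq_bigr => i _; rewrite coord_hval.
Qed.

Definition form_inv (x y z : L) :=
  form (lie x y) z = form (lie y z) x /\ form (lie y z) x = form (lie z x) y.

Lemma form_inv_cycle x y z : form_inv x y z -> form_inv y z x.
Proof. by move=> [xyz yzx]; split=> //; rewrite -yzx. Qed.

Lemma form_inv_swap x y z : form_inv x y z -> form_inv y x z.
Proof.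
by move=> [xyz yzx]; rewrite /form_inv (lieC y x) (lieC x z) (lieC z y) !formNl
  xyz yzx.
Qed.

Lemma form_invE x y z : form_inv x y z -> form (lie x y) z = form x (lie y z).
Proof. by move=> [-> _]; rewrite formC. Qed.

Lemma form_inv0 y z : form_inv 0 y z.
Proof. by rewrite /form_inv lie0x liex0 !form0l form0r. Qed.

Lemma form_inv_lin a x x' y z :
  form_inv x y z -> form_inv x' y z -> form_inv (a *: x + x') y z.
Proof.
move=> [xy yx] [xy' yx']; rewrite /form_inv lie_linearl lie_linearr.
by rewrite !form_linl !form_linr xy yx xy' yx'.
Qed.

Lemma form_inv_span (S : set L) y z : (forall x, S x -> form_inv x y z) ->
  forall x, lspan S x -> form_inv x y z.
Proof.
by apply: lspan_sub => [|a x x']; [apply: form_inv0 | apply: form_inv_lin].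
Qed.

Lemma form_inv_degree p q r x y z :
  gr p x -> gr q y -> gr r z -> p + q + r != 0 -> form_inv x y z.
Proof.
move=> gx gy gz pqr; rewrite /form_inv.
rewrite (form0 (gr_lie gx gy) gz) //.
by rewrite (form0 (gr_lie gy gz) gx) ?(form0 (gr_lie gz gx) gy) //; lia.
Qed.

(** The roots of s and t serve when [s, t] is paired with the Cartan
    subalgebra. *)
Definition split_degree (p : int) : set L := [set x | exists p1 p2 al be s t,
  [/\ gr p1 s, gr p2 t, root_sp al s, root_sp be t & x = lie s t] /\
  [/\ p1 + p2 = p, (0 < `|p1|)%N, (0 < `|p2|)%N & (`|p1| + `|p2| = `|p|)%N]].

Lemma bracket_inv (x : 'I_3 -> L) m y : bracket x m y ->
  (m = 1%N /\ exists j, y = x j) \/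
  exists l j z, [/\ m = l.+1, (0 < l)%N, bracket x l z & y = lie (x j) z].
Proof.
case=> [j|j l z bz]; first by left; split=> //; exists j.
by right; exists l, j, z; split=> //; case: bz.
Qed.

Lemma bracket_split (x : 'I_3 -> L) k y : bracket x k.+2 y ->
  exists j z, bracket x k.+1 z /\ y = lie (x j) z.
Proof. by case/bracket_inv=> [[]//|[l [j [z [[->] _ bz ->]]]]]; exists j, z. Qed.

Lemma bracket_one (x : 'I_3 -> L) y : bracket x 1 y -> exists j, y = x j.
Proof. by case/bracket_inv=> [[]//|[l [j [z []]]]]; lia. Qed.

Lemma split_degree_span p x : (1 < `|p|)%N -> gr p x -> lspan (split_degree p) x.
Proof.
case: p => [[|[|k]]|[|k]] // k0 gx.
- apply: lspan_mono (gr_span_e gx) => _ /bracket_split[j [y [bl ->]]].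
  have [a [b [c [_ ry _]]]] := bracket_e_root bl.
  exists 1, k.+1%:Z, (simple_root K A3 j), (root3 a b c), (e j), y; split; split=> //.
  + exact: (gr_bracket_e (bracket1 e j)).
  + exact: gr_bracket_e.
  + exact: root_space_e.
- rewrite NegzE in gx.
  apply: lspan_mono (gr_span_f gx) => _ /bracket_split[j [y [bl ->]]].
  have [a [b [c [_ ry]]]] := bracket_f_root bl.
  exists (-1), (- k.+1%:Z), (- simple_root K A3 j), (root3 (- a%:Z) (- b%:Z) (- c%:Z)).
  exists (f j), y; split; split=> //.
  + exact: (gr_bracket_f (bracket1 f j)).
  + exact: gr_bracket_f.
  + exact: root_space_f.
Qed.

(** Invariance goes by induction on the largest absolute value N of the three
    degrees. If x = [s, t] has degree N + 1 in absolute value, the products of x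
    are computed in two ways: by their definition through phi, and by a
    recursion in smaller degrees. *)
Section Step.
Variable N : nat.
Hypothesis IH : forall p q r x y z, (`|p| <= N)%N -> (`|q| <= N)%N -> (`|r| <= N)%N ->
  gr p x -> gr q y -> gr r z -> form_inv x y z.

(** The right-hand side involves y and z only through [y, z]: this makes the
    recursion for ([s, t] | [y, z]) consistent. *)
Lemma form_chain p1 p2 q r s t y z : gr p1 s -> gr p2 t -> gr q y -> gr r z ->
  p1 + p2 + q + r = 0 -> (0 < `|p1|)%N -> (0 < `|p2|)%N -> (0 < `|q|)%N ->
  (0 < `|r|)%N -> `|(p1 + p2)%R|%N = N.+1 -> (`|p1| + `|p2| = N.+1)%N ->
  (`|q| + `|r| = N.+1)%N ->
  form (lie (lie s t) y) z = form s (lie t (lie y z)).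
Proof.
move=> gs gt gy gz pq p10 p20 q0 r0 pN p12 qr.
have -> : lie (lie s t) y = lie (lie s y) t + lie s (lie t y).
  by rewrite (lie_leibniz s t y) (lieC t (lie s y)) addrCA subrr addr0.
rewrite formDl.
rewrite (form_invE (IH _ _ _ (gr_lie gs gy) gt gz)); try lia.
rewrite (form_invE (IH _ _ _ gs gy (gr_lie gt gz))); try lia.
rewrite (form_invE (IH _ _ _ gs (gr_lie gt gy) gz)); try lia.
by rewrite -formDr (lie_leibniz t y z) addrC.
Qed.

(** Put w = [y, z] and X = ([x, y] | z). By form_chain X = (s | [t, w]), and
    exchanging s and t, X = - (t | [s, w]). So phi [x, w] is
    deg s . X + deg t . X, and it is deg x . (x | w) by definition. *)
Lemma form_inv_opposite p q r x y z : gr p x -> gr q y -> gr r z -> p + q + r = 0 ->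
  `|p|%N = N.+1 -> (0 < `|q| <= N)%N -> (0 < `|r| <= N)%N -> form_inv x y z.
Proof.
move=> gx gy gz pqr pN qN rN.
suff H q' r' y' z' : gr q' y' -> gr r' z' -> p + q' + r' = 0 ->
    (0 < `|q'| <= N)%N -> (0 < `|r'| <= N)%N ->
    form (lie x y') z' = form x (lie y' z').
  split; first by rewrite (H _ _ _ _ gy gz) // formC.
  rewrite formC (lieC y z) formNr -(H _ _ _ _ gz gy) //; last by rewrite addrAC.
  by rewrite -formNl -lieC.
move=> gy' gz' pqr' qN' rN'.
have p0 : p != 0 by lia.
have p1 : (1 < `|p|)%N by lia.
elim: {gx}(split_degree_span p1 gx) => [|a {}x x' sx _ IHx].
  by rewrite lie0x !form0l.
rewrite lie_linearl !form_linl IHx; congr (_ * _ + _).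
case: sx => p1' [p2' [al [be [s [t [[gs gt _ _ ->]]]]]]] [p12 p10 p20 pp].
have ch := form_chain gs gt gy' gz'; have ch' := form_chain gt gs gy' gz'.
have p0K : (p%:~R : K) != 0 by rewrite intr_eq0.
apply: (mulfI p0K).
have gst : gr p (lie s t) by rewrite -p12; apply: gr_lie.
rewrite (form_gr _ gst p0).
have -> : lie (lie s t) (lie y' z')
    = lie s (lie t (lie y' z')) - lie t (lie s (lie y' z')).
  by rewrite (lie_leibniz s t (lie y' z')) addrK.
rewrite -[_ - _]addrC -scaleN1r phi_lin mulN1r.
rewrite -(form_gr _ gs) -?(form_gr _ gt) -?ch -?ch' //; try lia.
by rewrite (lieC t s) lieNl formNl -p12 intrD; ring.
Qed.

(** Here z is in the Cartan subalgebra and acts by weights. Splitting x = [s, t]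
    reduces ([x, y] | z) to (s | [t, y]) and (t | [s, y]), both equal to
    (x | y) up to sign by the case of nonzero degrees. *)
Lemma form_inv_opposite0 p x y z : gr p x -> gr (- p) y -> gr 0 z ->
  `|p|%N = N.+1 -> (0 < N)%N -> form_inv x y z.
Proof.
move=> gx gy gz pN N0; have p0 : p != 0 by lia.
have p1 : (1 < `|p|)%N by lia.
apply: (form_inv_span _ (split_degree_span p1 gx)) => _
  [p1' [p2' [al [be [s [t [[gs gt rs rt ->]]]]]]]] [p12 p10 p20 pp].
suff H y' : gr (- p) y' -> tri y' -> form_inv y' z (lie s t).
  apply/form_inv_cycle/form_inv_cycle.
  by apply: (form_inv_span _ (gr_span gy)) => y' [ty gy']; apply: H.
move=> gy' /triangular_root[a [b [c ry]]].
apply/form_inv_cycle/form_inv_cycle; set ga := root3 a b c in ry.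
set u := lie s t; pose ev (ga : 'rV[K]_3) : K := \sum_i coord i z * ga 0 i.
have gu : gr p u by rewrite -p12; apply: gr_lie.
have ru : root_sp (al + be) u by apply: root_space_lie.
have evE ga' x' : root_sp ga' x' -> lie z x' = ev ga' *: x' := gr0_root gz.
have opp : form_inv y' s t by apply: (form_inv_opposite gy' gs gt); lia.
have uE : form u y' = form s (lie t y') by rewrite [RHS]formC /u; case: opp => _ ->.
have uE' : form u y' = - form t (lie s y').
  by rewrite /u; case: opp => <- _; rewrite (lieC s y') formNr opprK formC.
have evD : ev (al + be) = ev al + ev be.
  by rewrite /ev -big_split; apply: eq_bigr => i _; rewrite mxE mulrDr.
have XE : form (lie u y') z = ev (al + be) * form u y'.
  have -> : lie u y' = lie s (lie t y') - lie t (lie s y').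
    by rewrite (lie_leibniz s t y') addrK.
  rewrite formDl formNl.
  have [-> ->] : form (lie s (lie t y')) z = form (lie z s) (lie t y') /\
     form (lie t (lie s y')) z = form (lie z t) (lie s y').
    split; first by have [-> ->] := IH (p := p1') (q := p2' - p) (r := 0)
      ltac:(lia) ltac:(lia) ltac:(lia) gs (gr_lie gt gy') gz.
    by have [-> ->] := IH (p := p2') (q := p1' - p) (r := 0)
      ltac:(lia) ltac:(lia) ltac:(lia) gt (gr_lie gs gy') gz.
  by rewrite (evE _ _ rs) (evE _ _ rt) !formZl -uE evD mulrDl -mulrN -uE'.
have ZE : form (lie z u) y' = ev (al + be) * form u y' by rewrite (evE _ _ ru) formZl.
have YE : form (lie y' z) u = - (ev ga * form u y').
  by rewrite lieC (evE _ _ ry) formNl formZl formC.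
rewrite /form_inv XE ZE YE; suff -> : ev ga * form u y' = - (ev (al + be) * form u y').
  by rewrite opprK.
have [u0|] := eqVneq (lie u y') 0.
  have := form_gr y' gu p0; rewrite u0 phi0 => /eqP.
  by rewrite mulf_eq0 intr_eq0 (negPf p0) /= => /eqP->; rewrite !mulr0 oppr0.
move=> uy0; have r0 : root_sp 0 (lie u y').
  have := gr_lie gu gy'; rewrite subrr => /gr0_span.
  apply: lspan_sub => [|? ? ?|_ [i _ <-]]; [exact: root_space_0 | | exact: root_space_h].
  exact: root_space_lin.
have /esym/eqP := root_uniq r0 (root_space_lie ru ry) uy0.
rewrite addr_eq0 => /eqP ab; rewrite -mulNr; congr (_ * _); rewrite ab.
by rewrite /ev -sumrN; apply: eq_bigr => i _; rewrite [(- ga) 0 i]mxE mulrN opprK.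
Qed.

End Step.

Lemma form_inv_base x y z : gr 1 x -> gr (-1) y -> gr 0 z -> form_inv x y z.
Proof.
move=> gx gy gz; apply: (form_inv_span _ (gr_span_e gx)) => _ /bracket_one[i ->].
apply/form_inv_cycle/form_inv_cycle.
apply: (form_inv_span _ (gr_span_f (k := 0) gy)) => _ /bracket_one[j ->].
have ef : form (e i) (f j) = (i == j)%:R.
  have := form_gr (f j) (gr_bracket_e (bracket1 e i)) isT.
  rewrite mul1r => ->; rewrite km_ef; case: eqP => _; last exact: phi0.
  by move: i; apply: ord3_ind; rewrite /phi !coord_h /= ?addr0 ?add0r.
have zE (u : L) al : root_sp al u -> lie z u = (\sum_k coord k z * al 0 k) *: u.
  exact: gr0_root gz.
have hz : form (h i) z = \sum_k coord k z * simple_root K A3 i 0 k.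
  rewrite (form_gr0 z (gr_h i)) hformC /hform; apply: eq_bigr => k _.
  rewrite (bigD1 i) //= coord_h eqxx mulr1 big1 ?addr0; last first.
    by move=> l li; rewrite coord_h (negPf li) mulr0.
  by rewrite [simple_root _ _ _ _ _]mxE.
rewrite /form_inv (lieC (f j)) (zE _ _ (@root_space_f K 3 A3 j)) (zE _ _ (@root_space_e K 3 A3 i)).
rewrite km_ef formNl !formZl (formC (f j)) ef.
case: eqP => [<-|_]; last by rewrite form0l !mulr0 oppr0.
rewrite hz !mulr1; split=> //; rewrite -sumrN; apply: eq_bigr => k _.
by rewrite [(- simple_root K A3 i) 0 k]mxE mulrN opprK.
Qed.

Lemma form_inv_le N p q r x y z : (`|p| <= N)%N -> (`|q| <= N)%N -> (`|r| <= N)%N ->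
  gr p x -> gr q y -> gr r z -> form_inv x y z.
Proof.
elim: N p q r x y z => [|N IH] p q r x y z.
  rewrite !leqn0 !absz_eq0 => /eqP-> /eqP-> /eqP-> gx gy gz.
  have com u v : gr 0 u -> gr 0 v -> lie u v = 0.
    move=> gu /gr0_coord->; rewrite (linear_sum_prop (lie_linearr u)) big1 // => i _.
    by rewrite lieZr (gr0_root gu (@root_space_h K 3 A3 i)) big1 ?scale0r ?scaler0 // => k _;
      rewrite mxE mulr0.
  by rewrite /form_inv !com // !form0l.
move=> pN qN rN gx gy gz; have [pqr|] := eqVneq (p + q + r) 0; last first.
  exact: form_inv_degree gx gy gz.
have top p' q' r' x' y' z' : `|p'|%N = N.+1 -> (`|q'| <= N.+1)%N ->
    (`|r'| <= N.+1)%N -> p' + q' + r' = 0 ->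
    gr p' x' -> gr q' y' -> gr r' z' -> form_inv x' y' z'.
  move=> pN' qN' rN' pqr' gx' gy' gz'.
  have zero q1 r1 y1 z1 : gr q1 y1 -> gr r1 z1 -> p' + q1 + r1 = 0 -> r1 = 0 ->
      form_inv x' y1 z1.
    move=> gy1 gz1 pqr1 r10; have q1E : q1 = - p' by lia.
    rewrite r10 in gz1; rewrite q1E in gy1.
    have [N0|N0] := posnP N; last exact: (form_inv_opposite0 IH gx' gy1 gz1).
    have [pE|pE] : p' = 1 \/ p' = -1 by lia.
      by rewrite pE in gx' gy1; apply: form_inv_base.
    rewrite pE opprK in gx' gy1; apply: form_inv_swap.
    exact: form_inv_base.
  have [r0|r0] := eqVneq r' 0; first exact: zero gy' gz' pqr' r0.
  have [q0|q0] := eqVneq q' 0.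
    apply/form_inv_cycle/form_inv_cycle/form_inv_swap/form_inv_cycle.
    by apply: (zero _ _ _ _ gz' gy' _ q0); lia.
  by apply: (form_inv_opposite IH gx' gy' gz'); lia.
have [pN'|pN'] := eqVneq `|p|%N N.+1; first exact: top gx gy gz.
have [qN'|qN'] := eqVneq `|q|%N N.+1.
  by apply/form_inv_cycle/form_inv_cycle/(top q r p) => //; lia.
have [rN'|rN'] := eqVneq `|r|%N N.+1.
  by apply/form_inv_cycle/(top r p q) => //; lia.
by apply: IH gx gy gz; lia.
Qed.

Lemma form_invariant x y z : form (lie x y) z = form x (lie y z).
Proof.
apply: form_invE; move: x; apply: gr_ind => [|a x x'|p x gx].
- exact: form_inv0.
- exact: form_inv_lin.
apply/form_inv_cycle/form_inv_cycle; move: y; apply: gr_ind => [|a y y'|q y gy].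
- exact: form_inv0.
- exact: form_inv_lin.
apply/form_inv_cycle/form_inv_cycle; move: z; apply: gr_ind => [|a z z'|r z gz].
- exact: form_inv0.
- exact: form_inv_lin.
apply/form_inv_cycle/form_inv_cycle.
apply: (@form_inv_le (`|p| + `|q| + `|r|) _ _ _ _ _ _ _ _ _ gx gy gz); lia.
Qed.

(** * The contravariant Hermitian form *)

Definition herm (x y : L) : K := form x (tr y).

Lemma form_h x j : gr 0 x -> form x (h j) = \sum_i coord i x * (A3 i j)%:~R.
Proof.
move=> gx; rewrite form_gr0 // /hform; apply: eq_bigr => i _.
rewrite (bigD1 j) //= coord_h eqxx mulr1 big1 ?addr0 // => k kj.
by rewrite coord_h (negPf kj) mulr0.
Qed.

(** The matrix A is invertible. *)
Lemma gr0_nondeg x y : gr 0 x -> gr 0 y ->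
  (forall j, form x (h j) = form y (h j)) -> x = y.
Proof.
move=> gx gy xy; rewrite (gr0_coord gx) (gr0_coord gy); apply: eq_bigr => i _.
congr (_ *: _); apply/eqP; rewrite -subr_eq0; apply/eqP.
apply: (cartan_matrix_inj (c := fun i => coord i x - coord i y)) => j.
by under eq_bigr do rewrite mulrBl; rewrite sumrB -!form_h // xy subrr.
Qed.

(** The entries of al times the inverse of A: the coordinates of al in the basis
    of simple roots. *)
Definition root_coord (al : 'rV[K]_3) (i : 'I_3) : K :=
  nth 0 [:: - (3 / 2 * al 0 i1 + 2 * al 0 i2 + al 0 i3);
            - (2 * al 0 i1 + 2 * al 0 i2 + al 0 i3); - (al 0 i1 + al 0 i2)] i.

Definition coroot al : L := \sum_i root_coord al i *: h i.

Definition root_form (al be : 'rV[K]_3) : K := \sum_i root_coord al i * be 0 i.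

Lemma root_formC al be : root_form al be = root_form be al.
Proof. by rewrite /root_form !sum3 /root_coord /=; field. Qed.

Lemma root_formDr al be ga : root_form al (be + ga) = root_form al be + root_form al ga.
Proof. by rewrite /root_form -big_split; apply: eq_bigr => i _; rewrite mxE mulrDr. Qed.

Lemma root_formDl al be ga : root_form (al + be) ga = root_form al ga + root_form be ga.
Proof. by rewrite root_formC root_formDr !(root_formC ga). Qed.

Lemma root_form_simple j be : root_form (simple_root K A3 j) be = be 0 j.
Proof.
by move: j; apply: ord3_ind; rewrite /root_form sum3 /root_coord /= !mxE /=; field.
Qed.

Lemma root_form3 a b c :
  root_form (root3 a b c) (root3 a b c) = (root_norm a b c)%:~R.
Proof.
have [E1 E2 E3] := root3E K a b c.
rewrite /root_form sum3 /root_coord /= E1 E2 E3 /root_norm.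
by rewrite !(intrD, intrN, intrM); field.
Qed.

Lemma coroot_gr al : gr 0 (coroot al).
Proof.
rewrite /coroot; elim/big_ind: _ => [|x y gx gy|i _]; first exact: gr0.
  by rewrite -[x]scale1r; apply: gr_lin.
by rewrite -[_ *: _]addr0; apply: gr_lin (gr_h _) (gr0 _).
Qed.

Lemma coroot_root al be x : root_sp be x -> lie (coroot al) x = root_form al be *: x.
Proof. by move=> rx; rewrite rx. Qed.

Lemma form_coroot al j : form (coroot al) (h j) = al 0 j.
Proof.
rewrite form_h; last exact: coroot_gr.
rewrite sum3 !coord_hval /root_coord /=.
by move: j; apply: ord3_ind; rewrite !mxE /=; field.
Qed.

(** Both sides lie in the Cartan subalgebra, and by invariance they have the
    same products with the h_j. *)
Lemma lie_form p al x y : gr p x -> root_sp al x -> gr (- p) y ->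
  lie x y = form x y *: coroot al.
Proof.
move=> gx rx gy; apply: gr0_nondeg => [||j].
- by rewrite -(subrr p); apply: gr_lie.
- by rewrite -[_ *: _]addr0; apply: gr_lin (coroot_gr _) (gr0 _).
rewrite formZl form_coroot form_invariant (lieC y) formNr -form_invariant.
have /root_weight /(_ j) := rx; rewrite /cartan_op lieC => /eqP; rewrite eqr_oppLR.
by move=> /eqP ->; rewrite formNl opprK formZl mulrC.
Qed.

Lemma coord_transpose i x : coord i (tr x) = (coord i x)^*.
Proof.
move: x i; apply: gr_ind => [i|a x y IHx IHy i|p x gx i].
- by rewrite transpose0 (coord_gr _ (gr0 1)) ?conjC0.
- by rewrite transpose_antilinear !coord_lin IHx IHy rmorphD /= rmorphM.
have [p0|p0] := eqVneq p 0; last first.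
  by rewrite (coord_gr _ gx p0) conjC0 (coord_gr _ (transpose_gr gx)) ?oppr_eq0.
rewrite p0 in gx; rewrite [in LHS](gr0_coord gx) transpose_sum.
under eq_bigr do rewrite transposeZ transpose_h.
by rewrite coord_hval.
Qed.

Lemma phi_transpose x : phi (tr x) = (phi x)^*.
Proof. by rewrite /phi !coord_transpose !rmorphD. Qed.

Lemma form_transpose x y : form (tr x) (tr y) = (form x y)^*.
Proof.
move: x; apply: gr_ind => [|a x x' IH IH'|p x gx].
- by rewrite transpose0 !form0l conjC0.
- by rewrite transpose_antilinear !form_linl IH IH' [RHS]rmorphD /= rmorphM.
have [p0|p0] := eqVneq p 0.
  rewrite p0 in gx; have gtx := transpose_gr gx; rewrite oppr0 in gtx.
  rewrite !form_gr0 // /hform rmorph_sum; apply: eq_bigr => i _.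
  rewrite rmorph_sum; apply: eq_bigr => j _.
  by rewrite !coord_transpose !rmorphM /= rmorph_int.
have p0K : (p%:~R : K) != 0 by rewrite intr_eq0.
apply: (mulfI p0K); have := congr1 Num.conj (form_gr y gx p0).
rewrite rmorphM /= rmorph_int => ->.
have := form_gr (tr y) (transpose_gr gx); rewrite oppr_eq0 intrN => /(_ p0).
move=> /eqP; rewrite mulNr eqr_oppLR => /eqP->.
by rewrite -phi_transpose transpose_lie lieC phiN opprK.
Qed.

Lemma herm_linl a x y z : herm (a *: x + y) z = a * herm x z + herm y z.
Proof. exact: form_linl. Qed.

Lemma herm_conjC x y : herm y x = (herm x y)^*.
Proof. by rewrite /herm -form_transpose transposeK formC. Qed.

Lemma herm_adjoint u x y : herm (lie u x) y = herm x (lie (tr u) y).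
Proof.
by rewrite /herm transpose_lie transposeK lieC formNl form_invariant (lieC u)
  formNr opprK.
Qed.

Lemma root_real al x : root_sp al x -> x != 0 -> forall i, (al 0 i)^* = al 0 i.
Proof.
move=> rx x0; have [->|al0] := eqVneq al 0 => [i|]; first by rewrite mxE conjC0.
have [a [b [c [_ aE _]]]] := root_coords rx x0 al0.
by apply: ord3_ind; case: aE => ->;
  have [E1 E2 E3] := root3E K a b c;
  have [F1 F2 F3] := root3E K (- a%:Z) (- b%:Z) (- c%:Z);
  rewrite ?E1 ?E2 ?E3 ?F1 ?F2 ?F3 rmorph_int.
Qed.

(** The h_i are self-adjoint, and roots take real values on them. *)
Lemma herm_root_orth al be x y : root_sp al x -> root_sp be y -> al != be ->
  herm x y = 0.
Proof.
move=> rx ry; have [->|y0] := eqVneq y 0; first by rewrite /herm transpose0 form0r.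
apply: contra_neq_eq => xy0; apply/rowP => i.
have := herm_adjoint (h i) x y; rewrite transpose_h.
have -> : lie (h i) x = al 0 i *: x by have /root_weight := rx; apply.
have -> : lie (h i) y = be 0 i *: y by have /root_weight := ry; apply.
rewrite (hermZl herm_linl) (hermZr herm_linl herm_conjC) (root_real ry y0).
by move/(mulIf xy0).
Qed.

(** * Positivity *)

Notation hZl := (hermZl herm_linl).
Notation h0l := (herm0l herm_linl).

Section Casimir.
Variables (N : nat) (b : nat -> seq L).
Hypothesis b_gr : forall k u, (0 < k < N)%N -> u \in b k -> gr k u.
Hypothesis b_proj : forall k x, (0 < k < N)%N -> gr k x -> x = oproj herm (b k) x.

(** The pairs (u / herm u u, tr u) are dual bases for the form. *)
Lemma dual_basis k w : (0 < k < N)%N -> gr (- k%:Z) w ->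
  w = \sum_(u <- b k) (form u w / herm u u) *: tr u.
Proof.
move=> kN gw; have gtw := transpose_gr gw; rewrite opprK in gtw.
rewrite -[LHS]transposeK (b_proj kN gtw) /oproj transpose_sum.
apply: eq_bigr => u _; rewrite transposeZ rmorphM fmorphV /= -!herm_conjC.
by rewrite [herm u (tr w)]/herm transposeK.
Qed.

(** By invariance, ad z from degree k to degree k + 1 and its dual from degree
    - k - 1 to degree - k have the same matrix. *)
Lemma casimir_shift (g : L -> L -> L) k z :
  (forall v, linear (g^~ v)) -> (forall u, linear (g u)) ->
  (0 < k)%N -> (k.+1 < N)%N -> gr 1 z ->
  \sum_(u <- b k) (herm u u)^-1 *: g (lie z u) (tr u) =
  \sum_(w <- b k.+1) (herm w w)^-1 *: g w (lie (tr w) z).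
Proof.
move=> gl gr_ k0 kN gz; have kN' : (0 < k < N)%N by lia.
have lhs u : u \in b k -> (herm u u)^-1 *: g (lie z u) (tr u) =
    \sum_(w <- b k.+1) ((herm u u)^-1 * (herm (lie z u) w / herm w w)) *: g w (tr u).
  move=> ub; have gzu := gr_lie gz (b_gr kN' ub).
  rewrite {1}(@b_proj k.+1 (lie z u)) // /oproj (linear_sum_prop (gl _)) scaler_sumr.
  by apply: eq_bigr => w _; rewrite (linearZ_prop (gl _)) scalerA.
have rhs w : w \in b k.+1 -> (herm w w)^-1 *: g w (lie (tr w) z) =
    \sum_(u <- b k) ((herm u u)^-1 * (herm (lie z u) w / herm w w)) *: g w (tr u).
  move=> wb; have gtw := gr_lie (transpose_gr (b_gr (k := k.+1) kN wb)) gz.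
  have {}gtw : gr (- k%:Z) (lie (tr w) z).
    by move: gtw; congr (gr _ _); lia.
  rewrite (dual_basis kN' gtw) (linear_sum_prop (gr_ _)) scaler_sumr.
  apply: eq_bigr => u _; rewrite (linearZ_prop (gr_ _)) scalerA; congr (_ *: _).
  have -> : form u (lie (tr w) z) = herm (lie z u) w.
    by rewrite -form_invariant formC -form_invariant.
  by ring.
rewrite (eq_big_seq _ lhs) (eq_big_seq _ rhs) exchange_big /=.
by [].
Qed.

(** Up to a factor 2, the part of the Casimir element that pairs the degrees k
    and - k for 0 < k < M. *)
Definition casimir M (x : L) : L :=
  \sum_(1 <= k < M) \sum_(u <- b k) (herm u u)^-1 *: lie u (lie (tr u) x).

Lemma casimir_linear M : linear (casimir M).
Proof.
move=> a x y; rewrite /casimir scaler_sumr -big_split; apply: eq_bigr => k _ /=.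
rewrite scaler_sumr -big_split; apply: eq_bigr => u _ /=.
by rewrite !lie_linearr scalerDr !scalerA mulrC.
Qed.

(** The full Casimir element commutes with e j. For its truncation, the sums S1
    and S2 of commutators cancel degree by degree by casimir_shift, except for
    S1 in degree 1 and S2 in degree M. These and the degree M term of S3 bring
    in the Cartan subalgebra, where lie_form evaluates them. *)
Lemma casimir_step M j ga y : (0 < M)%N -> (M < N)%N -> gr M y -> root_sp ga y ->
  casimir M.+1 (lie (e j) y) = lie (e j) (casimir M y)
    - (2 * root_form ga (simple_root K A3 j)) *: lie (e j) y.
Proof.
move=> M0 MN gy ry; set al := simple_root K A3 j; set x := lie (e j) y.
have ge : gr 1 (e j) := gr_bracket_e (bracket1 e j).
have re : root_sp al (e j) := @root_space_e K 3 A3 j.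
have MN' : (0 < M < N)%N by lia.
pose S1 k := \sum_(u <- b k) (herm u u)^-1 *: lie u (lie (lie (tr u) (e j)) y).
pose S2 k := \sum_(u <- b k) (herm u u)^-1 *: lie (lie u (e j)) (lie (tr u) y).
pose S3 k := \sum_(u <- b k) (herm u u)^-1 *: lie u (lie (tr u) y).
have split_x : casimir M.+1 x = \sum_(1 <= k < M.+1) S1 k
    + \sum_(1 <= k < M.+1) S2 k + lie (e j) (\sum_(1 <= k < M.+1) S3 k).
  rewrite (linear_sum_prop (lie_linearr _)) -!big_split; apply: eq_bigr => k _ /=.
  rewrite (linear_sum_prop (lie_linearr _)) -!big_split; apply: eq_bigr => u _ /=.
  rewrite lieZr -!scalerDr -addrA; congr (_ *: _).
  by rewrite /x (lie_leibniz (tr u)) lieDr (lie_leibniz u (e j)).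
have S12 k : (0 < k)%N -> (k.+1 < N)%N -> S1 k.+1 = - S2 k.
  move=> k0 kN; rewrite /S1 /S2 -sumrN.
  rewrite -(casimir_shift (g := fun u v => lie u (lie v y)) _ _ k0 kN ge).
  - by apply: eq_bigr => u _; rewrite (lieC (e j)) lieNl scalerN.
  - by move=> v a u u'; rewrite lie_linearl.
  - by move=> u a v v'; rewrite lie_linearl lie_linearr.
have S12s : \sum_(1 <= k < M.+1) S1 k + \sum_(1 <= k < M.+1) S2 k = S1 1 + S2 M.
  rewrite big_nat_recl // [X in _ + X = _]big_nat_recr //= -addrA; congr (_ + _).
  rewrite addrA -big_split /= big_nat big1 ?add0r // => k /andP[k1 kM].
  by rewrite S12 ?addNr //; lia.
have S1E : S1 1 = - (ga 0 j) *: x.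
  have oneN : (0 < 1 < N)%N by lia.
  rewrite /S1 /x [in RHS](b_proj oneN ge) /oproj lie_suml scaler_sumr.
  rewrite big_seq [in RHS]big_seq; apply: eq_bigr => u ub.
  have gtu : gr (- 1%:Z) (tr u) by apply/transpose_gr/(b_gr oneN ub).
  rewrite (lieC (tr u)) (lie_form ge re gtu) -/(herm (e j) u).
  rewrite -scaleNr lieZl (coroot_root _ ry) root_form_simple !lieZr lieZl !scalerA.
  by congr (_ *: _); ring.
have tuy u : u \in b M -> lie (tr u) y = - herm y u *: coroot ga.
  move=> ub; rewrite lieC (lie_form gy ry) ?scaleNr //.
  exact/transpose_gr/(b_gr MN' ub).
have S2E : S2 M = - root_form ga (ga + al) *: x.
  transitivity (lie (lie y (e j)) (- coroot ga)).
    rewrite [in RHS](b_proj MN' gy) /oproj !lie_suml /S2.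
    rewrite big_seq [in RHS]big_seq; apply: eq_bigr => u ub.
    by rewrite tuy // !lieZl lieZr lieNr scalerA scalerN -scaleNr; congr (_ *: _); ring.
  rewrite lieNr -lieC (lieC y) lieNr (coroot_root _ (root_space_lie re ry)).
  by rewrite -scaleNr (addrC ga).
have S3E : S3 M = root_form ga ga *: y.
  rewrite -(coroot_root ga ry) lieC [in RHS](b_proj MN' gy) /oproj lie_suml /S3.
  rewrite -sumrN big_seq [in RHS]big_seq; apply: eq_bigr => u ub.
  by rewrite tuy // lieZl lieZr scalerA -scaleNr; congr (_ *: _); ring.
rewrite split_x S12s S1E S2E big_nat_recr //= lieDr S3E lieZr -/x addrCA.
congr (_ + _); rewrite -!scalerDl -scaleNr root_formDr; congr (_ *: _).
by rewrite [in RHS]root_formC root_form_simple (root_formC ga) root_form_simple; ring.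
Qed.

(** The increments of casimir_step add up to 2 ht al - (al | al). *)
Lemma casimir_bracket M y : bracket e M y -> (M <= N)%N ->
  exists2 ga, root_sp ga y & casimir M y = (2 * M%:R - root_form ga ga) *: y.
Proof.
elim=> [j _|j {}M {}y bM IH MN].
  exists (simple_root K A3 j); first exact: root_space_e.
  rewrite /casimir big_geq // root_form_simple mxE.
  have -> : (A3 j j)%:~R = 2 :> K by move: j; apply: ord3_ind; rewrite mxE.
  by rewrite mulr1 subrr scale0r.
have [ga ry cy] := IH (ltnW MN); have M0 : (0 < M)%N by case: bM.
have re := @root_space_e K 3 A3 j.
exists (simple_root K A3 j + ga); first exact: root_space_lie.
rewrite (casimir_step j M0 MN (gr_bracket_e bM) ry) cy lieZr -scalerBl.
congr (_ *: _); rewrite !(root_formDl, root_formDr) (root_formC ga).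
rewrite [root_form (simple_root K A3 j) (simple_root K A3 j)]root_form_simple mxE.
have -> : (A3 j j)%:~R = 2 :> K by move: j {re}; apply: ord3_ind; rewrite mxE.
by rewrite mulrS; ring.
Qed.

Lemma casimir_root al x : (0 < N)%N -> gr N x -> root_sp al x ->
  casimir N x = (2 * N%:R - root_form al al) *: x.
Proof.
move=> N0 gx rx; have bx : lspan (bracket e N) x.
  by have := @gr_span_e N.-1 x; rewrite prednK //; apply.
have := root_span _ rx bx; move=> /(_ _)/(lspan_sub (P := fun x =>
  casimir N x = (2 * N%:R - root_form al al) *: x)); apply.
- by rewrite (linear0_prop (casimir_linear N)) scaler0.
- by move=> a u v uE vE; rewrite casimir_linear uE vE scalerDr !scalerA mulrC.
- move=> y [by_ ry]; have [ga rga cy] := casimir_bracket by_ (leqnn N).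
  have [->|y0] := eqVneq y 0; first by rewrite (linear0_prop (casimir_linear N)) scaler0.
  by rewrite cy (root_uniq rga ry y0).
- by move=> y /bracket_e_root[a [b' [c [_ r _]]]]; exists (root3 a b' c).
Qed.

End Casimir.

Lemma form_ef i j : form (e i) (f j) = (i == j)%:R.
Proof.
have := form_gr (f j) (gr_bracket_e (bracket1 e i)) isT.
rewrite mul1r => ->; rewrite km_ef; case: eqP => _; last exact: phi0.
by move: i; apply: ord3_ind; rewrite /phi !coord_h /= ?addr0 ?add0r.
Qed.

Lemma root_e_span (n : nat) x al : (0 < n)%N -> gr n x -> root_sp al x -> x != 0 ->
  exists a b c : nat, al = root3 a b c /\ n = (a + b + c)%N.
Proof.
case: n => // n _ gx rx x0; apply: contrapT => nex; move/eqP: x0; apply.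
have : lspan [set y | bracket e n.+1 y /\ root_sp al y] x.
  apply: root_span rx (gr_span_e gx) => y /bracket_e_root[a [b [c [_ r _]]]].
  by exists (root3 a b c).
apply: (lspan_sub (P := fun y => y = 0)) => // [a u v -> ->|y [by_ ry]].
  by rewrite scaler0 addr0.
apply: contrapT => /eqP y0; apply: nex.
have [a [b [c [nE r _]]]] := bracket_e_root by_.
by exists a, b, c; split=> //; apply: root_uniq ry r y0.
Qed.

Lemma root_proj_gr (n : nat) al x : gr n.+1 x -> gr n.+1 (root_proj al x).
Proof.
move=> /gr_span_e; elim=> [|a {}x y bx _ IH].
  by rewrite (linear0_prop (root_proj_linear al)); apply: gr0.
rewrite root_proj_linear; apply: gr_lin IH.
have [a' [b [c [_ r _]]]] := bracket_e_root bx.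
by rewrite (root_projE _ r); case: ifP => _; [apply: gr_bracket_e | apply: gr0].
Qed.

Lemma herm_sum_orth (r : seq 'rV[K]_3) (w : 'rV[K]_3 -> L) : uniq r ->
  (forall al, root_sp al (w al)) ->
  herm (\sum_(al <- r) w al) (\sum_(al <- r) w al) = \sum_(al <- r) herm (w al) (w al).
Proof.
move=> ur rw; rewrite (herm_suml herm_linl); apply: eq_big_seq => al alr.
rewrite herm_conjC (herm_suml herm_linl) rmorph_sum (bigD1_seq al) //= -herm_conjC big1 ?addr0 //.
by move=> be bal; rewrite (herm_root_orth (rw be) (rw al)) // conjC0.
Qed.

(** The brackets of e_i in a given degree are finitely many. *)
Lemma degree_basis (k : nat) : (forall v, gr k.+1 v -> v != 0 -> 0 < herm v v) ->
  exists b : seq L, [/\ orth_seq herm b, forall u, u \in b -> gr k.+1 u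
    & forall v, gr k.+1 v -> v = oproj herm b v].
Proof.
move=> pos.
have [r [rg gr_r]] : exists r : seq L, (forall u, u \in r -> gr k.+1 u) /\
    forall v, gr k.+1 v -> lspan [set u | u \in r] v.
  elim: k {pos} => [|k [r [rg gr_r]]].
    exists [seq e i | i <- enum 'I_3]; split=> [u /mapP[i _ ->]|v gv].
      exact: (gr_bracket_e (bracket1 e i)).
    apply: lspan_mono (gr_span_e gv) => _ /bracket_one[j ->] /=.
    by apply/mapP; exists j; rewrite ?mem_enum.
  exists [seq lie (e i) u | i <- enum 'I_3, u <- r]; split=> [u|v gv].
    move=> /allpairsP[[i w] /= [_ wr ->]].
    exact: (gr_lie (gr_bracket_e (bracket1 e i)) (rg w wr)).
  apply: (lspan_sub (P := lspan _)) (gr_span_e gv) => [|*|_ /bracket_split[j [z [bz ->]]]].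
  - exact: lspan0.
  - exact: lspan_lin.
  apply: (lspan_map (lie_linearr (e j)) _ (gr_r z (gr_bracket_e bz))) => u ur.
  by apply/lspan_in/allpairsP; exists (j, u); rewrite mem_enum.
have grs v : lspan [set u | u \in r] v -> gr k.+1 v.
  by apply: (lspan_sub (P := gr k.+1)) rg v; [apply: gr0 | move=> *; apply: gr_lin].
have nz v : lspan [set u | u \in r] v -> v != 0 -> herm v v != 0.
  by move=> rv v0; rewrite gt_eqF // pos //; apply: grs.
have [b [ob br bE]] := gram_schmidt herm_linl herm_conjC nz.
by exists b; split=> // [u /br/grs//|v /gr_r/bE//].
Qed.

(** Induction on the degree: by contravariance the eigenvalue of the Casimir
    operator times herm y y is a sum of norms in smaller degrees. *)
Lemma herm_pos_degree (n : nat) x : gr n.+1 x -> x != 0 -> 0 < herm x x.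
Proof.
have [m] := ubnP n; elim: m n x => // m IH n x nm.
suff root_pos al y : gr n.+1 y -> root_sp al y -> y != 0 -> 0 < herm y y.
  move=> gx x0; have [r [ur xE]] := root_proj_sum x.
  have w_ge0 al : 0 <= herm (root_proj al x) (root_proj al x).
    have [->|p0] := eqVneq (root_proj al x) 0; first by rewrite h0l.
    exact/ltW/(root_pos al)/p0/root_proj_root/root_proj_gr.
  rewrite {1 2}xE (herm_sum_orth ur (fun al => @root_proj_root K al x)) lt_neqAle sumr_ge0 // andbT.
  apply: contraNneq x0 => /esym/eqP; rewrite psumr_eq0 // => /allP s0.
  rewrite xE big_seq big1 // => al /s0 /= /eqP h0.
  have [//|p0] := eqVneq (root_proj al x) 0.
  by have := root_pos al _ (root_proj_gr al gx) (@root_proj_root K al x) p0; rewrite h0 ltxx.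
move=> gy ry y0; have [a [b [c [aE nE]]]] := root_e_span (ltn0Sn n) gy ry y0.
have [n0|n0] := posnP n.
  (* In degree 1 the e i are an orthonormal basis. *)
  have [c1 yE] : exists cs : 'I_3 -> K, y = \sum_i cs i *: e i.
    rewrite n0 in gy; elim: (gr_span_e gy) => [|k _ v /bracket_one[j ->] _ [cs ->]].
      by exists (fun=> 0); rewrite big1 // => i _; rewrite scale0r.
    exists (fun i => k * (i == j)%:R + cs i).
    under [RHS]eq_bigr do rewrite scalerDl; rewrite big_split /=; congr (_ + _).
    rewrite (bigD1 j) //= eqxx mulr1 big1 ?addr0 // => i /negPf->.
    by rewrite mulr0 scale0r.
  have yy : herm y y = \sum_i `|c1 i| ^+ 2.
    rewrite {1}yE (herm_suml herm_linl); apply: eq_bigr => i _; rewrite hZl.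
    rewrite normCK; congr (_ * _); rewrite herm_conjC yE (herm_suml herm_linl).
    have hee j k : herm (e j) (e k) = (j == k)%:R by rewrite /herm transpose_e form_ef.
    rewrite (bigD1 i) //= hZl hee eqxx mulr1 big1 ?addr0 //.
    by move=> j ji; rewrite hZl hee (negPf ji) mulr0.
  have pos i : true -> 0 <= `|c1 i| ^+ 2 by rewrite exprn_ge0.
  rewrite yy lt_neqAle sumr_ge0 // andbT; apply: contraNneq y0 => /esym/eqP.
  rewrite psumr_eq0 // => /allP s0; rewrite yE big1 // => i _.
  have := s0 i (mem_index_enum i); rewrite /= sqrf_eq0 normr_eq0 => /eqP->.
  by rewrite scale0r.
have basis k : exists bk : seq L, (0 < k < n.+1)%N ->
    [/\ orth_seq herm bk, forall u, u \in bk -> gr k u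
      & forall v, gr k v -> v = oproj herm bk v].
  case: k => [|k]; first by exists [::].
  have [kn|_] := ltnP k.+1 n.+1; last by exists [::].
  have [|bk bkP] := @degree_basis k; last by exists bk.
  by move=> v gv v0; apply: (IH k) => //; lia.
have [bs bsP] := choice basis.
have cE : casimir bs n.+1 y = (2 * n.+1%:R - root_form al al) *: y.
  apply: casimir_root => //.
  - by move=> k u /bsP[_ + _]; apply.
  - by move=> k v /bsP[_ _]; apply.
(* The height n.+1 is at least 2, and (al | al) is at most 2. *)
set cst := 2 * _ - _ in cE; have cst0 : 0 < cst.
  have q2 : root_norm a b c <= 2 by apply: (@root_norm_le2 K _ _ _ y) => //; rewrite -aE.
  rewrite /cst aE root_form3 subr_gt0; apply: (@le_lt_trans _ _ (2%:R)).
    by rewrite -[2%:R]/(2%:~R) ler_int.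
  by rewrite -natrM ltr_nat; lia.
have cyy : cst * herm y y = \sum_(1 <= k < n.+1) \sum_(u <- bs k)
    (herm u u)^-1 * herm (lie (tr u) y) (lie (tr u) y).
  rewrite -hZl -cE (herm_suml herm_linl); apply: eq_bigr => k _.
  by rewrite (herm_suml herm_linl); apply: eq_bigr => u _; rewrite hZl herm_adjoint.
have pos k u : (0 < k < n.+1)%N -> u \in bs k -> [/\ 0 < (herm u u)^-1,
    0 <= herm (lie (tr u) y) (lie (tr u) y) &
    herm (lie (tr u) y) (lie (tr u) y) = 0 -> lie (tr u) y = 0].
  move=> kn ub; have [[nz _] gu _] := bsP k kn; have ku := gu u ub.
  have u0 : u != 0 by apply: contraNneq (nz u ub) => ->; rewrite h0l.
  have guy : gr (n - k).+1 (lie (tr u) y).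
    by move: (gr_lie (transpose_gr ku) gy); congr (gr _ _); lia.
  have [k' kE] : exists k', k = k'.+1 by exists k.-1; lia.
  have uu : 0 < herm u u by rewrite kE in ku; apply: (IH k') => //; lia.
  split; first by rewrite invr_gt0.
    have [->|z0] := eqVneq (lie (tr u) y) 0; first by rewrite h0l.
    by apply/ltW/(IH (n - k)%N) => //; lia.
  move=> hz; apply/eqP; apply: contraT => z0.
  have : 0 < herm (lie (tr u) y) (lie (tr u) y) by apply: (IH (n - k)%N) => //; lia.
  by rewrite hz ltxx.
have pos2 k u : (0 < k < n.+1)%N -> u \in bs k ->
    0 <= (herm u u)^-1 * herm (lie (tr u) y) (lie (tr u) y).
  by move=> kn ub; have [p1 p2 _] := pos k u kn ub; apply: mulr_ge0 => //; apply: ltW.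
have pos3 k : (0 < k < n.+1)%N -> 0 <= \sum_(u <- bs k)
    (herm u u)^-1 * herm (lie (tr u) y) (lie (tr u) y).
  by move=> kn; rewrite big_seq; apply: sumr_ge0 => u; apply: pos2.
have yy0 : 0 <= herm y y.
  rewrite -(pmulr_rge0 _ cst0) cyy big_nat; apply: sumr_ge0 => k kn; exact: pos3.
rewrite lt_neqAle yy0 andbT eq_sym; apply: contraNneq y0 => yy.
(* All the norms in the sum vanish, hence so does the Casimir operator on y. *)
have : cst *: y = 0.
  rewrite -cE /casimir big_nat big1 // => k kn; rewrite big_seq big1 // => u ub.
  have := cyy; rewrite yy mulr0 big_nat => /esym/eqP; rewrite psumr_eq0; last first.
    by move=> k'; apply: pos3.
  move=> /allP/(_ k); rewrite mem_index_iota kn => /(_ isT) /= /eqP.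
  rewrite big_seq => /eqP; rewrite psumr_eq0 => [|u']; last exact: pos2.
  move=> /allP/(_ u ub); rewrite ub /= mulf_eq0.
  have [p1 _ p3] := pos k u kn ub; rewrite gt_eqF //= => /eqP/p3->.
  by rewrite liex0 scaler0.
by move/eqP; rewrite scaler_eq0 gt_eqF.
Qed.

Lemma herm_transpose x : herm (tr x) (tr x) = herm x x.
Proof. by rewrite /herm transposeK formC. Qed.

Lemma root_gr a b c x : root_sp (root3 a b c) x -> gr (a + b + c) x.
Proof.
move=> rx; apply/grP; rewrite rx; congr (_ *: _).
have [E1 E2 E3] := root3E K a b c; rewrite sum3 E1 E2 E3 /rho /=.
by rewrite !(intrD, intrN, intrM); field.
Qed.

(** Negative roots are carried to positive ones by the transposition. *)
Lemma herm_pos al x : root_sp al x -> al != 0 -> x != 0 -> 0 < herm x x.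
Proof.
move=> rx al0 x0; have [a [b [c [abc aE _]]]] := root_coords rx x0 al0.
have E : (a%:Z + b%:Z + c%:Z) = (a + b + c).-1.+1 by lia.
case: aE => aE; rewrite aE in rx.
  by apply: (@herm_pos_degree (a + b + c).-1) => //; rewrite -E; apply: root_gr.
rewrite -herm_transpose; apply: (@herm_pos_degree (a + b + c).-1).
  by rewrite -E; apply/root_gr; have := transpose_root rx; rewrite !opprK.
by apply: contraNneq x0 => tx; rewrite -(transposeK x) tx transpose0.
Qed.

(** Finite dimension of the root spaces, in the form used by orthogonal_basis. *)
Lemma root_separating al : al != 0 -> exists s : seq L,
  forall x, root_sp al x -> (forall u, u \in s -> herm x u = 0) -> x = 0.
Proof.
move=> al0; have [[y [ry y0]]|no] := pselect (exists y, root_sp al y /\ y != 0); last first.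
  exists [::] => x rx _; apply/eqP; apply: contraT => x0.
  by case: no; exists x.
have [a [b [c [abc aE _]]]] := root_coords ry y0 al0.
have E : (a%:Z + b%:Z + c%:Z) = (a + b + c).-1.+1 by lia.
have [bs [_ _ bsE]] := degree_basis (@herm_pos_degree (a + b + c).-1).
have sep x : gr (a + b + c).-1.+1 x -> (forall u, u \in bs -> herm x u = 0) -> x = 0.
  move=> gx xs; rewrite (bsE x gx) /oproj big_seq big1 // => u ub.
  by rewrite xs // mul0r scale0r.
case: aE => aE.
  by exists bs => x rx; apply: sep; rewrite -E; apply: root_gr; rewrite -aE.
exists [seq tr u | u <- bs] => x rx xs; rewrite -(transposeK x).
suff -> : tr x = 0 by rewrite transpose0.
apply: sep => [|u ub]; last first.
  have := xs (tr u) (map_f tr ub); rewrite /herm transposeK -{1}(transposeK u).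
  by rewrite -{1}(transposeK x) form_transpose => /eqP; rewrite conjC_eq0 => /eqP.
by rewrite -E; apply/root_gr; rewrite aE in rx; have := transpose_root rx; rewrite !opprK.
Qed.

End Form.

(** * Unitarizable modules *)

Section Unitarizable.
Variables (K : numClosedFieldType) (g : lieAlgType K) (V : lieModType g).
Variable H : V -> V -> K.
Hypothesis HL : forall a u v w, H (a *: u + v) w = a * H u w + H v w.
Hypothesis HC : forall u v, H v u = (H u v)^*.
Hypothesis Hnz : forall v, v != 0 -> H v v != 0.

(** The weight spaces G s have finite dimension and a level bounded below, which
    the F i lower; T i stands for the Cartan subalgebra, and G_FE for the fact
    that [F j, E i] belongs to it. *)
Variables (S : choiceType) (G : S -> set V) (level : S -> nat).
Hypothesis G0 : forall s, G s 0.
Hypothesis G_lin : forall s a u v, G s u -> G s v -> G s (a *: u + v).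
Hypothesis G_span : forall v, lspan [set w | exists s, G s w] v.
Hypothesis G_orth : forall s s' v w, s != s' -> G s v -> G s' w -> H v w = 0.
Hypothesis G_fin : forall s, exists (n : nat) (l : nat -> V -> K),
  (forall i a u v, l i (a *: u + v) = a * l i u + l i v) /\
  forall v, G s v -> (forall i, (i < n)%N -> l i v = 0) -> v = 0.

Variables (I : Type) (E F T : I -> g).
Hypothesis gen : forall P : g -> Prop, P 0 ->
  (forall a x y, P x -> P y -> P (a *: x + y)) ->
  (forall x y, P x -> P y -> P (lie x y)) ->
  (forall i, P (E i)) -> (forall i, P (F i)) -> (forall i, P (T i)) -> forall x, P x.
Hypothesis adjE : forall i v w, H (act (E i) v) w = H v (act (F i) w).
Hypothesis adjT : forall i v w, H (act (T i) v) w = H v (act (T i) w).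
Hypothesis G_E : forall i s v, G s v -> exists s', G s' (act (E i) v).
Hypothesis G_T : forall i s v, G s v -> exists c, act (T i) v = c *: v.
Hypothesis G_F : forall i s v, G s v -> act (F i) v = 0 \/ exists s',
  [/\ (level s' < level s)%N, G s' (act (F i) v)
    & forall u, G s' u -> G s (act (E i) u)].
Hypothesis G_FE : forall i j s v, G s v ->
  exists c, act (F j) (act (E i) v) = act (E i) (act (F j) v) + c *: v.

Lemma adjF i v w : H (act (F i) v) w = H v (act (E i) w).
Proof. by rewrite HC -adjE -HC. Qed.

Lemma adjoint_ex x : exists y, forall v w, H (act x v) w = H v (act y w).
Proof.
move: x; apply: gen => [|a x y [x' xx'] [y' yy']|x y [x' xx'] [y' yy']|i|i|i].
- by exists 0 => v w; rewrite !act0v (herm0l HL) (herm0r HL HC).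
- exists (a^* *: x' + y') => v w; rewrite !act_linearl HL (hermDr HL HC) (hermZr HL HC).
  by rewrite conjCK xx' yy'.
- exists (lie y' x') => v w; rewrite !act_lie (hermDl HL) (hermDr HL HC).
  by rewrite (hermNl HL) (hermNr HL HC) !(xx', yy').
- by exists (F i) => v w; rewrite adjE.
- by exists (E i) => v w; rewrite adjF.
- by exists (T i) => v w; rewrite adjT.
Qed.

Inductive word (v : V) : V -> Prop :=
| word0 : word v v
| wordS i w : word v w -> word v (act (E i) w).

Lemma word_G s v w : G s v -> word v w -> exists s', G s' w.
Proof. by move=> Gv; elim=> [|i {}w _ [s' Gw]]; [exists s | apply: G_E Gw]. Qed.

(** By G_FE, F j passes through a word at the cost of shorter words. *)
Lemma gen_mod_word s v : G s v -> (forall i, act (F i) v = 0) ->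
  forall w, gen_mod [set v] w -> lspan (word v) w.
Proof.
move=> Gv Fv w; elim=> [_ ->||a {}w w' _ + _|x {}w _ Hw].
- exact/lspan_in/word0.
- exact: lspan0.
- exact: lspan_lin.
move: x w Hw; suff stable i : [/\ forall w, word v w -> lspan (word v) (act (E i) w),
    forall w, word v w -> lspan (word v) (act (F i) w)
  & forall w, word v w -> lspan (word v) (act (T i) w)].
  have ext x : (forall w, word v w -> lspan (word v) (act x w)) ->
      forall w, lspan (word v) w -> lspan (word v) (act x w).
    by move=> xw; apply: lspan_map; first exact: act_linearr.
  apply: gen => [w _|a x y IHx IHy w ww|x y IHx IHy w ww|i|i|i].
  - by rewrite act0v; apply: lspan0.
  - by rewrite act_linearl; apply: lspan_lin; [apply: IHx | apply: IHy].
  - rewrite act_lie; apply: lspan_add; first exact/IHx/IHy.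
    exact/lspan_opp/IHy/IHx.
  - by apply: ext; have [] := stable i.
  - by apply: ext; have [] := stable i.
  - by apply: ext; have [] := stable i.
have sE j w : word v w -> lspan (word v) (act (E j) w).
  by move=> ww; apply/lspan_in/wordS.
split=> [w|w|w ww]; first exact: sE.
  elim=> [|j {}w ww IH]; first by rewrite Fv; apply: lspan0.
  have [s' Gw] := word_G Gv ww; have [c ->] := G_FE j i Gw.
  apply: lspan_add; last exact/lspan_scale/lspan_in.
  by apply: (lspan_map _ (sE j) IH); apply: act_linearr.
have [s' Gw] := word_G Gv ww; have [c ->] := G_T i Gw.
exact/lspan_scale/lspan_in.
Qed.

(** Adjoints reduce this to the case w = v, where w' may be taken to be a word in
    the E i applied to v'; and H (E i u) v = H u (F i v) = 0. *)
Lemma gen_mod_orth s v v' : G s v' -> (forall i, act (F i) v = 0) ->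
  (forall i, act (F i) v' = 0) -> H v' v = 0 ->
  forall w w', gen_mod [set v] w -> gen_mod [set v'] w' -> H w' w = 0.
Proof.
move=> Gv' Fv Fv' vv'.
have base w' : gen_mod [set v'] w' -> H w' v = 0.
  move=> /(gen_mod_word Gv' Fv'); apply: (herm_span0 HL) => _ [//|i u _].
  by rewrite adjE Fv (herm0r HL HC).
move=> w w' gw; elim: gw w' => [_ ->|w' _|a {}w w2 _ IH _ IH2 w' gw'|x {}w _ IH w' gw'].
- exact: base.
- by rewrite (herm0r HL HC).
- by rewrite (hermDr HL HC) (hermZr HL HC) IH // IH2 // mulr0 addr0.
have [y xy] := adjoint_ex x; rewrite HC xy -HC IH //.
exact: gen_mod_act.
Qed.

Lemma lowest_basis s : exists b, [/\ orth_seq H b,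
    forall u, u \in b -> G s u /\ forall i, act (F i) u = 0
  & forall v, G s v -> (forall i, act (F i) v = 0) -> lspan [set u | u \in b] v].
Proof.
have [n [l [ll lG]]] := G_fin s.
have [||v _|v [Gv _]|b [ob bW Wb]] := @orthogonal_basis _ _ H HL HC n l
   (fun v => G s v /\ forall i, act (F i) v = 0) ll.
- by split=> // i; rewrite actx0.
- move=> a u v [Gu Fu] [Gv Fv]; split=> [|i]; first exact: G_lin.
  by rewrite act_linearr Fu Fv scaler0 addr0.
- exact: Hnz.
- exact: lG.
- by exists b; split=> // v Gv Fv; apply: Wb.
Qed.

(** The submodules generated by the vectors of lowest_basis are orthogonal, so
    their sum is direct. It is everything, by induction on the level: let m be
    homogeneous and orthogonal to the part of the sum in its weight space. Each
    F i m has a lower level, hence lies in the sum; then so does E i F i m, and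
    (F i m | F i m) = (m | E i F i m) = 0. So F i m = 0 and m is in the span of
    lowest_basis. *)
Lemma unitarizable_decomposition (P : lieModType g -> Prop) :
  (forall s (v : V), v != 0 -> G s v -> (forall i, act (F i) v = 0) ->
     P (gen_submod [set v])) ->
  direct_sum_of P V.
Proof.
move=> HP; have [b bP] := choice lowest_basis.
pose J : choiceType := {p : S * nat | (p.2 < size (b p.1))%N}.
pose vec (p : J) := nth 0 (b (val p).1) (val p).2.
have vec_in p : vec p \in b (val p).1 by apply/mem_nth/(valP p).
have vecG p : G (val p).1 (vec p) by have [_ + _] := bP (val p).1; case/(_ _ (vec_in p)).
have vecF p i : act (F i) (vec p) = 0.
  by have [_ + _] := bP (val p).1; case/(_ _ (vec_in p)) => _; apply.
have vec_nz p : vec p != 0.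
  have [[+ _] _ _] := bP (val p).1 => /(_ _ (vec_in p)).
  by apply: contraNneq => ->; rewrite (herm0l HL).
have vec_orth p q : p != q -> H (vec p) (vec q) = 0.
  move=> pq; have [spq|spq] := eqVneq (val p).1 (val q).1; last exact: G_orth spq _ _.
  have npq : (val p).2 != (val q).2.
    apply: contraNneq pq => npq; apply/eqP/val_inj; move: spq npq.
    by case: (val p) => [? ?]; case: (val q) => [? ?] /= -> ->.
  have lq : ((val q).2 < size (b (val p).1))%N by rewrite spq; apply: (valP q).
  have [[_ /(pairwiseP 0) pw] _ _] := bP (val p).1.
  rewrite /vec -spq; case: ltngtP npq => // pq2 _.
    by apply/eqP/pw => //; rewrite ?inE ?(valP p).
  by apply/(herm_sym0 HC)/eqP/pw => //; rewrite ?inE ?(valP p).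
pose N (v : V) := lspan [set w | exists p : J, gen_mod [set vec p] w] v.
have N_act x v : N v -> N (act x v).
  apply: lspan_map; first exact: act_linearr.
  by move=> w [p gw]; apply: lspan_in; exists p; apply: gen_mod_act.
have b_N s u : u \in b s -> N u.
  move=> ub; have lu : (index u (b s) < size (b s))%N by rewrite index_mem.
  apply: lspan_in; exists (exist _ (s, index u (b s)) lu); apply: gen_mod_in.
  by rewrite /vec /= nth_index.
have G_N n : forall s v, (level s < n)%N -> G s v -> N v.
  elim: n => // n IH s v ln Gv; have [m [l [ll lG]]] := G_fin s.
  have [||u _|u [Gu _]|o [oo oW Wo]] := @orthogonal_basis _ _ H HL HC m l
     (fun v => G s v /\ N v) ll.
  - by split=> //; apply: lspan0.
  - by move=> a u w [Gu Nu] [Gw Nw]; split; [apply: G_lin | apply: lspan_lin].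
  - exact: Hnz.
  - exact: lG.
  have [Go No] : G s (oproj H o v) /\ N (oproj H o v).
    apply: (lspan_sub (P := fun v => G s v /\ N v)) (oproj_span H o v) => //.
      by split=> //; apply: lspan0.
    by move=> a u w [Gu Nu] [Gw Nw]; split; [apply: G_lin | apply: lspan_lin].
  set m' := v - oproj H o v.
  have Gm : G s m' by rewrite /m' addrC -scaleN1r; apply: G_lin.
  have m_orth u : G s u -> N u -> H u m' = 0.
    move=> Gu Nu; apply: (herm_span0 HL _ (Wo u (conj Gu Nu))) => t ot.
    exact/(herm_sym0 HC)/(oproj_orth HL HC).
  suff Nm : N m' by rewrite -(subrK (oproj H o v) v); apply: lspan_add.
  have Fm i : act (F i) m' = 0.
    have [//|[s' [ls Gs Es]]] := G_F i Gm; apply/eqP; apply: contraT => /Hnz.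
    rewrite adjF (herm_sym0 HC) ?eqxx // m_orth //; first exact: Es.
    by apply/N_act/(IH s') => //; apply: leq_trans ls _.
  have [_ _ Pb] := bP s; apply: (lspan_sub (P := N)) (Pb _ Gm Fm).
  - exact: lspan0.
  - by move=> *; apply: lspan_lin.
  - exact: b_N.
exists J, (fun p => gen_submod [set vec p]); split=> [p|v|r w ur rw w0 p pr].
- exact: (HP (val p).1).
- apply: (lspan_sub (P := N)) (G_span v) => [|*|w [s Gw]]; first exact: lspan0.
    exact: lspan_lin.
  exact: (G_N (level s).+1 s).
apply/eqP; apply: contraT => /Hnz; suff -> : H (w p) (w p) = 0 by rewrite eqxx.
have : H (\sum_(q <- r) w q) (w p) = 0 by rewrite w0 (herm0l HL).
rewrite (herm_suml HL) (bigD1_seq p) //= big_seq_cond big1 ?addr0 // => q /andP[qr qp].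
apply: (gen_mod_orth (vecG q) (vecF p) (vecF q)); first exact: vec_orth.
  exact: rw.
exact: rw.
Qed.

End Unitarizable.

(** * Generalities on modules *)

Section Modules.
Variables (K : fieldType) (g : lieAlgType K).

Lemma mod_iso_bij (V W : lieModType g) (f : V -> W) : linear f ->
  (forall x v, f (act x v) = act x (f v)) -> (forall v, f v = 0 -> v = 0) ->
  (forall w, exists v, f v = w) -> mod_iso V W.
Proof.
move=> fL fact f_inj f_surj.
pose fM := GRing.isLinear.Build K V W *:%R f fL.
pose F : {linear V -> W} := HB.pack f fM.
exists F; split=> //; have [h hP] := choice f_surj.
exists h => [v|w]; last exact: hP.
apply/eqP; rewrite -subr_eq0; apply/eqP/f_inj.
by rewrite (linearD_prop fL) (linearN_prop fL) hP subrr.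
Qed.

(** The component in N1 is chosen vector by vector; its uniqueness makes the
    choice linear and equivariant. *)
Lemma submod_projection (V : lieModType g) (N1 N2 : submod V) :
  (forall v, N1 v -> N2 v -> v = 0) ->
  (forall v, exists2 v1, N1 v1 & N2 (v - v1)) ->
  exists p : V -> N1, [/\ linear p, forall x v, p (act x v) = act x (p v),
    forall n : N1, p (val n) = n & forall v, N2 v -> p v = 0]
    /\ forall v, N2 (v - val (p v)).
Proof.
move=> N12 Nsum.
have ex v : exists n : N1, N2 (v - val n).
  have [v1 Nv1 Nv] := Nsum v.
  by exists (exist _ v1 (asboolT Nv1)).
have [p pP] := choice ex.
have N1v (n : N1) : N1 (val n) by apply: asboolW (valP n).
have subN (N : submod V) u v : N u -> N v -> N (u - v).
  by move=> Nu Nv; rewrite addrC -scaleN1r; apply: submod_lin.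
have uniq v (n : N1) : N2 (v - val n) -> p v = n.
  move=> Nvn; apply: val_inj; apply/eqP; rewrite -subr_eq0; apply/eqP; apply: N12.
    exact: subN.
  have -> : val (p v) - val n = (v - val n) - (v - val (p v)).
    by rewrite opprB [RHS]addrC addrA subrK.
  exact: subN.
exists p; split; last by [].
split=> [a u v|x v|n|v Nv].
- apply: uniq => /=.
  have -> : a *: u + v - (a *: val (p u) + val (p v))
      = a *: (u - val (p u)) + (v - val (p v)).
    by rewrite scalerBr opprD addrACA.
  exact: submod_lin.
- by apply: uniq; rewrite /= -actBr; apply: submod_act.
- by apply: uniq; rewrite subrr; apply: submod0.
- by apply: uniq; rewrite /= subr0.
Qed.

Lemma gen_mod_submod (V : lieModType g) (N : submod V) (v : V) :
  N v -> forall w, gen_mod [set v] w -> N w.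
Proof.
move=> Nv w; elim=> [_ ->//||a u u' _ Nu _ Nu'|x u _ Nu].
- exact: submod0.
- exact: submod_lin.
- exact: submod_act.
Qed.

Lemma gen_mod_sub (V : lieModType g) (N : submod V) (v : N) (w : N) :
  gen_mod [set val v] (val w) -> gen_mod [set v] w.
Proof.
have Nu := gen_mod_submod (asboolW (valP v)).
move wE: (val w) => w' gw; elim: gw w wE => [_ ->||a u u' gu IHu gu' IHu'|x u gu IHu] w0 w0E.
- by apply: gen_mod_in; apply: val_inj.
- have -> : w0 = 0 by apply: val_inj.
  exact: gen_mod0.
- pose u1 : N := exist _ u (asboolT (Nu u gu)).
  pose u2 : N := exist _ u' (asboolT (Nu u' gu')).
  have -> : w0 = a *: u1 + u2 by apply: val_inj.
  by apply: gen_mod_lin; [apply: IHu | apply: IHu'].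
- pose u1 : N := exist _ u (asboolT (Nu u gu)).
  have -> : w0 = act x u1 by apply: val_inj.
  by apply: gen_mod_act; apply: IHu.
Qed.

Lemma gen_submod_cyclic (V : lieModType g) (v : V) :
  exists2 v' : gen_submod [set v], val v' = v &
    forall w : gen_submod [set v], gen_mod [set v'] w.
Proof.
have vv : gen_mod [set v] v by apply: gen_mod_in.
exists (exist _ v (asboolT (vv : gen_submod [set v] v))) => // w.
exact/gen_mod_sub/(asboolW (valP w)).
Qed.

Lemma lspan_submod (V : lieModType g) (N : submod V) (X : set V) (w : N) :
  (forall x, X x -> N x) -> lspan X (val w) -> lspan [set x : N | X (val x)] w.
Proof.
move=> XN; move wE: (val w) => w' Xw; elim: Xw w wE => [|a u u' Xu Xu' IH] w wE.
  by have -> : w = 0 by [apply: val_inj]; apply: lspan0.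
have Nu' : N u'.
  by elim: Xu' => [|b r r' /XN Nr _ Nr']; [apply: submod0 | apply: submod_lin].
pose u1 : N := exist _ u (asboolT (XN u Xu)).
pose u2 : N := exist _ u' (asboolT Nu').
have -> : w = a *: u1 + u2 by apply: val_inj.
by apply: lspanD => //; apply: IH.
Qed.

End Modules.

(** * The orthogonal complement of V0 + Fib in Fib(0) *)

Section Complement.
Variable K : numClosedFieldType.
Notation L := (Falg K).
Notation h := (km_h K A3).
Notation e := (km_e K A3).
Notation f := (km_f K A3).
Notation root_sp := (@root_space K 3 A3).
Notation root3 := (root3 K).
Notation tr := (@transpose K 3 A3).
Notation F := (Fib K).
Notation proj := (@root_proj K).
Notation form := (@form K).
Notation herm := (@herm K).

Hypothesis e_neq0 : forall j, e j != 0.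
Let hL := herm_linl e_neq0.
Let hC := herm_conjC e_neq0.

Lemma fib_lin a (x y : L) : F x -> F y -> F (a *: x + y).
Proof. exact: gen_lie_lin. Qed.
Lemma fib_scale a (x : L) : F x -> F (a *: x).
Proof. by move=> Fx; rewrite -[_ *: _]addr0; apply: gen_lie_lin => //; apply: gen_lie0. Qed.
Lemma fib_add (x y : L) : F x -> F y -> F (x + y).
Proof. by move=> Fx Fy; rewrite -[x]scale1r; apply: fib_lin. Qed.
Lemma fib_opp (x : L) : F x -> F (- x).
Proof. by rewrite -scaleN1r; apply: fib_scale. Qed.

Lemma root_E1 : root_sp (root3 2 1 1) (E1 K).
Proof.
apply: root_spaceZ.
have := root_space_lie (@root_space_e K 3 A3 i1)
  (root_space_lie (@root_space_e K 3 A3 i1)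
    (root_space_lie (@root_space_e K 3 A3 i2) (@root_space_e K 3 A3 i3))).
by rewrite !simple_root3 !root3D.
Qed.

Lemma root_E2 : root_sp (root3 0 1 0) (E2 K).
Proof. by have := @root_space_e K 3 A3 i2; rewrite simple_root3. Qed.

Lemma transpose_E1 : tr (E1 K) = F1 K.
Proof.
rewrite /E1 transposeZ fmorphV /= conjC_nat !transpose_lie !transpose_e /F1 scaleNr -scalerN.
congr (_ *: _); rewrite (lieC (f i3)) !lieNl (lieC (lie (f i2) (f i3))) lieNl opprK.
by rewrite lieC.
Qed.

Lemma transpose_F1 : tr (F1 K) = E1 K. Proof. by rewrite -transpose_E1 transposeK. Qed.
Lemma transpose_E2 : tr (E2 K) = F2 K. Proof. exact: transpose_e. Qed.
Lemma transpose_F2 : tr (F2 K) = E2 K. Proof. exact: transpose_f. Qed.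
Lemma transpose_H1 : tr (H1 K) = H1 K.
Proof. by rewrite /H1 !transposeD transposeZ conjC_nat !transpose_h. Qed.
Lemma transpose_H2 : tr (H2 K) = H2 K. Proof. exact: transpose_h. Qed.

Lemma root_F1 : root_sp (root3 (-2) (-1) (-1)) (F1 K).
Proof. by rewrite -transpose_E1; apply: transpose_root root_E1. Qed.
Lemma root_F2 : root_sp (root3 0 (-1) 0) (F2 K).
Proof. by rewrite -transpose_E2 -[0]oppr0; apply: transpose_root root_E2. Qed.
Lemma root_H1 : root_sp 0 (H1 K).
Proof.
rewrite /H1 -addrA; apply: root_space_lin; first exact: root_space_h.
by rewrite -[h i2]scale1r; apply: root_space_lin; apply: root_space_h.
Qed.
Lemma root_H2 : root_sp 0 (H2 K). Proof. exact: root_space_h. Qed.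

Lemma fib_ind (P : L -> Prop) : P 0 ->
  (forall a x y, P x -> P y -> P (a *: x + y)) ->
  (forall x y, F x -> F y -> P x -> P y -> P (lie x y)) ->
  P (E1 K) -> P (F1 K) -> P (H1 K) -> P (E2 K) -> P (F2 K) -> P (H2 K) ->
  forall x, F x -> P x.
Proof.
move=> P0 Pl Pb e1 f1 h1 e2 f2 h2 x.
elim=> [{}x|//|a y z _ Py _ Pz|y z Fy Py Fz Pz]; [|exact: Pl|exact: Pb].
by case=> [[[[[->|->]|->]|->]|->]|->].
Qed.

Lemma fib_E1 : F (E1 K). Proof. by apply: gen_lie_in; do 5 left. Qed.
Lemma fib_F1 : F (F1 K). Proof. by apply: gen_lie_in; do 4 left; right. Qed.
Lemma fib_H1 : F (H1 K). Proof. by apply: gen_lie_in; do 3 left; right. Qed.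
Lemma fib_E2 : F (E2 K). Proof. by apply: gen_lie_in; do 2 left; right. Qed.
Lemma fib_F2 : F (F2 K). Proof. by apply: gen_lie_in; left; right. Qed.
Lemma fib_H2 : F (H2 K). Proof. by apply: gen_lie_in; right. Qed.

Lemma fib_transpose x : F x -> F (tr x).
Proof.
move: x; apply: fib_ind => [|a x y Fx Fy|x y _ _ Fx Fy||||||].
- by rewrite transpose0; apply: gen_lie0.
- by rewrite transpose_antilinear; apply: gen_lie_lin.
- by rewrite transpose_lie; apply: gen_lie_lie.
- by rewrite transpose_E1; apply: fib_F1.
- by rewrite transpose_F1; apply: fib_E1.
- by rewrite transpose_H1; apply: fib_H1.
- by rewrite transpose_E2; apply: fib_F2.
- by rewrite transpose_F2; apply: fib_E2.
- by rewrite transpose_H2; apply: fib_H2.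
Qed.

(** The generators of Fib are root vectors, so that Fib is graded. *)
Lemma fib_proj al x : F x -> F (proj al x).
Proof.
have root_case ga be y : root_sp be y -> F y -> F (proj ga y).
  by move=> ry Fy; rewrite (root_projE _ ry); case: ifP => // _; apply: gen_lie0.
move: x => x Fx; suff : forall al, F (proj al x) by apply.
move: x Fx; apply: fib_ind => [be|a x y Fx Fy be|x y Fx Fy pFx pFy be||||||].
- by rewrite (linear0_prop (root_proj_linear be)); apply: gen_lie0.
- by rewrite (root_proj_linear be); apply: fib_lin.
- have [[r [_ xE]] [r' [_ yE]]] := (root_proj_sum x, root_proj_sum y).
  rewrite xE lie_suml (linear_sum_prop (root_proj_linear be)).
  elim/big_ind: _ => [|u v Fu Fv|ga _]; first exact: gen_lie0.
    exact: fib_add.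
  rewrite yE (linear_sum_prop (lie_linearr _)) (linear_sum_prop (root_proj_linear be)).
  elim/big_ind: _ => [|u v Fu Fv|de _]; first exact: gen_lie0.
    exact: fib_add.
  have := root_space_lie (root_proj_root ga x) (root_proj_root de y).
  move/root_projE->; case: ifP => _; last exact: gen_lie0.
  by apply: gen_lie_lie; [exact: pFx | exact: pFy].
- by move=> ga; apply: root_case root_E1 fib_E1.
- by move=> ga; apply: root_case root_F1 fib_F1.
- by move=> ga; apply: root_case root_H1 fib_H1.
- by move=> ga; apply: root_case root_E2 fib_E2.
- by move=> ga; apply: root_case root_F2 fib_F2.
- by move=> ga; apply: root_case root_H2 fib_H2.
Qed.

Lemma fib0_proj al (x : L) : fib0 x -> fib0 (proj al x).
Proof.
elim=> [|a {}x y gx _ IH].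
  by rewrite (linear0_prop (root_proj_linear al)); apply: lspan0.
rewrite (root_proj_linear al); apply: lspan_lin => //.
have [a' [b [c [_ rx]]]] := fib0_span_graded gx.
by rewrite (root_projE _ rx); case: ifP => _; [apply: lspan_in | apply: lspan0].
Qed.

(** This is z beta1 + (y - z) beta2 as a root of F; its restriction has
    wt = - y. *)
Definition wroot (y z : int) : 'rV[K]_3 := root3 (2 * z) y z.

Lemma fib0_root_wroot al (x : L) : fib0 x -> root_sp al x -> x != 0 ->
  exists y z, al = wroot y z.
Proof.
move=> fx rx; rewrite -[x in x != 0](_ : proj al x = x); last first.
  by rewrite (root_projE _ rx) eqxx.
apply: contra_neqP => nal; elim: fx {rx} => [|a {}x y gx _ IH].
  exact: linear0_prop (root_proj_linear al).
rewrite (root_proj_linear al) IH addr0; have [a' [b [c [ca rx']]]] := fib0_span_graded gx.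
rewrite (root_projE _ rx'); case: eqP => [aE|_]; last by rewrite scaler0.
by case: nal; exists b, c; rewrite -aE /wroot; congr root3; lia.
Qed.

Lemma herm_proj al x u : herm (proj al x) u = herm x (proj al u).
Proof.
have pl := root_proj_linear (K := K) al; have p0 := linear0_prop pl.
apply: (lspan_sub (P := fun x => herm (proj al x) u = herm x (proj al u)) _ _ _
  (root_full x)) => [|a y z yE zE|y [be /root_weight ry]].
- by rewrite p0 !(herm0l hL).
- by rewrite pl !hL yE zE.
apply: (lspan_sub (P := fun u => herm (proj al y) u = herm y (proj al u)) _ _ _
  (root_full u)) => [|a v w vE wE|v [ga /root_weight rv]].
- by rewrite p0 !(herm0r hL hC).
- by rewrite pl !(hermDr hL hC) !(hermZr hL hC) vE wE.
rewrite (root_projE _ ry) (root_projE _ rv).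
case: (eqVneq be al) => [<-|ba]; case: (eqVneq ga _) => [ga_|gb] //.
- by rewrite (herm_root_orth e_neq0 ry rv) ?(herm0r hL hC) // eq_sym.
- by rewrite (herm_root_orth e_neq0 ry rv) ?(herm0l hL) // ga_.
- by rewrite (herm0l hL) (herm0r hL hC).
Qed.

Definition perp_set : set (Fib0 K) :=
  [set v | herm (val v) (hV0 K) = 0 /\ forall u, F u -> herm (val v) u = 0].

Lemma hV0_fib_commute x : F x -> lie x (hV0 K) = 0.
Proof. by move=> /fib_sub_fib0/hV0_central. Qed.

Lemma perp0 : perp_set 0.
Proof. by split=> [|u _]; apply: (herm0l hL). Qed.
Lemma perp_lin a u v : perp_set u -> perp_set v -> perp_set (a *: u + v).
Proof.
move=> [u0 uF] [v0 vF]; split=> [|w Fw]; rewrite [LHS]hL.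
  by rewrite [X in _ * X]u0 [X in _ + X]v0 mulr0 addr0.
by rewrite [X in _ * X]uF // [X in _ + X]vF // mulr0 addr0.
Qed.
Lemma perp_act (x : F) v : perp_set v -> perp_set (act x v).
Proof.
move=> [v0 vF]; have Fx : F (tr (val x)) by exact: fib_transpose (asboolW (valP x)).
split=> [|u Fu]; rewrite [LHS](herm_adjoint e_neq0).
  by rewrite hV0_fib_commute // (herm0r hL hC).
by apply/vF/gen_lie_lie.
Qed.
Definition perp : submod (Fib0 K) := Submod perp0 perp_lin perp_act.

Lemma hV0_gr : gr 0 (hV0 K).
Proof.
rewrite /hV0 addrC -scaleNr; apply: gr_lin; exact: gr_h.
Qed.

Lemma form_hh i j : form (h i) (h j) = (A3 i j)%:~R.
Proof.
rewrite (form_h e_neq0); last exact: gr_h.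
rewrite (bigD1 i) //= coord_h // eqxx mul1r big1 ?addr0 // => k ki.
by rewrite coord_h // (negPf ki) mul0r.
Qed.

(** V0 is orthogonal to the Cartan subalgebra of Fib, and to brackets, as it
    centralizes Fib. *)
Lemma form_hV0_fib x : F x -> form (hV0 K) x = 0.
Proof.
have root_case (p : int) y : p != 0 -> gr p y -> form (hV0 K) y = 0.
  by move=> p0 gy; apply: (form0 e_neq0 hV0_gr gy); rewrite add0r.
move: x; apply: fib_ind => [|a x y xE yE|x y Fx Fy _ _||||||].
- exact: (form0r e_neq0).
- by rewrite form_linr // xE yE mulr0 addr0.
- by rewrite -form_invariant // lieC hV0_fib_commute // oppr0 form0l.
- by apply: root_case (root_gr root_E1).
- by apply: root_case (root_gr root_F1).
- rewrite /hV0 /H1 !(formDl, formDr, formNl, formZl, formZr) //.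
  by rewrite !form_hh !mxE /=; ring.
- by apply: root_case (root_gr root_E2).
- by apply: root_case (root_gr root_F2).
- rewrite /hV0 /H2 !(formDl, formDr, formNl, formZl, formZr) //.
  by rewrite !form_hh !mxE /=; ring.
Qed.

Lemma V0_fib_disjoint c : F (c *: hV0 K) -> c = 0.
Proof.
move=> /form_hV0_fib; rewrite formZr // => /eqP; rewrite mulf_eq0 => /orP[/eqP//|].
suff -> : form (hV0 K) (hV0 K) = 10 by rewrite pnatr_eq0.
rewrite {1}/hV0 /hV0 !(formDl, formDr, formNl, formNr, formZl, formZr) //.
by rewrite !form_hh !mxE /=; ring.
Qed.

Lemma h_combination j : exists c1 c2 c3,
  h j = c1 *: hV0 K + (c2 *: H1 K + c3 *: H2 K).
Proof.
have ex c1 c2 c3 : c1 *: hV0 K + (c2 *: H1 K + c3 *: H2 K)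
    = (c1 + 2 * c2) *: h i1 + (c2 + c3) *: h i2 + (c2 - 2 * c1) *: h i3.
  rewrite /hV0 /H1 /H2 !scalerDr scalerN !scalerA !scalerDl scaleNr.
  rewrite [c1 * 2]mulrC [c2 * 2]mulrC.
  by rewrite -!addrA; congr (_ + _); rewrite addrCA; congr (_ + _);
    rewrite addrC -!addrA; congr (_ + _); rewrite addrCA; congr (_ + _).
move: j; apply: ord3_ind.
- exists (5^-1), (2 / 5), (- (2 / 5)); rewrite ex.
  rewrite -[LHS](_ : 1 *: h i1 + 0 *: h i2 + 0 *: h i3 = _).
    by congr (_ *: _ + _ *: _ + _ *: _); field.
  by rewrite scale1r !scale0r !addr0.
- exists 0, 0, 1; rewrite ex mulr0 subr0 !addr0 add0r.
  by rewrite scale1r !scale0r add0r addr0.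
- exists (- (2 / 5)), (5^-1), (- 5^-1); rewrite ex.
  rewrite -[LHS](_ : 0 *: h i1 + 0 *: h i2 + 1 *: h i3 = _).
    by congr (_ *: _ + _ *: _ + _ *: _); field.
  by rewrite scale1r !scale0r !add0r.
Qed.

(** V0, H1 and H2 span the Cartan subalgebra, where the form is nondegenerate. *)
Lemma perp_cartan (v : Fib0 K) : perp v -> root_sp 0 (val v : L) -> val v = 0.
Proof.
move=> [v0 vF] rv; have gv : gr 0 (val v : L).
  by have := @root_gr K 0 0 0 (val v); rewrite root3_0 !addr0; apply.
apply: (gr0_nondeg e_neq0 gv (gr0 _ _)) => j; rewrite form0l //.
have -> : form (val v) (h j) = herm (val v) (h j) by rewrite /herm transpose_h.
have [c1 [c2 [c3 ->]]] := h_combination j.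
rewrite !(hermDr hL hC) !(hermZr hL hC) v0 (vF _ fib_H1) (vF _ fib_H2).
by rewrite !mulr0 !addr0.
Qed.

Lemma perp_proj al (v : Fib0 K) (fv : proj al (val v) \in submod_pred (Fib0 K)) :
  perp v -> perp (exist _ (proj al (val v)) fv : Fib0 K).
Proof.
move=> [v0 vF]; split=> [|u Fu] /=; rewrite herm_proj; last exact/vF/fib_proj.
have r0 : root_sp 0 (hV0 K).
  rewrite /hV0 addrC -scaleNr; apply: root_space_lin; exact: root_space_h.
rewrite (root_projE _ r0); case: ifP => // _; exact: (herm0r hL hC).
Qed.

(** The components of v in the root spaces are in perp as well. The one in the
    Cartan subalgebra is 0, and the others have positive norms. *)
Lemma perp_pos (v : Fib0 K) : perp v -> v != 0 -> 0 < herm (val v) (val v).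
Proof.
move=> pv v0; have [r [ur vE]] := root_proj_sum (val v : L).
have comp_pos al : proj al (val v) != 0 -> 0 < herm (proj al (val v)) (proj al (val v)).
  move=> p0; apply: (herm_pos e_neq0 (root_proj_root al (val v))) => //.
  apply: contra_neq p0 => al0.
  have fv : proj al (val v) \in submod_pred (Fib0 K).
    exact: asboolT (fib0_proj al (asboolW (valP v))).
  have := perp_cartan (perp_proj fv pv); apply.
  by rewrite /= -{1}al0; apply: root_proj_root.
have ge0 al : 0 <= herm (proj al (val v)) (proj al (val v)).
  have [->|p0] := eqVneq (proj al (val v)) 0; first by rewrite (herm0l hL).
  exact/ltW/comp_pos.
rewrite {1 2}vE (herm_sum_orth e_neq0 ur (fun al => root_proj_root al (val v))).
rewrite lt_neqAle sumr_ge0 // andbT; apply: contraNneq v0 => /esym/eqP.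
rewrite psumr_eq0 // => /allP s0; apply/eqP/val_inj; rewrite [LHS]vE big_seq big1 //.
move=> al /s0 /= /eqP hz; apply/eqP; apply: contraT => /comp_pos.
by rewrite hz ltxx.
Qed.

(** The Cartan subalgebra is contained in V0 + Fib; a root vector is projected
    orthogonally to the part of Fib in its root space. *)
Lemma fib0_decomposition (v : L) : fib0 v -> exists c u,
  [/\ F u, herm (v - (c *: hV0 K + u)) (hV0 K) = 0
    & forall w, F w -> herm (v - (c *: hV0 K + u)) w = 0].
Proof.
have hcase j : exists c u, F u /\ h j = c *: hV0 K + u.
  have [c1 [c2 [c3 ->]]] := h_combination j.
  exists c1, (c2 *: H1 K + c3 *: H2 K); split=> //.
  by apply: fib_lin; [exact: fib_H1 | apply/fib_scale/fib_H2].
elim=> [|a {}v w gv _ [c' [u' [Fu' p' q']]]].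
  exists 0, 0; rewrite scale0r addr0 subr0; split; first exact: gen_lie0.
    exact: (herm0l hL).
  by move=> w _; exact: (herm0l hL).
suff [c [u [Fu p q]]] : exists c u,
  [/\ F u, herm (v - (c *: hV0 K + u)) (hV0 K) = 0
    & forall w, F w -> herm (v - (c *: hV0 K + u)) w = 0].
  exists (a * c + c'), (a *: u + u').
  have combine (z : L) : a *: v + w - ((a * c + c') *: z + (a *: u + u'))
      = a *: (v - (c *: z + u)) + (w - (c' *: z + u')).
    rewrite scalerBr [RHS]addrACA -opprD; congr (_ - _).
    by rewrite scalerDl scalerDr scalerA addrACA.
  rewrite combine; split; first exact: gen_lie_lin; first by rewrite hL p p' mulr0 addr0.
  by move=> x Fx; rewrite hL q // q' // mulr0 addr0.
have zero_case c u : F u -> v = c *: hV0 K + u -> exists c u,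
  [/\ F u, herm (v - (c *: hV0 K + u)) (hV0 K) = 0
    & forall w, F w -> herm (v - (c *: hV0 K + u)) w = 0].
  by move=> Fu vE; exists c, u; rewrite -vE subrr; split=> // *; exact: (herm0l hL).
case: gv => [[j _ <-{v zero_case}]|[al [[[al0 _] _] rv]]].
  have [c [u [Fu hE]]] := hcase j; exists c, u; rewrite -hE subrr.
  by split=> // *; exact: (herm0l hL).
have [s sep] := root_separating e_neq0 al0.
have [||||u [Fu ru]|o [oo oW Wo]] := @orthogonal_basis _ _ herm hL hC (size s)
  (fun i x => herm x (nth 0 s i)) (fun x => F x /\ root_sp al x).
- by move=> i a' u x; exact: hL.
- by split; [exact: gen_lie0 | exact: root_space_0].
- by move=> a' u x [Fu ru] [Fx rx]; split; [exact: gen_lie_lin | exact: root_space_lin].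
- by move=> u [Fu ru] u0; rewrite gt_eqF // (herm_pos e_neq0 ru).
- move=> us; apply: sep ru _ => x /(nthP 0)[i is_ <-]; exact: us.
exists 0, (oproj herm o v); rewrite scale0r add0r.
have [Fo ro] : F (oproj herm o v) /\ root_sp al (oproj herm o v).
  apply: (lspan_sub (P := fun x => F x /\ root_sp al x)) (oproj_span herm o v).
  - by split; [exact: gen_lie0 | exact: root_space_0].
  - by move=> a' u x [Fu ru] [Fx rx]; split; [exact: gen_lie_lin | exact: root_space_lin].
  - exact: oW.
set v' := v - _; have rv' : root_sp al v'.
  by rewrite /v' addrC -scaleN1r; apply: root_space_lin.
split=> //.
  have r0 : root_sp 0 (hV0 K).
    rewrite /hV0 addrC -scaleNr; apply: root_space_lin; exact: root_space_h.
  exact: (herm_root_orth e_neq0 rv' r0).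
move=> x Fx; have -> : herm v' x = herm v' (proj al x).
  by rewrite -herm_proj (root_projE _ rv') eqxx.
apply/(herm_sym0 hC)/(herm_span0 hL _ (Wo _ (conj (fib_proj al Fx) (root_proj_root al x)))).
by move=> u uo; apply/(herm_sym0 hC)/(oproj_orth hL hC).
Qed.

End Complement.

(** * The two halves of Y(0) *)

Section Halves.
Variable K : numClosedFieldType.
Notation L := (Falg K).
Notation h := (km_h K A3).
Notation e := (km_e K A3).
Notation root_sp := (@root_space K 3 A3).
Notation F := (Fib K).
Notation proj := (@root_proj K).
Notation herm := (@herm K).
Notation wroot := (@wroot K).
Notation hval c := (\sum_i c i *: h i).

Hypothesis e_neq0 : forall j, e j != 0.
Let hL := herm_linl e_neq0.
Let hC := herm_conjC e_neq0.
Notation perp := (perp e_neq0).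


(** Y(0) is kept abstract: a module Y with an equivariant embedding in the
    orthogonal complement of V0 + Fib. *)
Variables (Y : lieModType F) (lift : Y -> Fib0 K).
Hypothesis lift_linear : linear lift.
Hypothesis lift_act : forall (x : F) y, lift (act x y) = act x (lift y).
Hypothesis lift_perp : forall y, perp (lift y).
Hypothesis lift_inj0 : forall y, lift y = 0 -> y = 0.
Hypothesis Y_diag : Defs.diagonalizable Y.

Definition emb (y : Y) : L := val (lift y).

Lemma emb_linear : linear emb.
Proof. by move=> a u v; rewrite /emb lift_linear. Qed.

Lemma emb_act (x : F) y : emb (act x y) = lie (val x) (emb y).
Proof. by rewrite /emb lift_act. Qed.

Lemma emb_inj0 y : emb y = 0 -> y = 0.
Proof. by move=> y0; apply: lift_inj0; apply: val_inj. Qed.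

Lemma emb_inj y y' : emb y = emb y' -> y = y'.
Proof.
move=> yy; apply/eqP; rewrite -subr_eq0; apply/eqP/emb_inj0.
by rewrite (linearD_prop emb_linear) (linearN_prop emb_linear) yy subrr.
Qed.

Lemma emb_fib0 y : fib0 (emb y).
Proof. exact: asboolW (valP (lift y)). Qed.

Lemma herm_emb_pos y : y != 0 -> 0 < herm (emb y) (emb y).
Proof.
move=> y0; apply: (perp_pos (lift_perp y)).
by apply: contraNneq y0 => ly; apply/eqP/emb_inj0; rewrite /emb ly.
Qed.

(** The norm of 2z alpha1 + z alpha3 is 10 z^2. *)
Lemma wroot0 z x : root_sp (wroot 0 z) x -> x != 0 -> z = 0.
Proof.
move=> rx x0; have := root_norm_le2 rx x0; rewrite /root_norm => q.
by apply/eqP; apply: contraT => z0; move: q; nia.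
Qed.

Lemma wroot0_gr0 z x : root_sp (wroot 0 z) x -> gr 0 x.
Proof.
move=> rx; have [->|x0] := eqVneq x 0; first exact: gr0.
by have := root_gr rx; rewrite (wroot0 rx x0) mulr0 !addr0.
Qed.

Lemma emb_wroot0 z y : root_sp (wroot 0 z) (emb y) -> y = 0.
Proof.
move=> ry; apply: emb_inj0; have [//|y0] := eqVneq (emb y) 0.
apply: (perp_cartan (lift_perp y)).
have z0 := wroot0 ry y0; move: ry.
by rewrite z0 /wroot mulr0 root3_0.
Qed.

Lemma wroot_inj y z y' z' : wroot y z = wroot y' z' -> y = y' /\ z = z'.
Proof. by case/root3_inj. Qed.

Lemma wrootD y z y' z' : wroot y z + wroot y' z' = wroot (y + y') (z + z').
Proof. by rewrite /wroot root3D mulrDr. Qed.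

Lemma fib_restr_wroot y z : fib_restr (wroot y z) 0 0 = (5 * z - 3 * y)%:~R /\
  fib_restr (wroot y z) 0 1 = (2 * y - 5 * z)%:~R.
Proof.
have [E1 E2 E3] := root3E K (2 * z) y z.
rewrite /fib_restr [X in X = _ /\ _]mxE [X in _ /\ X = _]mxE /= /wroot E1 E2 E3.
by rewrite !(intrD, intrN, intrM); split; ring.
Qed.

Lemma fib_restr_inj y z y' z' :
  fib_restr (wroot y z) = fib_restr (wroot y' z') -> wroot y z = wroot y' z'.
Proof.
have [a1 a2] := fib_restr_wroot y z; have [b1 b2] := fib_restr_wroot y' z'.
move=> r; rewrite r b1 in a1; rewrite r b2 in a2.
by have /eqP := a1; have /eqP := a2; rewrite !eqr_int => /eqP ? /eqP ?;
  congr (wroot _ _); lia.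
Qed.

Lemma lambdaE (n1 n2 : K) : (n1 *: lambda1 K + n2 *: lambda2 K) 0 0 = n1 /\
  (n1 *: lambda1 K + n2 *: lambda2 K) 0 1 = n2.
Proof. by split; rewrite !mxE /=; field. Qed.

Lemma root_proj_cartan be c x :
  proj be (lie (hval c) x) = (\sum_i c i * be 0 i) *: proj be x.
Proof.
have pl := @root_proj_linear K be.
apply: (lspan_sub (P := fun x => proj be (lie (hval c) x)
    = (\sum_i c i * be 0 i) *: proj be x) _ _ _ (root_full x)).
- by rewrite liex0 (linear0_prop pl) scaler0.
- by move=> a u v uE vE; rewrite lie_linearr !pl uE vE scalerDr !scalerA mulrC.
move=> y [al /root_weight ry]; rewrite ry (linearZ_prop pl) (root_projE _ ry).
by case: eqP => [->//|_]; rewrite !scaler0.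
Qed.

Lemma fib_cartan_hval a b : a *: H1 K + b *: H2 K
  = hval (fun i : 'I_3 => nth 0 [:: 2 * a; a + b; a] i).
Proof.
rewrite sum3 /= /H1 /H2 !scalerDr scalerA (mulrC a) scalerDl.
by rewrite -!addrA; congr (_ + (_ + _)); rewrite addrC.
Qed.

(** Distinct roots of Fib(0) have distinct restrictions to Fib. *)
Lemma wt_space_root mu w : wt_space mu w -> w != 0 ->
  exists y z, root_sp (wroot y z) (emb w) /\ mu = fib_restr (wroot y z).
Proof.
move=> ww w0; have H a b : lie (a *: H1 K + b *: H2 K) (emb w)
    = (a * mu 0 0 + b * mu 0 1) *: emb w.
  by have := congr1 emb (ww a b); rewrite emb_act (linearZ_prop emb_linear).
have comp be : proj be (emb w) != 0 ->
    exists y z, be = wroot y z /\ mu = fib_restr (wroot y z).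
  move=> p0; have rp := root_proj_root be (emb w).
  have [y [z beE]] := fib0_root_wroot (fib0_proj be (emb_fib0 w)) rp p0.
  exists y, z; split=> //; rewrite -beE; apply/rowP => i.
  have key a b : 2 * a * be 0 i1 + (a + b) * be 0 i2 + a * be 0 i3
      = a * mu 0 0 + b * mu 0 1.
    have := congr1 (proj be) (H a b); rewrite fib_cartan_hval root_proj_cartan sum3 /=.
    rewrite (linearZ_prop (@root_proj_linear K be)) => /eqP.
    by rewrite -subr_eq0 -scalerBl scaler_eq0 (negPf p0) orbF subr_eq0 => /eqP.
  have k1 : 2 * be 0 i1 + be 0 i2 + be 0 i3 = mu 0 0.
    by transitivity (1 * mu 0 0 + 0 * mu 0 1); [rewrite -key|]; ring.
  have k2 : be 0 i2 = mu 0 1.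
    by transitivity (0 * mu 0 0 + 1 * mu 0 1); [rewrite -key|]; ring.
  rewrite [RHS]mxE.
  case: i => [[|[|//]] lt2] /=.
    by rewrite k1; congr (mu 0 _); apply: val_inj.
  by rewrite k2; congr (mu 0 _); apply: val_inj.
have [r [ur wE]] := root_proj_sum (emb w).
have [al p0] : exists al, proj al (emb w) != 0.
  apply: contrapT => no; move/eqP: w0; apply; apply: emb_inj0; rewrite wE.
  by apply: big1 => al _; apply/eqP/negPn/negP => p0; apply: no; exists al.
have [y [z [alE muE]]] := comp al p0; exists y, z; split=> //.
rewrite -alE wE big_seq; elim/big_ind: _ => [|u v ru rv|be _].
- exact: root_space_0.
- by rewrite -[u]scale1r; apply: root_space_lin.
have [->|q0] := eqVneq (proj be (emb w)) 0; first exact: root_space_0.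
have [y' [z' [beE muE']]] := comp be q0.
have -> : al = be by rewrite alE beE; apply: fib_restr_inj; rewrite -muE.
exact: root_proj_root.
Qed.

Lemma root_wt_space y z w :
  root_sp (wroot y z) (emb w) -> wt_space (fib_restr (wroot y z)) w.
Proof.
move=> rw a b; apply: emb_inj; rewrite emb_act (linearZ_prop emb_linear).
rewrite -[lie _ _]/(lie (a *: H1 K + b *: H2 K) (emb w)) fib_cartan_hval rw.
by congr (_ *: _); rewrite sum3 !mxE /=; ring.
Qed.

Definition sgn (sg : bool) : int := if sg then 1 else -1.

(** The pair (n, z) stands for y = n + 1, or y = - (n + 1) if sg is false. As
    wt = - y, the half of sg = true is the part of negative wt. *)
Definition half_root (sg : bool) (s : nat * int) : 'rV[K]_3 :=
  wroot (sgn sg * s.1.+1%:Z) (sgn sg * s.2).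

Definition half (sg : bool) : set Y :=
  lspan [set w | exists s, root_sp (half_root sg s) (emb w)].

Lemma half_rootP sg y z : 0 < sgn sg * y -> exists s, wroot y z = half_root sg s.
Proof.
move=> y0; exists (`|y|.-1%N, sgn sg * z); rewrite /half_root /=.
by congr (wroot _ _); move: y0; rewrite /sgn; case: sg; lia.
Qed.

Lemma wt_space_level n1 n2 w :
  wt_space (n1 *: lambda1 K + n2 *: lambda2 K) w -> w != 0 ->
  exists y z, root_sp (wroot y z) (emb w) /\ n1 + n2 = (- y)%:~R.
Proof.
move=> ww w0; have [y [z [rw muE]]] := wt_space_root ww w0.
exists y, z; split=> //.
have [l1 l2] := lambdaE n1 n2; have [r1 r2] := fib_restr_wroot y z.
rewrite muE r1 in l1; rewrite muE r2 in l2; rewrite -l1 -l2 -intrD.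
by congr (_%:~R); lia.
Qed.

Lemma half_wt_space sg s w : root_sp (half_root sg s) (emb w) ->
  exists n1 n2, n1 + n2 = (- (sgn sg * s.1.+1%:Z))%:~R /\
    wt_space (n1 *: lambda1 K + n2 *: lambda2 K) w.
Proof.
move=> rw; have := root_wt_space rw; set mu := fib_restr _ => ww.
have [r1 r2] := fib_restr_wroot (sgn sg * s.1.+1%:Z) (sgn sg * s.2).
exists (mu 0 0), (mu 0 1); split.
  by rewrite r1 r2 -intrD; congr (_%:~R); lia.
have [l1 l2] := lambdaE (mu 0 0) (mu 0 1).
suff -> : mu 0 0 *: lambda1 K + mu 0 1 *: lambda2 K = mu by [].
apply/rowP; case=> [[|[|//]] lt2].
  by rewrite (_ : Ordinal lt2 = 0) ?l1 //; apply: val_inj.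
by rewrite (_ : Ordinal lt2 = 1) ?l2 //; apply: val_inj.
Qed.

Lemma neg_part_half : neg_part Y = half true.
Proof.
apply/seteqP; split=> [w|w].
  apply: (lspan_sub (P := half true)) => [|a u v|{}w [n1 [n2 [n0 ww]]]].
  - exact: lspan0.
  - exact: lspan_lin.
  have [->|w0] := eqVneq w 0; first exact: lspan0.
  have [y [z [rw nE]]] := wt_space_level ww w0; rewrite nE ltrz0 in n0.
  have [|s sE] := @half_rootP true y z; first by rewrite /sgn; lia.
  by apply: lspan_in; exists s; rewrite -sE.
apply: lspan_mono => {}w [s rw]; have [n1 [n2 [nE ww]]] := half_wt_space rw.
by exists n1, n2; split=> //; rewrite nE ltrz0 /sgn; lia.
Qed.

Lemma pos_part_half : pos_part Y = half false.
Proof.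
apply/seteqP; split=> [w|w].
  apply: (lspan_sub (P := half false)) => [|a u v|{}w [n1 [n2 [n0 ww]]]].
  - exact: lspan0.
  - exact: lspan_lin.
  have [->|w0] := eqVneq w 0; first exact: lspan0.
  have [y [z [rw nE]]] := wt_space_level ww w0; rewrite nE ler0z in n0.
  have yn0 : y != 0.
    by apply: contraNneq w0 => yE; apply/eqP; rewrite yE in rw; apply: emb_wroot0 rw.
  have [|s sE] := @half_rootP false y z; first by rewrite /sgn; lia.
  by apply: lspan_in; exists s; rewrite -sE.
apply: lspan_mono => {}w [s rw]; have [n1 [n2 [nE ww]]] := half_wt_space rw.
by exists n1, n2; split=> //; rewrite nE ler0z /sgn; lia.
Qed.

(** In the half of negative y the roles of E and F are exchanged: raise sg
    increases |y| in the half of sg. *)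
Definition raise (sg : bool) (i : bool) : F :=
  if sg then (if i then FibE1 K else FibE2 K) else (if i then FibF1 K else FibF2 K).
Definition cartan (i : bool) : F := if i then FibH1 K else FibH2 K.

Lemma root_raise sg (i : bool) :
  root_sp (wroot (sgn sg) (sgn sg * (i : nat)%:Z)) (val (raise sg i)).
Proof.
by case: sg i => [] []; rewrite /wroot /sgn /=;
  [exact: root_E1 | exact: root_E2 | exact: root_F1 | exact: root_F2].
Qed.

Lemma transpose_raise sg i : transpose (val (raise sg i)) = val (raise (~~ sg) i).
Proof.
by case: sg i => [] []; [exact: transpose_E1 | exact: transpose_E2
  | exact: transpose_F1 | exact: transpose_F2].
Qed.

Lemma root_cartan i : root_sp 0 (val (cartan i)).
Proof. by case: i; [exact: root_H1 | exact: root_H2]. Qed.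

Lemma transpose_cartan i : transpose (val (cartan i)) = val (cartan i).
Proof. by case: i; [exact: transpose_H1 | exact: transpose_H2]. Qed.

Lemma fib_type_ind sg (P : F -> Prop) : P 0 ->
  (forall a x y, P x -> P y -> P (a *: x + y)) ->
  (forall x y, P x -> P y -> P (lie x y)) ->
  (forall i, P (raise sg i)) -> (forall i, P (raise (~~ sg) i)) ->
  (forall i, P (cartan i)) -> forall x, P x.
Proof.
move=> P0 Pl Pb Pe Pf Pc.
have Pr s i : P (raise s i).
  by move: (Pe i) (Pf i); case: s sg {Pe Pf} => [] [].
suff H y : F y -> F y /\ forall x : F, val x = y -> P x.
  by move=> x; case: (H (val x) (asboolW (valP x))) => _; apply.
have lift_fib z : F z -> exists x : F, val x = z by move=> Fz; exists (exist _ z (asboolT Fz)).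
move: y; apply: fib_ind => [|a y z [Fy Py] [Fz Pz]|y z _ _ [Fy Py] [Fz Pz]||||||].
- split=> [|x x0]; first exact: gen_lie0.
  by have -> : x = 0 by apply: val_inj.
- split=> [|x xE]; first exact: fib_lin.
  have [[y' y'E] [z' z'E]] := (lift_fib y Fy, lift_fib z Fz).
  have -> : x = a *: y' + z' by apply: val_inj; rewrite xE -y'E -z'E.
  by apply: Pl; [apply: Py | apply: Pz].
- split=> [|x xE]; first exact: gen_lie_lie.
  have [[y' y'E] [z' z'E]] := (lift_fib y Fy, lift_fib z Fz).
  have -> : x = lie y' z' by apply: val_inj; rewrite xE -y'E -z'E.
  by apply: Pb; [apply: Py | apply: Pz].
- split=> [|x xE]; first exact: fib_E1.
  by have -> : x = raise true true by apply: val_inj.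
- split=> [|x xE]; first exact: fib_F1.
  by have -> : x = raise false true by apply: val_inj.
- split=> [|x xE]; first exact: fib_H1.
  by have -> : x = cartan true by apply: val_inj.
- split=> [|x xE]; first exact: fib_E2.
  by have -> : x = raise true false by apply: val_inj.
- split=> [|x xE]; first exact: fib_F2.
  by have -> : x = raise false false by apply: val_inj.
- split=> [|x xE]; first exact: fib_H2.
  by have -> : x = cartan false by apply: val_inj.
Qed.

Lemma act_raise sg (i : bool) y z w : root_sp (wroot y z) (emb w) ->
  root_sp (wroot (y + sgn sg) (z + sgn sg * (i : nat)%:Z)) (emb (act (raise sg i) w)).
Proof.
move=> rw; rewrite emb_act addrC (addrC z) -wrootD.
exact: root_space_lie (root_raise sg i) rw.
Qed.

(** By wroot0_gr0, x belongs to the Cartan subalgebra. *)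
Lemma act_scalar (x : F) z al w : root_sp (wroot 0 z) (val x) ->
  root_sp al (emb w) -> exists c, act x w = c *: w.
Proof.
move=> rx rw; exists (\sum_i coord i (val x) * al 0 i); apply: emb_inj.
rewrite emb_act (linearZ_prop emb_linear).
exact: (gr0_root e_neq0 (wroot0_gr0 rx) rw).
Qed.

Lemma act_cartan i al w : root_sp al (emb w) -> exists c, act (cartan i) w = c *: w.
Proof.
move=> rw; apply: (@act_scalar _ 0 _ _ _ rw).
by have := root_cartan i; rewrite -root3_0.
Qed.

Lemma half_raise sg (i : bool) s w : root_sp (half_root sg s) (emb w) ->
  root_sp (half_root sg (s.1.+1, s.2 + (i : nat)%:Z)) (emb (act (raise sg i) w)).
Proof.
move=> /(act_raise sg i); congr (root_sp (wroot _ _) _) => /=; last by rewrite mulrDr.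
by rewrite -[s.1.+2]addn1 PoszD mulrDr mulr1.
Qed.

Lemma sgnN sg : sgn (~~ sg) = - sgn sg. Proof. by case: sg. Qed.

Lemma half_lower sg (i : bool) n z w : root_sp (half_root sg (n.+1, z)) (emb w) ->
  root_sp (half_root sg (n, z - (i : nat)%:Z)) (emb (act (raise (~~ sg) i) w)).
Proof.
move=> /(act_raise (~~ sg) i); rewrite sgnN.
congr (root_sp (wroot _ _) _) => /=; last by rewrite mulrBr mulNr.
by rewrite -[n.+2]addn1 PoszD mulrDr mulr1 addrK.
Qed.

(** From |y| = 1 lowering leads to y = 0, where the complement vanishes. *)
Lemma half_lower0 sg i z w : root_sp (half_root sg (0%N, z)) (emb w) ->
  act (raise (~~ sg) i) w = 0.
Proof.
move=> /(act_raise (~~ sg) i); rewrite sgnN /= mulr1 subrr.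
exact: emb_wroot0.
Qed.

Fact half0 sg : half sg 0. Proof. exact: lspan0. Qed.
Fact half_lin sg a u v : half sg u -> half sg v -> half sg (a *: u + v).
Proof. exact: lspan_lin. Qed.
Fact half_act sg x v : half sg v -> half sg (act x v).
Proof.
move: x v; apply: (@fib_type_ind sg) => [v _|a x y IHx IHy v hv|x y IHx IHy v hv|i|i|i].
- by rewrite act0v; apply: half0.
- by rewrite act_linearl; apply: half_lin; [apply: IHx | apply: IHy].
- rewrite act_lie; apply: lspan_add; first exact/IHx/IHy.
  exact/lspan_opp/IHy/IHx.
- move=> v; apply: lspan_map; first exact: act_linearr.
  by move=> w [s rw]; apply: lspan_in; eexists; apply: half_raise rw.
- move=> v; apply: lspan_map; first exact: act_linearr.
  move=> w [[[|n] z] rw]; first by rewrite (half_lower0 i rw); apply: lspan0.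
  by apply: lspan_in; eexists; apply: half_lower rw.
- move=> v; apply: lspan_map; first exact: act_linearr.
  move=> w [s rw]; have [c ->] := act_cartan i rw.
  by apply/lspan_scale/lspan_in; exists s.
Qed.
Definition half_submod sg : submod Y :=
  Submod (half0 sg) (@half_lin sg) (@half_act sg).

Lemma half_span y : exists2 y1, half true y1 & half false (y - y1).
Proof.
elim: (Y_diag y) => [|a {}y w [mu yw] _ [y1 h1 h2]].
  by exists 0; rewrite ?subr0; apply: half0.
have [-> {yw}|y0] := eqVneq y 0; first by exists y1; rewrite // scaler0 add0r.
have [n [z [rw _]]] := wt_space_root yw y0.
have [n0|n0|n0] := ltgtP n 0.
- exists y1 => //; rewrite -addrA; apply: half_lin => //; apply: lspan_in.
  by have [|s sE] := @half_rootP false n z; [rewrite /sgn; lia | exists s; rewrite -sE].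
- exists (a *: y + y1); last by rewrite opprD addrACA subrr add0r.
  apply: half_lin => //; apply: lspan_in.
  by have [|s sE] := @half_rootP true n z; [rewrite /sgn; lia | exists s; rewrite -sE].
- by rewrite n0 in rw; rewrite (emb_wroot0 rw) eqxx in y0.
Qed.

(** The two halves are orthogonal. *)
Lemma half_disjoint y : half true y -> half false y -> y = 0.
Proof.
have orth s s' w w' : root_sp (half_root true s) (emb w) ->
    root_sp (half_root false s') (emb w') -> herm (emb w) (emb w') = 0.
  move=> rw rw'; apply: (herm_root_orth e_neq0 rw rw'); apply/eqP => /wroot_inj[].
  by rewrite /sgn; lia.
move=> ht hf; apply/eqP; apply: contraT => /herm_emb_pos.
suff -> : herm (emb y) (emb y) = 0 by rewrite ltxx.
apply: (lspan_sub (P := fun w => herm (emb w) (emb y) = 0) _ _ _ ht).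
- by rewrite (linear0_prop emb_linear) (herm0l hL).
- by move=> a u v uE vE; rewrite emb_linear hL uE vE mulr0 addr0.
move=> w [s rw]; apply: (lspan_sub (P := fun w' => herm (emb w) (emb w') = 0) _ _ _ hf).
- by rewrite (linear0_prop emb_linear) (herm0r hL hC).
- move=> a u v uE vE; rewrite emb_linear (hermDr hL hC) (hermZr hL hC).
  by rewrite uE vE mulr0 addr0.
by move=> w' [s' rw']; apply: orth rw rw'.
Qed.

Definition extremal_weight_module (sg : bool) (W : lieModType F) : Prop :=
  if sg then lowest_weight_module W else highest_weight_module W.

(** The form herm, pulled back by the embedding, makes the half unitarizable
    with level n = |y| - 1. *)
Lemma half_decomposition sg :
  direct_sum_of (extremal_weight_module sg) (half_submod sg).
Proof.
pose emb' (v : half_submod sg) := emb (val v).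
have eL : linear emb' by move=> a u v; rewrite /emb' emb_linear.
have e_act (x : F) v : emb' (act x v) = lie (val x) (emb' v) by rewrite /emb' emb_act.
have vinj (u v : half_submod sg) : val u = val v -> u = v by apply: val_inj.
apply: (@unitarizable_decomposition _ _ _ (fun u v => herm (emb' u) (emb' v)) _ _ _
  (nat * int)%type (fun s v => root_sp (half_root sg s) (emb' v)) (fun s => s.1)
  _ _ _ _ _ bool (raise sg) (raise (~~ sg)) cartan).
- by move=> a u v w; rewrite eL hL.
- by move=> u v; exact: hC.
- by move=> v nz; rewrite gt_eqF // herm_emb_pos //.
- by move=> s; rewrite (linear0_prop eL); apply: root_space_0.
- by move=> s a u v ru rv; rewrite eL; apply: root_space_lin.
- move=> v; have hv : half sg (val v) by apply: asboolW (valP v).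
  apply: lspan_mono (lspan_submod _ hv) => [w [s rw]|w [s rw]]; first by exists s.
  by apply: lspan_in; exists s.
- move=> s s' v w ss rv rw; apply: (herm_root_orth e_neq0 rv rw).
  apply: contra_neq ss => /wroot_inj[]; case: s s' {rv rw} => [n z] [n' z'] /=.
  by rewrite /sgn => H1 H2; congr (_, _); case: (sg) H1 H2; lia.
- move=> s; have s0 : half_root sg s != 0.
    rewrite -root3_0; apply/eqP => /root3_inj[_ + _]; rewrite /sgn.
    by case: (sg); lia.
  have [us usP] := root_separating e_neq0 s0.
  exists (size us), (fun i v => herm (emb' v) (nth 0 us i)); split.
    by move=> i a u v; rewrite eL hL.
  move=> v rv vs; apply/vinj/emb_inj0; apply: usP rv _ => u /(nthP 0)[i ius <-].
  exact: vs.
- exact: fib_type_ind.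
- by move=> i v w; rewrite !e_act (herm_adjoint e_neq0) transpose_raise.
- by move=> i v w; rewrite !e_act (herm_adjoint e_neq0) transpose_cartan.
- by move=> i s v rv; eexists; apply: half_raise rv.
- move=> i s v rv; have [c cE] := act_cartan i rv; exists c; exact: vinj.
- move=> i [[|n] z] v rv; first by left; apply/vinj/(half_lower0 i rv).
  right; exists (n, z - (i : nat)%:Z); split=> //; first exact: half_lower rv.
  by move=> u /(half_raise i) /=; rewrite subrK.
- move=> i j s v rv.
  have rij : root_sp (wroot 0 (sgn sg * ((i : nat)%:Z - (j : nat)%:Z)))
      (val (lie (raise (~~ sg) j) (raise sg i))).
    have := root_space_lie (root_raise (~~ sg) j) (root_raise sg i).
    rewrite wrootD sgnN addNr; congr (root_sp (wroot _ _) _).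
    by rewrite mulrBr addrC mulNr.
  have [c cE] := act_scalar rij rv; exists c; apply: vinj.
  by have := cE; rewrite act_lie => /eqP; rewrite subr_eq addrC => /eqP.
move=> s v v0 rv Fv; have [v' v'E gen] := gen_submod_cyclic v.
have v'0 : v' != 0 by apply: contraNneq v0 => v'z; rewrite -v'E v'z.
have wv : wt_space (fib_restr (half_root sg s)) v'.
  move=> a b; apply: val_inj; apply: vinj; rewrite /= v'E.
  exact: root_wt_space rv a b.
have Fv' i : act (raise (~~ sg) i) v' = 0 by apply: val_inj; rewrite /= v'E Fv.
have [sgE|sgE] : sg = true \/ sg = false by case: (sg); [left | right].
  rewrite /extremal_weight_module [X in if X then _ else _]sgE.
  exists v', (fib_restr (half_root sg s)); split=> //.
    by have -> : FibF1 K = raise (~~ sg) true by rewrite sgE.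
  by have -> : FibF2 K = raise (~~ sg) false by rewrite sgE.
rewrite /extremal_weight_module [X in if X then _ else _]sgE.
exists v', (fib_restr (half_root sg s)); split=> //.
  by have -> : FibE1 K = raise (~~ sg) true by rewrite sgE.
by have -> : FibE2 K = raise (~~ sg) false by rewrite sgE.
Qed.

End Halves.

(** * The decomposition of Fib(0) *)

Section Decomposition.
Variable K : numClosedFieldType.
Notation L := (Falg K).
Notation h := (km_h K A3).
Notation e := (km_e K A3).
Notation f := (km_f K A3).
Notation F := (Fib K).
Notation herm := (@herm K).
Notation Vfib := (sum_submod (V0 K) (FibAd K)).
Notation Y := (Y0 K).

Definition decomposition_statement : Prop := exists Ym Yp : submod Y,
  [/\ submod_set Ym = neg_part Y, submod_set Yp = pos_part Y,
      mod_iso (Fib0 K) (V0 K * FibAd K * Ym * Yp)%type,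
      direct_sum_of (@lowest_weight_module K) Ym
    & direct_sum_of (@highest_weight_module K) Yp].

Section Nontrivial.
Hypothesis e_neq0 : forall j, e j != 0.
Let hL := herm_linl e_neq0.
Let hC := herm_conjC e_neq0.
Notation perp := (perp e_neq0).

Lemma perp_disjoint v : perp v -> Vfib v -> v = 0.
Proof.
move=> pv [v1 [v2 [[c v1E] Fv2 vE]]]; apply/eqP; apply: contraT => /(perp_pos pv).
suff -> : herm (val v) (val v) = 0 by rewrite ltxx.
have -> : herm (val v) (val v) = herm (val v) (c *: hV0 K + val v2) by rewrite {2}vE /= v1E.
case: pv => p0 pF; rewrite (hermDr hL hC) (hermZr hL hC) [X in _ * X]p0 [X in _ + X]pF //.
by rewrite mulr0 addr0.
Qed.

Lemma perp_complement v : exists2 v1, perp v1 & Vfib (v - v1).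
Proof.
have [c [u [Fu p q]]] := fib0_decomposition e_neq0 (asboolW (valP v)).
have fu : u \in submod_pred (Fib0 K) by exact: asboolT (fib_sub_fib0 Fu).
have fh : c *: hV0 K \in submod_pred (Fib0 K).
  exact: asboolT (lspan_scale c (hV0_fib0 K)).
pose v1 : Fib0 K := exist _ (c *: hV0 K) fh; pose v2 : Fib0 K := exist _ u fu.
exists (v - (v1 + v2)); first by split.
by rewrite opprB addrCA subrr addr0; exists v1, v2; split=> //; exists c.
Qed.

Definition to_perp : Fib0 K -> perp := sval (cid (submod_projection perp_disjoint perp_complement)).

Lemma to_perpP : [/\ linear to_perp, forall x v, to_perp (act x v) = act x (to_perp v),
    forall n : perp, to_perp (val n) = n & forall v, Vfib v -> to_perp v = 0]
    /\ forall v, Vfib (v - val (to_perp v)).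
Proof. by rewrite /to_perp; case: (cid _). Qed.

(** As perp is a complement of V0 + Fib, this is an equivariant section of the
    quotient map. *)
Definition lift (y : Y) : Fib0 K := val (to_perp (repr y)).

Lemma lift_pi v : lift (quot_pi Vfib v) = val (to_perp v).
Proof.
have [[tl _ _ t0] _] := to_perpP; congr val; apply/eqP; rewrite -subr_eq0.
by rewrite -(linearN_prop tl) -(linearD_prop tl) t0 //; apply: quot_repr.
Qed.

Lemma lift_linear : linear lift.
Proof.
move=> a; elim/quot_ind=> u; elim/quot_ind=> v.
have [[tl _ _ _] _] := to_perpP.
have <- : quot_pi Vfib (a *: u + v) = a *: quot_pi Vfib u + quot_pi Vfib v :> Y.
  exact: quot_pi_linear.
rewrite (lift_pi (a *: u + v)) (lift_pi u) (lift_pi v) tl.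
exact: linearP.
Qed.

Lemma lift_act x y : lift (act x y) = act x (lift y).
Proof.
elim/quot_ind: y => v; have [[_ ta _ _] _] := to_perpP.
by rewrite [act x _]quot_actE !lift_pi ta.
Qed.

Lemma lift_perp y : perp (lift y).
Proof. exact: asboolW (valP (to_perp (repr y))). Qed.

Lemma pi_lift y : quot_pi Vfib (lift y) = y.
Proof.
elim/quot_ind: y => v; rewrite lift_pi; apply/quot_piP.
have [_ tN] := to_perpP; rewrite -opprB -scaleN1r -[_ *: _]addr0.
by apply: submod_lin; [exact: tN | exact: submod0].
Qed.

Lemma lift_inj0 y : lift y = 0 -> y = 0.
Proof.
by move=> y0; rewrite -(pi_lift y) y0; apply: (linear0_prop (@quot_pi_linear _ _ _ Vfib)).
Qed.

Lemma sum_submodl (V : lieModType F) (N1 N2 : submod V) v : N1 v -> sum_submod N1 N2 v.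
Proof. by move=> Nv; exists v, 0; rewrite addr0; split=> //; apply: submod0. Qed.
(** Being orthogonal, perp meets V0 + Fib only in 0; and V0 meets Fib only in 0
    because hV0 is orthogonal to Fib but not to itself. *)
Lemma three_disjoint a u p : V0 K a -> FibAd K u -> perp p -> a + u + p = 0 ->
  [/\ a = 0, u = 0 & p = 0].
Proof.
move=> Va Fu Pp s0; have au : a + u = - p by apply/eqP; rewrite -addr_eq0 s0.
have Pau : perp (a + u).
  by rewrite au -scaleN1r -[_ *: _]addr0; apply: submod_lin => //; apply: submod0.
have au0 : a + u = 0 by apply: (perp_disjoint Pau); exists a, u; split.
have p0 : p = 0 by rewrite au0 add0r in s0.
have uE : u = - a by apply/eqP; rewrite -addr_eq0 addrC au0.
have [c aE] := Va; have c0 : c = 0.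
  apply: (V0_fib_disjoint e_neq0); rewrite -aE -[val a]opprK; apply: fib_opp.
  by move: Fu; rewrite uE.
have a0 : a = 0 by apply: val_inj; rewrite aE c0 scale0r.
by split=> //; rewrite uE a0 oppr0.
Qed.

Lemma three_sum v : exists a u p, [/\ V0 K a, FibAd K u, perp p & v = a + u + p].
Proof.
have [p Pp [a [u [Va Fu vE]]]] := perp_complement v.
by exists a, u, p; split=> //; rewrite -vE subrK.
Qed.

Lemma V0_projection : exists p : Fib0 K -> V0 K,
  [/\ linear p, forall x v, p (act x v) = act x (p v), forall n : V0 K, p (val n) = n
    & forall v, sum_submod (FibAd K) perp v -> p v = 0].
Proof.
have [v Va [u [p [Fu Pp vE]]]|v|p [pP _]] := @submod_projection _ _ _ (V0 K)
  (sum_submod (FibAd K) perp); last by exists p.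
- have [|||//] := @three_disjoint v (- u) (- p) Va.
  + by rewrite -scaleN1r -[_ *: _]addr0; apply: submod_lin => //; apply: submod0.
  + by rewrite -scaleN1r -[_ *: _]addr0; apply: submod_lin => //; apply: submod0.
  + by rewrite -addrA -opprD vE subrr.
- have [a [u [p [Va Fu Pp ->]]]] := three_sum v; exists a => //.
  by rewrite addrC !addrA addNr add0r; exists u, p.
Qed.

Lemma FibAd_projection : exists p : Fib0 K -> FibAd K,
  [/\ linear p, forall x v, p (act x v) = act x (p v), forall n : FibAd K, p (val n) = n
    & forall v, sum_submod (V0 K) perp v -> p v = 0].
Proof.
have [v Fv [u [p [Vu Pp vE]]]|v|p [pP _]] := @submod_projection _ _ _ (FibAd K)
  (sum_submod (V0 K) perp); last by exists p.
- have [||||//] := @three_disjoint (- u) v (- p).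
  + by rewrite -scaleN1r -[_ *: _]addr0; apply: submod_lin => //; apply: submod0.
  + by [].
  + by rewrite -scaleN1r -[_ *: _]addr0; apply: submod_lin => //; apply: submod0.
  + by rewrite addrAC -opprD vE addNr.
- have [a [u [p [Va Fu Pp ->]]]] := three_sum v; exists u => //.
  by rewrite addrAC addrK; exists a, p.
Qed.

Notation Yhalf := (half_submod lift_linear lift_act lift_perp lift_inj0).
Notation Yhalf_span := (half_span lift_linear lift_act lift_perp lift_inj0 (@Y0_diagonalizable K)).
Notation Yhalf_disjoint := (half_disjoint lift_linear lift_perp lift_inj0).

Lemma half_projection sg : exists p : Y -> Yhalf sg,
  [/\ linear p, forall x v, p (act x v) = act x (p v), forall n : Yhalf sg, p (val n) = n
    & forall v, Yhalf (~~ sg) v -> p v = 0]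
  /\ forall v, Yhalf (~~ sg) (v - val (p v)).
Proof.
have [v h1 h2|v|p pP] := @submod_projection _ _ _ (Yhalf sg) (Yhalf (~~ sg));
  last by exists p.
- by case: sg h1 h2 => h1 h2; apply: Yhalf_disjoint.
- have [y1 h1 h2] := Yhalf_span v; case: sg; first by exists y1.
  by exists (v - y1) => //; rewrite opprB addrCA subrr addr0.
Qed.

Lemma nontrivial_decomposition : decomposition_statement.
Proof.
exists (Yhalf true), (Yhalf false); split.
- exact/esym/(neg_part_half lift_linear lift_act lift_inj0).
- exact/esym/(pos_part_half lift_linear lift_act lift_perp lift_inj0).
- have [pV [Vl Va Vid Vz]] := V0_projection.
  have [pF [Fl Fa Fid Fz]] := FibAd_projection.
  have [q1 [[l1 a1 id1 z1] r1]] := half_projection true.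
  have [q2 [[l2 a2 id2 z2] _]] := half_projection false.
  pose pi := quot_pi Vfib.
  have pil : linear pi := @quot_pi_linear _ _ _ Vfib.
  have pi_act x v : pi (act x v) = act x (pi v) by rewrite /pi -quot_actE.
  have Vsub (n : V0 K) : V0 K (val n) := asboolW (valP n).
  have Fsub (n : FibAd K) : FibAd K (val n) := asboolW (valP n).
  have Hsub sg (n : Yhalf sg) : Yhalf sg (val n) := asboolW (valP n).
  apply: (@mod_iso_bij _ _ _ _ (fun v => (pV v, pF v, q1 (pi v), q2 (pi v)))).
  + by move=> a u v; rewrite Vl Fl pil l1 l2.
  + by move=> x v; rewrite pi_act Va Fa a1 a2.
  + move=> v E; have pV0 : pV v = 0 := congr1 (fun t => t.1.1.1) E.
    have pF0 : pF v = 0 := congr1 (fun t => t.1.1.2) E.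
    have q10 : q1 (pi v) = 0 := congr1 (fun t => t.1.2) E.
    have q20 : q2 (pi v) = 0 := congr1 (fun t => t.2) E.
    have h2 : Yhalf false (pi v) by have := r1 (pi v); rewrite q10 subr0.
    pose n : Yhalf false := exist _ (pi v) (asboolT h2).
    have piv : pi v = pi 0.
      by rewrite (linear0_prop pil) -[LHS]/(val n) -(id2 n) [q2 _]q20.
    have [a [u [Na Nu vE]]] := proj1 (quot_piP Vfib v 0) piv.
    rewrite subr0 in vE.
    pose na : V0 K := exist _ a (asboolT Na); pose nu : FibAd K := exist _ u (asboolT Nu).
    have a0 : na = 0.
      rewrite -(Vid na) -[RHS]pV0 vE (linearD_prop Vl) [pV u]Vz ?addr0 //.
      exact: sum_submodl.
    have u0 : nu = 0.
      rewrite -(Fid nu) -[RHS]pF0 vE (linearD_prop Fl) [pF a]Fz ?add0r //.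
      exact: sum_submodl.
    by rewrite vE -[a]/(val na) -[u]/(val nu) a0 u0 addr0.
  + move=> [[[a b] y1] y2]; set w := lift (val y1 + val y2).
    exists (val a + val b + w).
    have Pw : perp w by apply: lift_perp.
    have pia : pi (val a + val b) = 0.
      rewrite -(linear0_prop pil); apply/quot_piP; rewrite subr0.
      by exists (val a), (val b); split; [apply: Vsub | apply: Fsub |].
    have piE : pi (val a + val b + w) = val y1 + val y2.
      by rewrite (linearD_prop pil) pia add0r; apply: pi_lift.
    have qE1 : q1 (pi (val a + val b + w)) = y1.
      rewrite piE (linearD_prop l1) id1 z1 ?addr0 //; exact: (Hsub false).
    have qE2 : q2 (pi (val a + val b + w)) = y2.
      rewrite piE (linearD_prop l2) id2 z2 ?add0r //; exact: (Hsub true).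
    have VE : pV (val a + val b + w) = a.
      rewrite -addrA (linearD_prop Vl) Vid Vz ?addr0 //.
      by exists (val b), w; split=> //; apply: Fsub.
    have FE : pF (val a + val b + w) = b.
      rewrite addrAC (linearD_prop Fl) Fid Fz ?add0r //.
      by exists (val a), w; split=> //; apply: Vsub.
    by rewrite qE1 qE2 VE FE.
- exact: (half_decomposition lift_linear lift_act lift_perp lift_inj0 true).
- exact: (half_decomposition lift_linear lift_act lift_perp lift_inj0 false).
Qed.

End Nontrivial.

(** Since the diagram of A is connected, a single relation e j = 0 collapses
    the whole algebra. *)
Lemma e0_trivial j : e j = 0 -> forall x : L, x = 0.
Proof.
move=> ej0; have step i k : e i = 0 -> A3 i k != 0 -> e k = 0.
  move=> ei0 ik; have hi : h i = 0.
    by have := km_ef K A3 i i; rewrite eqxx ei0 lie0x.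
  have := km_he K A3 i k; rewrite hi lie0x => /esym/eqP.
  by rewrite scaler_eq0 intr_eq0 (negPf ik) => /eqP.
have e2 : e i2 = 0.
  move: j ej0; apply: ord3_ind => // [e1|e3].
    by apply: (step i1) => //; rewrite mxE.
  by apply: (step i3) => //; rewrite mxE.
have e0 i : e i = 0.
  move: i; apply: ord3_ind => //; first by apply: (step i2) => //; rewrite mxE.
  by apply: (step i2) => //; rewrite mxE.
have h0 i : h i = 0 by have := km_ef K A3 i i; rewrite eqxx e0 lie0x.
have f0 i : f i = 0.
  have := km_hf K A3 i i; rewrite h0 lie0x => /esym/eqP.
  rewrite scaler_eq0 oppr_eq0 intr_eq0.
  have -> : (A3 i i == 0) = false by move: i; apply: ord3_ind; rewrite mxE.
  by move/eqP.
apply: pres_alg_ind => [//|a x y -> ->|x y -> _|[] i].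
- by rewrite scaler0 addr0.
- by rewrite lie0x.
- exact: h0.
- exact: e0.
- exact: f0.
Qed.

Lemma trivial_direct_sum (V : lieModType F) (P : lieModType F -> Prop) :
  (forall v : V, v = 0) -> direct_sum_of P V.
Proof.
move=> V0; exists void, (fun i : void => match i with end).
by split=> [[]|v|r w _ _ _ []]; rewrite (V0 v); apply: lspan0.
Qed.

Lemma trivial_decomposition : (forall x : L, x = 0) -> decomposition_statement.
Proof.
move=> L0; have fib0_0 (v : Fib0 K) : v = 0 by apply: val_inj; apply: L0.
have Y_0 (y : Y) : y = 0.
  elim/quot_ind: y => v; rewrite (fib0_0 v).
  exact: (linear0_prop (@quot_pi_linear _ _ _ Vfib)).
have sub (S : set Y) : S 0 -> exists N : submod Y, submod_set N = S.
  move=> S0; have all v : S v by rewrite (Y_0 v).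
  by exists (@Submod _ _ Y S S0 (fun _ _ _ _ _ => all _) (fun _ _ _ => all _)).
have [Ym YmE] := sub (neg_part Y) (lspan0 _).
have [Yp YpE] := sub (pos_part Y) (lspan0 _).
have sub0 (N : submod Y) (v : N) : v = 0 by apply: val_inj; apply: Y_0.
exists Ym, Yp; split=> //.
- apply: (@mod_iso_bij _ _ _ _ (fun=> 0)) => [a u v|x v|v _|[[[a b] y1] y2]].
  + by rewrite scaler0 addr0.
  + by rewrite actx0.
  + exact: fib0_0.
  + exists 0; rewrite (sub0 _ y1) (sub0 _ y2).
    have -> : a = 0 by apply: val_inj; apply: fib0_0.
    by have -> : b = 0 by apply: val_inj; apply: fib0_0.
- exact/trivial_direct_sum/sub0.
- exact/trivial_direct_sum/sub0.
Qed.

Lemma Fib0_decomposition : decomposition_statement.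
Proof.
have [e_neq0|] := pselect (forall j, e j != 0); first exact: nontrivial_decomposition.
by move=> /existsNP[j /negP/negPn/eqP/e0_trivial]; apply: trivial_decomposition.
Qed.

End Decomposition.

Local Open Scope complex_scope.

Theorem theorem4p4 (R : realType) :
  exists Ym Yp : submod (Y0 R[i]),
    [/\ submod_set Ym = neg_part (Y0 R[i]),
        submod_set Yp = pos_part (Y0 R[i]),
        mod_iso (Fib0 R[i]) (V0 R[i] * FibAd R[i] * Ym * Yp)%type,
        direct_sum_of (@lowest_weight_module R[i]) Ym
      & direct_sum_of (@highest_weight_module R[i]) Yp].
Proof. exact: (Fib0_decomposition R[i]). Qed.
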